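(* Let $X_t,Y_t$ be symmetric Lévy processes in $\mathbb{R}^d$ with triplets $(0,\nu^X,0)$, $(0,\nu^Y,0)$ (nonzero) and bounded transition densities, let $D$ be a bounded open set, and suppose $\sigma=\nu^X-\nu^Y$ is a nonnegative finite measure. Suppose that $X$ or $Y$ satisfies Property A on $D$. Then there is a constant $C=C(\sigma,D)$ such that for every $x\in D$, \[G^Y_D(x,y)\le C\,G^X_D(x,y)\quad\text{for a.e. } y.\]
   Context: For a process $X$ with transition density $p(t,x,y)=p(t,y-x)$: $\tau_D=\inf\{t>0:X_t\notin D\}$; $p_D(t,x,y)=p(t,x,y)-E^x[t\ge\tau_D;\,p(t-\tau_D,X_{\tau_D},y)]$; Green function $G_D(x,y)=\int_0^\infty p_D(t,x,y)dt$. Property A for a process on $D$: there is a constant $c=c(D)$ such that $E^x\tau_D\,E^y\tau_D\le c\,G_D(x,y)$ for all $x,y\in D$.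
   Formalization: The constant C is allowed to depend on the processes X and Y (as does the Property A constant), not only on σ and D: dependence on σ and D alone fails, e.g. for Y with Lévy measure aν, ν stable, a→0, with σ and D fixed. *)

(* Defs.v *)
From HB Require Import structures.
From mathcomp Require Import all_boot all_order all_algebra.
From mathcomp Require Import all_classical all_reals all_analysis.
Set Implicit Arguments. Unset Strict Implicit. Unset Printing Implicit Defensive.
Import Order.TTheory GRing.Theory Num.Theory.
Import numFieldNormedType.Exports.
Local Open Scope classical_set_scope.
Local Open Scope ring_scope.

Section Levy.
Variable R : realType.

(* R^d is modelled as d.-tuple R, with the product (Borel) sigma-algebra. *)
Definition vsub d (a b : d.-tuple R) : d.-tuple R := [tuple tnth a i - tnth b i | i < d].
Definition vneg d (a : d.-tuple R) : d.-tuple R := [tuple - tnth a i | i < d].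
Definition dotv d (a b : d.-tuple R) : R := \sum_(i < d) tnth a i * tnth b i.
Definition sqnorm d (a : d.-tuple R) : R := \sum_(i < d) tnth a i ^+ 2.

Arguments vsub {d}. Arguments vneg {d}. Arguments dotv {d}. Arguments sqnorm {d}.

Fixpoint lebR (n : nat) : (n.-tuple R -> \bar R) -> \bar R :=
  match n return (n.-tuple R -> \bar R) -> \bar R with
  | 0 => fun f => f [tuple]
  | n'.+1 => fun f =>
      (\int[@lebesgue_measure R]_x lebR (fun t : n'.-tuple R => f [tuple of x :: t]))%E
  end.

Definition ae_leb d (Q : d.-tuple R -> Prop) : Prop :=
  exists N : set (d.-tuple R), measurable N /\
    lebR (fun y => (\1_N y)%:E) = 0%E /\ forall y, ~ N y -> Q y.

Definition open_Rd d (D : set (d.-tuple R)) : Prop :=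
  forall x, D x -> exists e : R, 0 < e /\
    forall y, (forall i, `|tnth y i - tnth x i| < e) -> D y.

Definition bounded_Rd d (D : set (d.-tuple R)) : Prop :=
  exists M : R, forall x, D x -> forall i, `|tnth x i| <= M.

Definition continuous_tuple d (f : d.-tuple R -> R) : Prop :=
  forall y (e : R), 0 < e -> exists del : R, 0 < del /\
    forall z, (forall i, `|tnth z i - tnth y i| < del) -> `|f z - f y| < e.

Definition levy_exponent d (nu : {measure set (d.-tuple R) -> \bar R}) (xi : d.-tuple R) : R :=
  fine (\int[nu]_z (1 - cos (dotv xi z))%:E)%E.

Definition symmetric_levy_measure d (nu : {measure set (d.-tuple R) -> \bar R}) : Prop :=
  nu [set [tuple 0 | _ < d]] = 0%E /\
  (\int[nu]_z (Num.min 1 (sqnorm z))%:E < +oo)%E /\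
  (forall A : set (d.-tuple R), measurable A -> nu (vneg @` A) = nu A) /\
  nu setT != 0%E.

(* X is (a cadlag version of) the symmetric Levy process with triplet
   (0, nu, 0), started at x under P x, with transition density
   p(t,x,y) = p t (y - x), bounded for each t > 0. *)
Definition sym_levy_process d (dO : measure_display) (O : measurableType dO)
    (P : d.-tuple R -> probability O R) (X : R -> O -> d.-tuple R)
    (nu : {measure set (d.-tuple R) -> \bar R}) (p : R -> d.-tuple R -> R) : Prop :=
  symmetric_levy_measure nu /\
  (forall t, 0 <= t -> measurable_fun setT (X t)) /\
  (forall x, P x [set w | X 0 w = x] = 1%E) /\
  (forall w t (i : 'I_d), 0 <= t ->
     (fun s => tnth (X s w) i) @ t^'+ --> tnth (X t w) i) /\
  (forall w t (i : 'I_d), 0 < t -> cvg ((fun s => tnth (X s w) i) @ t^'-)) /\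
  (* finite dimensional distributions: independent stationary increments
     with characteristic function exp(-t psi) *)
  (forall x (n : nat) (h : 'I_n -> R) (xi : 'I_n -> d.-tuple R),
     (forall k, 0 <= h k) ->
     let S (k : nat) := \sum_(j < n | (j < k)%N) h j in
     let phase w := \sum_(k < n) dotv (xi k) (vsub (X (S k.+1) w) (X (S k) w)) in
     (\int[P x]_w (cos (phase w))%:E =
        (\prod_(k < n) expR (- (h k * levy_exponent nu (xi k))))%:E)%E /\
     (\int[P x]_w (sin (phase w))%:E = 0)%E) /\
  (forall t, 0 < t ->
     (forall y, 0 <= p t y) /\ (exists M : R, forall y, p t y <= M) /\
     continuous_tuple (p t) /\
     forall x (A : set (d.-tuple R)), measurable A ->
       P x [set w | A (vsub (X t w) (X 0 w))] = lebR (fun y => (\1_A y * p t y)%:E)).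

Definition exit_time d (O : Type) (X : R -> O -> d.-tuple R) (D : set (d.-tuple R))
    (w : O) : \bar R :=
  ereal_inf [set t%:E | t in [set t : R | 0 < t /\ ~ D (X t w)]].

Definition killed_density d (dO : measure_display) (O : measurableType dO)
    (P : d.-tuple R -> probability O R) (X : R -> O -> d.-tuple R)
    (p : R -> d.-tuple R -> R) (D : set (d.-tuple R)) (t : R) (x y : d.-tuple R) : \bar R :=
  ((p t (vsub y x))%:E -
   \int[P x]_w (if (exit_time X D w < t%:E)%E then
                  (p (t - fine (exit_time X D w))
                     (vsub y (X (fine (exit_time X D w)) w)))%:E
                else 0%E))%E.

Definition green d (dO : measure_display) (O : measurableType dO)
    (P : d.-tuple R -> probability O R) (X : R -> O -> d.-tuple R)
    (p : R -> d.-tuple R -> R) (D : set (d.-tuple R)) (x y : d.-tuple R) : \bar R :=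
  (\int[@lebesgue_measure R]_(t in `]0%R, +oo[) killed_density P X p D t x y)%E.

Definition expected_exit d (dO : measure_display) (O : measurableType dO)
    (P : d.-tuple R -> probability O R) (X : R -> O -> d.-tuple R)
    (D : set (d.-tuple R)) (x : d.-tuple R) : \bar R :=
  (\int[P x]_w exit_time X D w)%E.

Definition propertyA d (dO : measure_display) (O : measurableType dO)
    (P : d.-tuple R -> probability O R) (X : R -> O -> d.-tuple R)
    (p : R -> d.-tuple R -> R) (D : set (d.-tuple R)) : Prop :=
  exists c : R, forall x y, D x -> D y ->
    (expected_exit P X D x * expected_exit P X D y <= c%:E * green P X p D x y)%E.

End Levy.

(* Main.v *)
Require Import Defs.

From HB Require Import structures.
From mathcomp Require Import all_boot all_order all_algebra.
From mathcomp Require Import all_classical all_reals all_analysis.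
From mathcomp Require Import measurable_realfun ring lra.
Set Implicit Arguments. Unset Strict Implicit. Unset Printing Implicit Defensive.
Import Order.TTheory GRing.Theory Num.Theory.
Import numFieldNormedType.Exports HBNNSimple.
Local Open Scope classical_set_scope.
Local Open Scope ring_scope.

(** Write [Q_t(x, A)] for the probability, from [x], that the process has not left [D] up to time [t] and is
in [A] at time [t]; then [\int_A G_D(x, y) dy = \int_0^oo Q_t(x, A) dt], and all estimates are made on [Q].
After symmetrization of [sigma], [X] has the law of the sum of [Y] and of an independent compound Poisson
process with finite total rate [m]. On the event that the latter does not jump, of probability [e^(-m t)],
the two increments agree, so that [Q^Y_t <= e^(m t) Q^X_t]. For bounded times this is the comparison
wanted. For large times, the semigroup property, the bound on the densities at time 1, the symmetry of [Q]
and the exponential decay of [Q_t(x, D)] give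
[\int_(T + 3)^oo Q^Y_t(x, A) dt <= K q^T Q^Y_1(x, D) \int_A Q^Y_1(y, D) dy] with [q < 1]. Since
[Q_1(x, D)] is at most the mean exit time, Property A for [X] bounds the right-hand side by a multiple of
[\int_A G^X_D(x, y) dy] (as [Q^Y_1 <= e^m Q^X_1]); Property A for [Y] bounds it by a multiple of
[q^T \int_A G^Y_D(x, y) dy], which is absorbed in the left-hand side for [T] large. *)

(** * Characteristic functions determine laws *)

(** The processes live on unrelated probability spaces and are known only through the laws of their
    increments, so paths are never coupled. Survival is instead a limit of chains of transition
    operators at dyadic times: each step costs a factor [expR (m * r)], and the factors multiply to
    [expR (m * t)] whatever the mesh. Right-continuous paths can be tested at dyadic times only
    against closed sets, hence survival means staying in one of the closed sets [inner D n]. Its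
    end, [lifetime], may precede the exit time of the definition, when the path approaches the
    boundary and jumps back into [D] at that very moment; that this almost surely does not happen is
    the quasi-left-continuity of Levy processes, proved here by a discrete strong Markov argument.
    The second obstacle is the link between [killed_density], an expectation at the exit time, and
    [Q_t]: it is the strong Markov property at [lifetime], obtained on characteristic functions by
    stopping a martingale. It identifies the integrals of the density over sets only, which is why
    the Green functions are compared for almost every [y]. *)

Section threshold.
Context {R : realType}.
Implicit Types s r : R.

Lemma bernoulli_le (a : R) n : 0 <= a -> 1 + n%:R * a <= (1 + a) ^+ n.
Proof.
move=> a0; elim: n => [|n IH]; first by rewrite expr0 mul0r addr0.
rewrite exprS; apply: (@le_trans _ _ ((1 + a) * (1 + n%:R * a))).
  rewrite -natr1; have : 0 <= n%:R * a * a by rewrite !mulr_ge0.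
  nra.
by rewrite ler_wpM2l// addr_ge0.
Qed.

Lemma one_sub_exp_ge (q : R) n : 0 <= q <= 1 -> 1 - n%:R * q <= (1 - q) ^+ n.
Proof.
move=> /andP[q0 q1]; elim: n => [|n IH]; first by rewrite expr0 mul0r subr0.
rewrite exprS; apply: (@le_trans _ _ ((1 - q) * (1 - n%:R * q))).
  rewrite -natr1; have : 0 <= n%:R * q * q by rewrite !mulr_ge0.
  nra.
by rewrite ler_wpM2l// subr_ge0.
Qed.

(** Multiply by [1 + n%:R * q], which is at most [(1 + q) ^+ n]: the product is at most
    [(1 - q ^+ 2) ^+ n <= 1]. *)
Lemma one_sub_exp_le (q : R) n : 0 <= q <= 1 -> (1 - q) ^+ n <= (1 + n%:R * q)^-1.
Proof.
move=> /andP[q0 q1].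
have h : 0 < 1 + n%:R * q by rewrite ltr_wpDr// mulr_ge0.
rewrite -div1r ler_pdivlMr// (le_trans (ler_wpM2l _ (bernoulli_le n q0)))//.
  by rewrite exprn_ge0// subr_ge0.
rewrite -exprMn exprn_ile1//; first by rewrite mulr_ge0 ?subr_ge0 ?addr_ge0.
nra.
Qed.

(** Split [r] as [q * q]. By Bernoulli applied to [q^-1 = 1 + a], one factor keeps [n%:R * q ^+ n]
    below [a^-1], and the other tends to 0. *)
Lemma cvg_nat_expr (r : R) : 0 <= r < 1 -> (n%:R * r ^+ n) @[n --> \oo] --> (0 : R).
Proof.
move=> /andP[r0 r1].
have [->|rn0] := eqVneq r 0.
  apply: cvg_near_cst; near=> n; rewrite expr0n.
  have -> : (n == 0%N) = false by apply/negbTE; rewrite -lt0n; near: n; exists 1%N.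
  by rewrite mulr0.
have rp : 0 < r by rewrite lt_neqAle eq_sym rn0.
pose q := Num.sqrt r.
have q0 : 0 < q by rewrite sqrtr_gt0.
have q1 : q < 1 by rewrite -sqrtr1 ltr_sqrt.
pose a := q^-1 - 1.
have a0 : 0 < a by rewrite subr_gt0 invf_gt1.
have a1 : 0 < 1 + a by lra.
have qa : q = (1 + a)^-1 by rewrite /a addrC subrK invrK.
apply: (@squeeze_cvgr _ _ _ _ (fun=> 0) (fun n => a^-1 * q ^+ n)).
- near=> n; apply/andP; split; first by rewrite mulr_ge0// exprn_ge0.
  have -> : r = q * q by rewrite -expr2 sqr_sqrtr// ltW.
  rewrite exprMn mulrA ler_wpM2r ?exprn_ge0 ?(ltW q0)//.
  rewrite ltW// {1}qa exprVn ltr_pdivrMr ?exprn_gt0//.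
  rewrite mulrC ltr_pdivlMr//.
  apply: lt_le_trans (bernoulli_le n (ltW a0)); lra.
- exact: cvg_cst.
- have := @cvg_geometric R a^-1 q; rewrite ger0_norm ?(ltW q0)// => /(_ q1).
  exact.
Unshelve. all: by end_near. Qed.

(* With [s = (1 + cos u) / 2] this produces indicators out of polynomials in cosines. *)
Lemma cvg_threshold s : 0 <= s <= 1 ->
  ((1 - s ^+ n) ^+ (n * 2 ^ n)) @[n --> \oo] --> ((s < 2^-1)%R%:R : R).
Proof.
move=> /andP[s0 s1].
have sn n : 0 <= s ^+ n <= 1 by rewrite exprn_ge0//= exprn_ile1.
(* The exponent [n * 2 ^ n] makes the Bernoulli bounds depend on [n%:R * (2 * s) ^+ n], which tends
   to 0 below the threshold 1/2 and is at least [n] from 1/2 on. *)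
have mE n : (n * 2 ^ n)%:R * s ^+ n = n%:R * (2 * s) ^+ n :> R.
  by rewrite natrM natrX exprMn mulrA.
case: ltP => h.
- apply: (@squeeze_cvgr _ _ _ _ (fun n => 1 - n%:R * (2 * s) ^+ n) (fun=> 1)).
  + near=> n; rewrite -mE one_sub_exp_ge//=.
    by rewrite exprn_ile1 ?subr_ge0 ?gerBl//; have /andP[] := sn n.
  + rewrite -[X in _ --> X]subr0; apply: cvgB; first exact: (@cvg_cst R).
    by apply: cvg_nat_expr; lra.
  + exact: (@cvg_cst R).
- apply: (@squeeze_cvgr _ _ _ _ (fun=> 0) (fun n => n.+1%:R^-1)).
  + near=> n; rewrite exprn_ge0 ?subr_ge0//=; last by have /andP[] := sn n.
    rewrite (le_trans (one_sub_exp_le _ _))// mE lef_pV2 ?posrE//; last first.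
      by rewrite ltr_pwDl// mulr_ge0// exprn_ge0// mulr_ge0.
    rewrite -natr1 addrC lerD2l ler_peMr// exprn_ege1//; lra.
  + exact: (@cvg_cst R).
  + exact: cvg_harmonic.
Unshelve. all: by end_near. Qed.

End threshold.

Section bounded_measurable.
Context {R : realType} {dO : measure_display} {O : measurableType dO}.
Variable m : {finite_measure set O -> \bar R}.
Implicit Types f g : O -> R.

Definition bmeas f := measurable_fun setT f /\ exists M : R, forall w, `|f w| <= M.

Lemma bmeas_int f : bmeas f -> m.-integrable setT (EFin \o f).
Proof.
move=> [mf [M fM]]; apply: measurable_bounded_integrable => //.
  by have := fin_num_fun_lty (@fin_num_measure _ _ _ m); exact.
exists M; split; first exact: num_real.
by move=> y My x _ /=; rewrite (le_trans (fM x))// ltW.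
Qed.

Lemma bmeas_cst c : bmeas (fun=> c).
Proof. by split => //; exists `|c|. Qed.

Lemma bmeasM f g : bmeas f -> bmeas g -> bmeas (fun w => f w * g w).
Proof.
move=> [mf [M fM]] [mg [N gN]]; split; first exact: measurable_funM.
by exists (M * N) => w; rewrite normrM ler_pM.
Qed.

Lemma bmeasD f g : bmeas f -> bmeas g -> bmeas (fun w => f w + g w).
Proof.
move=> [mf [M fM]] [mg [N gN]]; split; first exact: measurable_funD.
by exists (M + N) => w; rewrite (le_trans (ler_normD _ _))// lerD.
Qed.

Lemma bmeas_cos f : measurable_fun setT f -> bmeas (fun w => cos (f w)).
Proof.
move=> mf; split.
  by apply: measurableT_comp => //; apply: continuous_measurable_fun; exact: continuous_cos.
by exists 1 => w; rewrite ler_norml cos_geN1 cos_le1.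
Qed.

Lemma bmeas_indic (A : set O) : measurable A -> bmeas \1_A.
Proof.
by move=> mA; split => //; exists 1 => w; rewrite indicE; case: (_ \in _); rewrite ?normr1 ?normr0.
Qed.

Lemma bounded_cvg (f_ : nat -> O -> R) f (M : R) :
  (forall n, measurable_fun setT (f_ n)) -> (forall n w, `|f_ n w| <= M) ->
  (forall w, f_ n w @[n --> \oo] --> f w) ->
  \int[m]_w f_ n w @[n --> \oo] --> \int[m]_w f w.
Proof.
move=> mf fM fc.
have mf' : measurable_fun setT f by apply: (measurable_fun_cvg mf) => x _; exact: fc.
have fM' w : `|f w| <= M.
  have h : `|f_ n w| @[n --> \oo] --> `|f w| by apply: cvg_norm; exact: fc.
  by rewrite -(cvg_lim _ h)//; apply: limr_le; [apply/cvg_ex; eexists; exact: h|exact: nearW].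
have fin : (\int[m]_w (f w)%:E)%E \is a fin_num.
  by apply: integrable_fin_num => //; apply: bmeas_int; split => //; exists M.
apply: fine_cvg; rewrite fineK//.
apply: (@dominated_cvg _ _ _ m setT measurableT (fun n w => (f_ n w)%:E) _ (fun=> M%:E)) => //.
- by move=> n; apply/measurable_EFinP.
- by move=> x _; apply: cvg_EFin; [exact: nearW|exact: fc].
- exact: finite_measure_integrable_cst.
- by move=> n x _; rewrite lee_fin.
Qed.

End bounded_measurable.

Section vectors.
Context {R : realType} {d : nat}.
Local Notation V := (d.-tuple R).
Implicit Types x y z : V.

Definition vadd x y : V := [tuple tnth x i + tnth y i | i < d].
Definition vzero : V := [tuple 0 | _ < d].

Lemma tnth_vadd x y i : tnth (vadd x y) i = tnth x i + tnth y i.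
Proof. by rewrite tnth_mktuple. Qed.

Lemma tnth_vsub x y i : tnth (vsub x y) i = tnth x i - tnth y i.
Proof. by rewrite tnth_mktuple. Qed.

Lemma tnth_vneg x i : tnth (vneg x) i = - tnth x i.
Proof. by rewrite tnth_mktuple. Qed.

Lemma tnth_vzero i : tnth vzero i = 0.
Proof. by rewrite tnth_mktuple. Qed.

Lemma vadd_vsub x y : vadd x (vsub y x) = y.
Proof. by apply: eq_from_tnth => i; rewrite tnth_vadd tnth_vsub addrC subrK. Qed.

Lemma vsub_vadd x y : vsub (vadd x y) x = y.
Proof. by apply: eq_from_tnth => i; rewrite tnth_vsub tnth_vadd addrC addKr. Qed.

Lemma vaddA x y z : vadd x (vadd y z) = vadd (vadd x y) z.
Proof. by apply: eq_from_tnth => i; rewrite !tnth_vadd addrA. Qed.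

Lemma vaddC x y : vadd x y = vadd y x.
Proof. by apply: eq_from_tnth => i; rewrite !tnth_vadd addrC. Qed.

Lemma vadd0 x : vadd x vzero = x.
Proof. by apply: eq_from_tnth => i; rewrite tnth_vadd tnth_vzero addr0. Qed.

Lemma vsubxx x : vsub x x = vzero.
Proof. by apply: eq_from_tnth => i; rewrite tnth_vsub tnth_vzero subrr. Qed.

Lemma vadd_vneg x y : vadd x (vneg y) = vsub x y.
Proof. by apply: eq_from_tnth => i; rewrite tnth_vsub tnth_vadd tnth_vneg. Qed.

Lemma vnegK x : vneg (vneg x) = x.
Proof. by apply: eq_from_tnth => i; rewrite !tnth_vneg opprK. Qed.

Lemma dotvDl x y z : dotv (vadd x y) z = dotv x z + dotv y z.
Proof. by rewrite -big_split; apply: eq_bigr => i _; rewrite tnth_vadd mulrDl. Qed.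

Lemma dotvNl x z : dotv (vneg x) z = - dotv x z.
Proof. by rewrite -sumrN; apply: eq_bigr => i _; rewrite tnth_vneg mulNr. Qed.

Lemma dotvDr x y z : dotv z (vadd x y) = dotv z x + dotv z y.
Proof. by rewrite -big_split; apply: eq_bigr => i _; rewrite tnth_vadd mulrDr. Qed.

Lemma dotvNr x z : dotv z (vneg x) = - dotv z x.
Proof. by rewrite -sumrN; apply: eq_bigr => i _; rewrite tnth_vneg mulrN. Qed.

Lemma dotvBr x y z : dotv z (vsub x y) = dotv z x - dotv z y.
Proof. by rewrite -vadd_vneg dotvDr dotvNr. Qed.

Lemma dotv0l z : dotv vzero z = 0.
Proof. by rewrite /dotv big1// => i _; rewrite tnth_vzero mul0r. Qed.

Lemma dotv_delta i (a : R) z : dotv [tuple if k == i then a else 0 | k < d] z = a * tnth z i.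
Proof.
rewrite /dotv (bigD1 i)//= big1 ?addr0 => [|j ji]; rewrite tnth_mktuple ?eqxx//.
by rewrite (negbTE ji) mul0r.
Qed.

Context {dO : measure_display} {O : measurableType dO}.

Lemma measurable_tnth_comp (f : O -> V) i :
  measurable_fun setT f -> measurable_fun setT (fun w => tnth (f w) i).
Proof. by move=> mf; exact: (measurableT_comp (measurable_tnth i) mf). Qed.

Lemma measurable_vadd (f g : O -> V) : measurable_fun setT f -> measurable_fun setT g ->
  measurable_fun setT (fun w => vadd (f w) (g w)).
Proof.
move=> mf mg; apply/measurable_fun_tnthP => i /=.
rewrite (_ : _ \o _ = fun w => tnth (f w) i + tnth (g w) i).
  by apply: measurable_funD; exact: measurable_tnth_comp.
by apply/funext => w; rewrite /= tnth_vadd.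
Qed.

Lemma measurable_vneg (f : O -> V) : measurable_fun setT f ->
  measurable_fun setT (fun w => vneg (f w)).
Proof.
move=> mf; apply/measurable_fun_tnthP => i /=.
rewrite (_ : _ \o _ = fun w => - tnth (f w) i).
  by apply: measurableT_comp => //; exact: measurable_tnth_comp.
by apply/funext => w; rewrite /= tnth_vneg.
Qed.

Lemma measurable_vsub (f g : O -> V) : measurable_fun setT f -> measurable_fun setT g ->
  measurable_fun setT (fun w => vsub (f w) (g w)).
Proof.
move=> mf mg; under eq_fun do rewrite -vadd_vneg.
by apply: measurable_vadd => //; exact: measurable_vneg.
Qed.

Lemma measurable_dotv xi (f : O -> V) : measurable_fun setT f ->
  measurable_fun setT (fun w => dotv xi (f w)).
Proof.
move=> mf; apply: measurable_sum => i; apply: measurable_funM => //.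
exact: measurable_tnth_comp.
Qed.

End vectors.

Section characteristic_functions.
Context {R : realType} {d n : nat}.
Local Notation V := (d.-tuple R).
Local Notation W := ('I_n -> V).
Context {d1 : measure_display} {O1 : measurableType d1} (m1 : {finite_measure set O1 -> \bar R}).
Context {d2 : measure_display} {O2 : measurableType d2} (m2 : {finite_measure set O2 -> \bar R}).
Variables (Z1 : O1 -> W) (Z2 : O2 -> W).
Hypothesis mZ1 : forall j, measurable_fun setT (fun w => Z1 w j).
Hypothesis mZ2 : forall j, measurable_fun setT (fun w => Z2 w j).

Definition phase (xi z : W) : R := \sum_(j < n) dotv (xi j) (z j).

Lemma phaseD (xi eta z : W) : phase (fun j => vadd (xi j) (eta j)) z = phase xi z + phase eta z.
Proof. by rewrite -big_split; apply: eq_bigr => j _; rewrite dotvDl. Qed.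

Lemma phaseN (xi z : W) : phase (fun j => vneg (xi j)) z = - phase xi z.
Proof. by rewrite -sumrN; apply: eq_bigr => j _; rewrite dotvNl. Qed.

Lemma measurable_phase1 xi c : measurable_fun setT (fun w => phase xi (Z1 w) + c).
Proof. by apply: measurable_funD => //; apply: measurable_sum => j; exact: measurable_dotv. Qed.

Lemma measurable_phase2 xi c : measurable_fun setT (fun w => phase xi (Z2 w) + c).
Proof. by apply: measurable_funD => //; apply: measurable_sum => j; exact: measurable_dotv. Qed.

Hypothesis cfE : forall (xi : W) (c : R),
  \int[m1]_w cos (phase xi (Z1 w) + c) = \int[m2]_w cos (phase xi (Z2 w) + c).

(** The last clause tests [g] against every cosine, not only against 1; this is what makes the class
    stable under multiplication by cosines and then by indicators. The plain integrals of [g] are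
    recovered at frequency and phase 0. *)
Definition adm (g : W -> R) := [/\ measurable_fun setT (g \o Z1), measurable_fun setT (g \o Z2),
  exists M : R, forall z, `|g z| <= M & forall (xi : W) (c : R),
  \int[m1]_w (g (Z1 w) * cos (phase xi (Z1 w) + c)) =
  \int[m2]_w (g (Z2 w) * cos (phase xi (Z2 w) + c))].

Let i1 g xi c : adm g -> m1.-integrable setT (EFin \o (fun w => g (Z1 w) * cos (phase xi (Z1 w) + c))).
Proof.
move=> [mg1 _ [M gM] _]; apply: bmeas_int; apply: bmeasM; last exact/bmeas_cos/measurable_phase1.
by split => //; exists M.
Qed.

Let i2 g xi c : adm g -> m2.-integrable setT (EFin \o (fun w => g (Z2 w) * cos (phase xi (Z2 w) + c))).
Proof.
move=> [_ mg1 [M gM] _]; apply: bmeas_int; apply: bmeasM; last exact/bmeas_cos/measurable_phase2.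
by split => //; exists M.
Qed.

Lemma adm1 : adm (fun=> 1).
Proof.
split; [exact: measurable_cst|exact: measurable_cst|by exists 1 => z; rewrite normr1|].
move=> xi c; under eq_Rintegral do rewrite mul1r.
by under [RHS]eq_Rintegral do rewrite mul1r.
Qed.

Lemma adm_lin (a b : R) g h : adm g -> adm h -> adm (fun z => a * g z + b * h z).
Proof.
move=> ag ah; have [mg1 mg2 [M gM] gE] := ag; have [mh1 mh2 [N hN] hE] := ah; split.
- by apply: measurable_funD; apply: measurable_funM.
- by apply: measurable_funD; apply: measurable_funM.
- exists (`|a| * M + `|b| * N) => z; rewrite (le_trans (ler_normD _ _))// !normrM lerD//.
  + by rewrite ler_wpM2l.
  + by rewrite ler_wpM2l.
- move=> xi c.
  under eq_Rintegral do rewrite mulrDl -!mulrA.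
  under [RHS]eq_Rintegral do rewrite mulrDl -!mulrA.
  have zi1 k g' : adm g' -> m1.-integrable setT (EFin \o (fun w => k * (g' (Z1 w) * cos (phase xi (Z1 w) + c)))).
    by move=> /(i1 xi c)/(integrableZl measurableT k); apply: eq_integrable.
  have zi2 k g' : adm g' -> m2.-integrable setT (EFin \o (fun w => k * (g' (Z2 w) * cos (phase xi (Z2 w) + c)))).
    by move=> /(i2 xi c)/(integrableZl measurableT k); apply: eq_integrable.
  rewrite !RintegralD//; [|exact: zi2|exact: zi2|exact: zi1|exact: zi1].
  by rewrite !RintegralZl ?gE ?hE//; first [exact: i1|exact: i2].
Qed.

Lemma adm_ext g h : (forall z, g z = h z) -> adm g -> adm h.
Proof. by move=> /funext ->. Qed.

Lemma adm_cos g eta b : adm g -> adm (fun z => g z * cos (phase eta z + b)).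
Proof.
move=> ag; have [mg1 mg2 [M gM] gE] := ag; split.
- apply: measurable_funM => //.
  by have [] := bmeas_cos (measurable_phase1 eta b).
- apply: measurable_funM => //.
  by have [] := bmeas_cos (measurable_phase2 eta b).
- exists M => z; rewrite normrM (le_trans _ (gM z))// ler_piMr//.
  by rewrite ler_norml cos_geN1 cos_le1.
- move=> xi c.
  (* Product-to-sum formula: the two cosines combine into a half-sum of single cosines, to which the
     clause of [adm] applies. *)
  have E z : g z * cos (phase eta z + b) * cos (phase xi z + c) =
    2^-1 * (g z * cos (phase (fun j => vadd (xi j) (eta j)) z + (c + b))) +
    2^-1 * (g z * cos (phase (fun j => vadd (xi j) (vneg (eta j))) z + (c - b))).
    rewrite !phaseD phaseN.
    rewrite (_ : phase xi z + phase eta z + _ = (phase xi z + c) + (phase eta z + b)); last by ring.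
    rewrite (_ : phase xi z - phase eta z + _ = (phase xi z + c) - (phase eta z + b)); last by ring.
    set A := phase xi z + c; set B := phase eta z + b; clearbody A B.
    by rewrite cosB cosD; field.
  under eq_Rintegral do rewrite E.
  under [RHS]eq_Rintegral do rewrite E.
  have zi1 k xi' c' : m1.-integrable setT (EFin \o (fun w => k * (g (Z1 w) * cos (phase xi' (Z1 w) + c')))).
    by have /(i1 xi' c')/(integrableZl measurableT k) := ag; apply: eq_integrable.
  have zi2 k xi' c' : m2.-integrable setT (EFin \o (fun w => k * (g (Z2 w) * cos (phase xi' (Z2 w) + c')))).
    by have /(i2 xi' c')/(integrableZl measurableT k) := ag; apply: eq_integrable.
  rewrite !RintegralD//.
  by rewrite !RintegralZl ?gE//; first [exact: i1|exact: i2].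
Qed.

Lemma adm_lim (g_ : nat -> W -> R) g (M : R) : (forall k, adm (g_ k)) ->
  (forall k z, `|g_ k z| <= M) -> (forall z, g_ k z @[k --> \oo] --> g z) -> adm g.
Proof.
move=> ag gM gc.
have m1' : measurable_fun setT (g \o Z1).
  apply: (@measurable_fun_cvg _ _ _ _ (fun k => g_ k \o Z1)) => [k|x _]; last exact: gc.
  by have [] := ag k.
have m2' : measurable_fun setT (g \o Z2).
  apply: (@measurable_fun_cvg _ _ _ _ (fun k => g_ k \o Z2)) => [k|x _]; last exact: gc.
  by have [] := ag k.
split => //.
  exists M => z.
  have h : `|g_ k z| @[k --> \oo] --> `|g z| by apply: cvg_norm; exact: gc.
  by rewrite -(cvg_lim _ h)//; apply: limr_le; [apply/cvg_ex; eexists; exact: h|exact: nearW].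
move=> xi c.
have gM' k z y : `|g_ k z * cos y| <= M.
  by rewrite normrM (le_trans _ (gM k z))// ler_piMr// ler_norml cos_geN1 cos_le1.
have c1 : \int[m1]_w (g_ k (Z1 w) * cos (phase xi (Z1 w) + c)) @[k --> \oo] -->
    \int[m1]_w (g (Z1 w) * cos (phase xi (Z1 w) + c)).
  apply: (@bounded_cvg _ _ _ _ _ _ M) => [k|k w|w].
  - by have /(adm_cos xi c)[] := ag k.
  - exact: gM'.
  - by apply: cvgMr_tmp; exact: gc.
have c2 : \int[m2]_w (g_ k (Z2 w) * cos (phase xi (Z2 w) + c)) @[k --> \oo] -->
    \int[m2]_w (g (Z2 w) * cos (phase xi (Z2 w) + c)).
  apply: (@bounded_cvg _ _ _ _ _ _ M) => [k|k w|w].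
  - by have /(adm_cos xi c)[] := ag k.
  - exact: gM'.
  - by apply: cvgMr_tmp; exact: gc.
have E k : \int[m1]_w (g_ k (Z1 w) * cos (phase xi (Z1 w) + c)) =
    \int[m2]_w (g_ k (Z2 w) * cos (phase xi (Z2 w) + c)) by have [] := ag k.
by rewrite -(cvg_lim _ c2)// -(cvg_lim _ c1)//; under eq_fun do rewrite E.
Qed.

Let s_ eta b (z : W) : R := 2^-1 * (1 + cos (phase eta z + b)).

Let s01 eta b z : 0 <= s_ eta b z <= 1.
Proof. by have := cos_geN1 (phase eta z + b); have := cos_le1 (phase eta z + b); rewrite /s_; lra. Qed.

(** [s_] lies in [0, 1] and is below 1/2 exactly where the cosine is negative. Polynomials in [s_]
    preserve admissibility, and those of [cvg_threshold] converge to the indicator. *)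
Lemma adm_halfspace g eta b : adm g ->
  adm (fun z => g z * (cos (phase eta z + b) < 0)%R%:R).
Proof.
move=> ag.
have adms h : adm h -> adm (fun z => h z * s_ eta b z).
  move=> ah; apply: adm_ext (adm_lin 2^-1 2^-1 ah (adm_cos eta b ah)) => z.
  by rewrite /s_; ring.
have admsk h k : adm h -> adm (fun z => h z * s_ eta b z ^+ k).
  move=> ah; elim: k => [|k IH]; first by apply: adm_ext ah => z; rewrite expr0 mulr1.
  by apply: adm_ext (adms _ IH) => z; rewrite exprSr mulrA.
have admpoly h k l : adm h -> adm (fun z => h z * (1 - s_ eta b z ^+ k) ^+ l).
  move=> ah; elim: l => [|l IH]; first by apply: adm_ext ah => z; rewrite expr0 mulr1.
  apply: adm_ext (adm_lin 1 (-1) IH (admsk _ k IH)) => z.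
  by rewrite exprSr; ring.
have [_ _ [M gM] _] := ag.
apply: (@adm_lim (fun k z => g z * (1 - s_ eta b z ^+ k) ^+ (k * 2 ^ k)) _ M) => [k|k z|z].
- exact: admpoly.
- rewrite normrM (le_trans _ (gM z))// ler_piMr//.
  have /andP[h0 h1] := s01 eta b z.
  rewrite ger0_norm; first by rewrite exprn_ile1 ?subr_ge0 ?gerBl ?exprn_ge0// exprn_ile1.
  by rewrite exprn_ge0// subr_ge0 exprn_ile1.
- apply: cvgMl_tmp.
  have -> : (cos (phase eta z + b) < 0) = (s_ eta b z < 2^-1).
    by rewrite /s_; apply/idP/idP; lra.
  exact: cvg_threshold.
Qed.

(** At frequency [k.+1%:R^-1] and with the phase shifted by [pi / 2], the cosine is minus the sine
    of [(tnth (z j) i - u) / k.+1%:R]. Once [k] is large for the given [z], this argument is within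
    [pi] of 0 and the sine has the sign of [tnth (z j) i - u]. *)
Lemma adm_gt g j i u : adm g -> adm (fun z => g z * (u < tnth (z j) i)%R%:R).
Proof.
move=> ag; have [_ _ [M gM] _] := ag.
pose eta k : W := fun j' => if j' == j then [tuple if l == i then k.+1%:R^-1 else 0 | l < d] else vzero.
pose b k : R := - u / k.+1%:R + pi / 2.
have E k z : phase (eta k) z + b k = (tnth (z j) i - u) / k.+1%:R + pi / 2.
  rewrite /phase (bigD1 j)//= big1 => [|l lj]; last by rewrite /eta (negbTE lj) dotv0l.
  by rewrite /eta eqxx dotv_delta addr0 /b addrA; congr (_ + _); ring.
apply: (@adm_lim (fun k z => g z * (cos (phase (eta k) z + b k) < 0)%R%:R) _ M) => [k|k z|z].
- exact: adm_halfspace.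
- rewrite normrM (le_trans _ (gM z))// ler_piMr//.
  by case: (_ < _); rewrite ?normr1 ?normr0.
- apply: cvgMl_tmp; apply: cvg_near_cst; near=> k; congr (_%:R); congr nat_of_bool.
  rewrite E cosDpihalf oppr_lt0.
  set t := tnth (z j) i - u.
  have tk : `|t| < k.+1%:R.
    near: k; exists (Num.bound `|t|) => // k /= hk.
    apply: lt_le_trans (archi_boundP (normr_ge0 _)) _.
    by rewrite ler_nat (leq_trans hk).
  have tk' : `|t / k.+1%:R| < pi.
    rewrite normrM [X in _ * X]gtr0_norm ?invr_gt0// ltr_pdivrMr//.
    rewrite (lt_le_trans tk)// ler_peMl//.
    by rewrite (le_trans _ (pi_ge2 R))// ler1n.
  case: (ltP u (tnth (z j) i)) => ut.
    rewrite sin_gt0_pi// divr_gt0 ?subr_gt0//=.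
    by apply: le_lt_trans tk'; rewrite ler_norm.
  apply/negbTE; rewrite -leNgt -oppr_ge0 -sinN sin_ge0_pi//.
  rewrite oppr_ge0 pmulr_lle0 ?invr_gt0// subr_le0 ut/=.
  by rewrite (le_trans _ (ltW tk'))// -normrN ler_norm.
Unshelve. all: by end_near. Qed.

(** Quantifying over all admissible [g] makes intersections a matter of applying the definition
    twice, so these sets form a sigma-algebra directly, instead of merely a Dynkin system. *)
Definition admset j (A : set V) := forall g, adm g -> adm (fun z => g z * \1_A (z j)).

Lemma admset_sigma_algebra j : sigma_algebra setT (admset j).
Proof.
have aC A : admset j A -> admset j (~` A).
  move=> aA g ag; apply: adm_ext (adm_lin 1 (-1) ag (aA _ ag)) => z.
  by rewrite !indicE in_setC; case: (_ \in _) => /=; ring.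
have a0 : admset j set0.
  by move=> g ag; apply: adm_ext (adm_lin 0 0 ag ag) => z; rewrite indicE in_set0 /=; ring.
split => //; first by move=> A aA; rewrite setTD; exact: aC.
move=> A aA.
have afin k : admset j (\big[setU/set0]_(l < k) A l).
  elim: k => [|k IH]; first by rewrite big_ord0.
  rewrite big_ord_recr/= => g ag.
  apply: adm_ext (adm_lin 1 1 (aA k _ ag) (adm_lin 1 (-1) (IH _ ag) (aA k _ (IH _ ag)))) => z.
  by rewrite !indicE in_setU; case: (z j \in A k); case: (_ \in _); rewrite /=; ring.
move=> g ag; have [_ _ [M gM] _] := ag.
apply: (@adm_lim (fun k z => g z * \1_(\big[setU/set0]_(l < k) A l) (z j)) _ M) => [k|k z|z].
- exact: afin.
- rewrite normrM (le_trans _ (gM z))// ler_piMr//.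
  by rewrite indicE; case: (_ \in _); rewrite ?normr1 ?normr0.
- apply: cvgMl_tmp; apply: cvg_near_cst.
  have [[l _ Al]|nA] := pselect ((\bigcup_k A k) (z j)).
    near=> k; rewrite !indicE !mem_set//; first by exists l.
    rewrite -bigcup_mkord; exists l => //=; near: k; exists l.+1 => // k.
  near=> k; rewrite !indicE !memNset// -bigcup_mkord => -[l _ Al].
  by apply: nA; exists l.
Unshelve. all: by end_near. Qed.

Lemma measurable_admset j (A : set V) : measurable A -> admset j A.
Proof.
move=> mA; move: A mA; apply: smallest_sub; first exact: admset_sigma_algebra.
have [a0 aC aU] := admset_sigma_algebra j.
move=> A; rewrite -bigcup_seq/= => -[i _ [B mB <-]]; rewrite setTI.
suff: [set B | admset j ((@tnth _ R)^~ i @^-1` B)] B by [].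
have {mB} : (@ocitv R).-sigma.-measurable B := mB.
rewrite RGenOInfty.measurableE => mB; move: B mB; apply: smallest_sub.
  split => [|B aB|B aB]; rewrite /= ?preimage_set0//.
  - by rewrite setTD preimage_setC -setTD; exact: aC.
  - by rewrite preimage_bigcup; exact: aU.
move=> _ [x ->] g ag; apply: adm_ext (adm_gt j i x ag) => z.
by rewrite indicE; congr (_ * (nat_of_bool _)%:R); apply/idP/idP; rewrite inE/= in_itv/= andbT.
Qed.

(** A product of coordinate indicators is admissible, one factor at a time; frequency and phase 0
    turn the clause of [adm] into the equality of the two masses. *)
Lemma cf_unique (A : 'I_n -> set V) : (forall j, measurable (A j)) ->
  m1 [set w | forall j, A j (Z1 w j)] = m2 [set w | forall j, A j (Z2 w j)].
Proof.
move=> mA.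
have ap (s : seq 'I_n) : adm (fun z => \prod_(j <- s) \1_(A j) (z j)).
  elim: s => [|j s IH]; first by apply: adm_ext adm1 => z; rewrite big_nil.
  apply: adm_ext (@measurable_admset j _ (mA j) _ IH) => z.
  by rewrite big_cons mulrC.
have pE (z : W) : \prod_(j <- index_enum 'I_n) \1_(A j) (z j) = \1_[set z : W | forall j, A j (z j)] z :> R.
  rewrite [RHS]indicE; have [zA|zA] := boolP (z \in _).
    rewrite big1// => j _; rewrite indicE mem_set//; move: zA; rewrite inE; exact.
  have : ~ forall j, A j (z j) by move: zA; rewrite notin_setE.
  move=> /existsNP[j Aj]; rewrite (bigD1 j)//= indicE memNset//.
  by rewrite mul0r.
have m1' : measurable [set w | forall j, A j (Z1 w j)].
  rewrite (_ : [set _ | _] = \bigcap_(j in [set: 'I_n]) ((fun w => Z1 w j) @^-1` A j)); last first.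
    by apply/seteqP; split=> [w h j _|w h j]; exact: h.
  apply: fin_bigcap_measurable => // j _; rewrite -[X in measurable X]setTI; exact: mZ1.
have m2' : measurable [set w | forall j, A j (Z2 w j)].
  rewrite (_ : [set _ | _] = \bigcap_(j in [set: 'I_n]) ((fun w => Z2 w j) @^-1` A j)); last first.
    by apply/seteqP; split=> [w h j _|w h j]; exact: h.
  apply: fin_bigcap_measurable => // j _; rewrite -[X in measurable X]setTI; exact: mZ2.
have [_ _ _ /(_ (fun=> vzero) 0)] := ap (index_enum 'I_n).
have ph0 z : cos (phase (fun=> vzero) z + 0) = 1.
  by rewrite /phase big1 ?addr0 ?cos0// => j _; rewrite dotv0l.
under eq_Rintegral do rewrite ph0 mulr1 pE.
under [RHS]eq_Rintegral do rewrite ph0 mulr1 pE.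
rewrite /Rintegral.
have -> : (\int[m1]_w (\1_[set z : W | forall j, A j (z j)] (Z1 w))%:E)%E = m1 [set w | forall j, A j (Z1 w j)].
  by rewrite -[X in _ = _ X]setIT -integral_indic.
have -> : (\int[m2]_w (\1_[set z : W | forall j, A j (z j)] (Z2 w))%:E)%E = m2 [set w | forall j, A j (Z2 w j)].
  by rewrite -[X in _ = _ X]setIT -integral_indic.
by move=> E; have := congr1 EFin E; rewrite !fineK ?fin_num_measure.
Qed.

End characteristic_functions.

(** * Lebesgue measure on tuples *)

Local Open Scope ereal_scope.

Section law.
Context {R : realType} {d1 : measure_display} {T : measurableType d1}.
Context {d2 : measure_display} {U : measurableType d2}.

Section measure.
Variables (mu : {measure set T -> \bar R}) (f : T -> U) (mf : measurable_fun setT f).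

(** The measurability proof is an argument so that a measure structure can be attached to the term
    [law mf]. *)
Definition law & measurable_fun setT f : set U -> \bar R := pushforward mu f.

HB.instance Definition _ := Measure.copy (law mf)
  (@measure_function_pushforward__canonical__measure_function_Measure _ _ T U R mu f mf).

Lemma lawE A : law mf A = mu (f @^-1` A). Proof. by []. Qed.

Lemma ge0_integral_law (g : U -> \bar R) : measurable_fun setT g -> (forall x, 0 <= g x) ->
  \int[law mf]_x g x = \int[mu]_w g (f w).
Proof.
move=> mg g0; have := @ge0_integral_pushforward _ _ T U R f mf mu setT g measurableT mg.
by rewrite preimage_setT; apply => x _; exact: g0.
Qed.

End measure.

Section finite.
Variables (mu : {finite_measure set T -> \bar R}) (f : T -> U) (mf : measurable_fun setT f).

HB.instance Definition _ := Measure_isFinite.Build _ _ _ (law mu mf)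
  (fun A (mA : measurable A) => fin_num_measure mu (f @^-1` A)
     (eq_ind _ measurable (mf measurableT mA) _ (setTI (f @^-1` A)))).

End finite.

End law.

Lemma eq_law_ge0_integral {R : realType} {d1} {T1 : measurableType d1}
    {d2} {T2 : measurableType d2} {dU} {U : measurableType dU}
    (m1 : {measure set T1 -> \bar R}) (m2 : {measure set T2 -> \bar R})
    (f1 : T1 -> U) (f2 : T2 -> U) (g : U -> \bar R) :
  measurable_fun setT f1 -> measurable_fun setT f2 ->
  (forall A, measurable A -> m1 (f1 @^-1` A) = m2 (f2 @^-1` A)) ->
  measurable_fun setT g -> (forall x, 0 <= g x) ->
  \int[m1]_w g (f1 w) = \int[m2]_w g (f2 w).
Proof.
move=> mf1 mf2 E mg g0; rewrite -(ge0_integral_law m1 mf1)// -(ge0_integral_law m2 mf2)//.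
by apply: eq_measure_integral => A mA _; exact: E.
Qed.

Lemma eq_law_pair {R : realType} {d1} {T1 : measurableType d1}
    {d2} {T2 : measurableType d2} {dU} {U : measurableType dU} {dV} {V : measurableType dV}
    (m1 : {finite_measure set T1 -> \bar R}) (m2 : {finite_measure set T2 -> \bar R})
    (u1 : T1 -> U) (v1 : T1 -> V) (u2 : T2 -> U) (v2 : T2 -> V) :
  measurable_fun setT u1 -> measurable_fun setT v1 ->
  measurable_fun setT u2 -> measurable_fun setT v2 ->
  (forall A B, measurable A -> measurable B ->
     m1 (u1 @^-1` A `&` v1 @^-1` B) = m2 (u2 @^-1` A `&` v2 @^-1` B)) ->
  forall g : U * V -> \bar R, measurable_fun setT g -> (forall x, 0 <= g x) ->
  \int[m1]_w g (u1 w, v1 w) = \int[m2]_w g (u2 w, v2 w).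
Proof.
move=> mu1 mv1 mu2 mv2 E g mg g0.
have mf1 := measurable_fun_pair mu1 mv1; have mf2 := measurable_fun_pair mu2 mv2.
apply: (eq_law_ge0_integral mf1 mf2) => // A mA.
rewrite -(lawE m1 mf1) -(lawE m2 mf2).
pose C : set (set (U * V)) :=
  [set C | exists A, measurable A /\ exists B, measurable B /\ C = A `*` B].
apply: (measure_unique C (fun=> setT)) => //.
- rewrite measurable_prod_measurableType //; congr (<<s _ >>).
  rewrite predeqE => D; split => [[A' mA' [B mB <-]]|[A' [mA' [B [mB ->]]]]].
    by exists A'; split => //; exists B.
  by exists A' => //; exists B.
- move=> /= _ _ [X1 [mX1 [X2 [mX2 ->]]]] [Y1 [mY1 [Y2 [mY2 ->]]]].
  rewrite -setXI; exists (X1 `&` Y1); split; first exact: measurableI.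
  by exists (X2 `&` Y2); split => //; exact: measurableI.
- by move=> _; exists setT; split => //; exists setT; split => //; rewrite setXTT.
- by rewrite bigcup_const.
- by move=> _ [A1 [mA1 [A2 [mA2 ->]]]]; exact: E.
- by move=> _; rewrite ltey_eq fin_num_measure.
Qed.

Section sigma_finite_product.
Context {R : realType} {d1} {T1 : measurableType d1} {d2} {T2 : measurableType d2}.
Variables (m1 : {sigma_finite_measure set T1 -> \bar R}) (m2 : {sigma_finite_measure set T2 -> \bar R}).

(** A name for the product measure that can carry a sigma-finite structure, so that products can be
    iterated along the dimension. *)
Definition sprod : set (T1 * T2) -> \bar R := m1 \x m2.

HB.instance Definition _ := Measure.on sprod.

Let sprod_sigma_finite : sigma_finite setT sprod.
Proof.
have /sigma_finiteP[F [TF ndF Foo]] := sigma_finiteT m1.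
have /sigma_finiteP[G [TG ndG Goo]] := sigma_finiteT m2.
exists (fun n => F n `*` G n).
  apply/seteqP; split=> // -[x y] _.
  have [n _ Fn] : (\bigcup_k F k) x by rewrite -TF.
  have [k _ Gk] : (\bigcup_k G k) y by rewrite -TG.
  exists (maxn n k) => //; split => /=.
  - by move: x Fn; exact/subsetPset/ndF/leq_maxl.
  - by move: y Gk; exact/subsetPset/ndG/leq_maxr.
move=> k; have [? ?] := Foo k; have [? ?] := Goo k.
by split; [exact: measurableX|rewrite /sprod product_measure1E// lte_mul_pinfty// ge0_fin_numE].
Qed.

HB.instance Definition _ := Measure_isSigmaFinite.Build _ _ _ sprod sprod_sigma_finite.

Variables (f : T1 * T2 -> \bar R) (mf : measurable_fun setT f) (f0 : forall z, 0 <= f z).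

Lemma ge0_integral_sprod1 : \int[sprod]_z f z = \int[m1]_x \int[m2]_y f (x, y).
Proof. exact: fubini_tonelli1. Qed.

Lemma ge0_integral_sprod2 : \int[sprod]_z f z = \int[m2]_y \int[m1]_x f (x, y).
Proof. by rewrite ge0_integral_sprod1; exact: fubini_tonelli. Qed.

End sigma_finite_product.

Section lebesgue_tuple.
Context {R : realType}.

Definition tcons n (u : R * n.-tuple R) : n.+1.-tuple R := [tuple of u.1 :: u.2].
Definition tuncons n (t : n.+1.-tuple R) : R * n.-tuple R := (thead t, [tuple of behead t]).

Lemma tconsK n : cancel (@tcons n) (@tuncons n).
Proof. by case=> x t; congr (_, _); apply: val_inj. Qed.

Lemma measurable_tcons n : measurable_fun setT (@tcons n).
Proof. exact: measurable_cons. Qed.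

Lemma measurable_tuncons n : measurable_fun setT (@tuncons n).
Proof.
apply: measurable_fun_pair; last exact: measurable_behead.
exact: (measurable_tnth ord0).
Qed.

Section succ.
Variables (n : nat) (mu : {sigma_finite_measure set (n.-tuple R) -> \bar R}).

Definition leb_succ := law (sprod (@lebesgue_measure R) mu) (@measurable_tcons n).

HB.instance Definition _ := Measure.on leb_succ.

Let leb_succ_sigma_finite : sigma_finite setT leb_succ.
Proof.
have [F FT Foo] := sigma_finiteT (sprod (@lebesgue_measure R) mu).
exists (fun k => @tuncons n @^-1` F k).
  by rewrite -preimage_bigcup -FT preimage_setT.
move=> k; have [mF Fk] := Foo k; split.
  by rewrite -[X in measurable X]setTI; exact: measurable_tuncons.
rewrite /leb_succ lawE -comp_preimage (_ : _ \o _ = id) ?preimage_id//.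
by apply/funext => x /=; rewrite tconsK.
Qed.

HB.instance Definition _ := Measure_isSigmaFinite.Build _ _ _ leb_succ leb_succ_sigma_finite.

End succ.

(** [lebR] is only a functional, given by iterated integrals. Tonelli and dominated convergence call
    for a measure that represents it on nonnegative measurable functions. *)
Definition lebT_spec n (mu : {sigma_finite_measure set (n.-tuple R) -> \bar R}) :=
  forall f : n.-tuple R -> \bar R, measurable_fun setT f -> (forall x, 0 <= f x) ->
    lebR f = \int[mu]_x f x.

Lemma lebT_exists n : {mu : {sigma_finite_measure set (n.-tuple R) -> \bar R} | lebT_spec mu}.
Proof.
elim: n => [|n [mu IH]].
  exists (\d_ ([tuple] : 0.-tuple R)) => f mf f0.
  by rewrite integral_dirac// diracT mul1e.
exists (leb_succ mu) => f mf f0 /=.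
have mft : measurable_fun setT (f \o @tcons n).
  by apply: measurableT_comp => //; exact: measurable_tcons.
rewrite ge0_integral_law//.
have h := (@ge0_integral_sprod1 R _ _ _ _ (@lebesgue_measure R) mu _ mft (fun z => f0 (tcons z))); apply: etrans (esym h).
apply: eq_integral => x _; rewrite IH//.
by apply: measurableT_comp => //; apply: measurable_cons.
Qed.

Definition lebT n : {sigma_finite_measure set (n.-tuple R) -> \bar R} := sval (lebT_exists n).

Lemma lebRE n (f : n.-tuple R -> \bar R) : measurable_fun setT f -> (forall x, 0 <= f x) ->
  lebR f = \int[lebT n]_x f x.
Proof. exact: (svalP (lebT_exists n)). Qed.

Lemma lebR_indic n (A : set (n.-tuple R)) : measurable A ->
  lebR (fun y => (\1_A y)%:E) = lebT n A.
Proof.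
move=> mA; rewrite lebRE//; first by rewrite integral_indic// setIT.
by apply/measurable_EFinP.
Qed.

Lemma lebesgue_measureD (a : R) (A : set R) : measurable A ->
  (@lebesgue_measure R) ((fun x => x + a)%R @^-1` A) = lebesgue_measure A.
Proof.
move=> mA.
have ma : measurable_fun setT ((fun x => x + a)%R : R -> measurableTypeR R).
  exact: measurable_funD.
rewrite -[LHS]/(law lebesgue_measure ma A).
apply/esym/lebesgue_measure_unique; [move=> _ [[b c] _ <-]|by []].
transitivity (lebesgue_measure (`](b - a)%R, (c - a)%R]%classic : set R)); last first.
  congr lebesgue_measure.
  by apply/seteqP; split=> x /=; rewrite !in_itv/= ltrBlDr lerBrDr.
rewrite /= !lebesgue_measure_itv/= !lte_fin ltrD2r -!EFinB.
by case: ifPn => // _; congr EFin; ring.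
Qed.

Lemma integral_lebesgue_shift (a : R) (f : R -> \bar R) :
  measurable_fun setT f -> (forall x, 0 <= f x) ->
  \int[lebesgue_measure]_x f (x + a)%R = \int[lebesgue_measure]_x f x.
Proof.
move=> mf f0.
apply: (@eq_law_ge0_integral R _ _ _ _ _ (measurableTypeR R) lebesgue_measure lebesgue_measure
   (fun x => x + a)%R idfun f) => //.
  exact: measurable_funD.
  exact: measurable_id.
by move=> A mA; exact: (lebesgue_measureD a mA).
Qed.

Lemma lebR_shift n (a : n.-tuple R) (f : n.-tuple R -> \bar R) :
  measurable_fun setT f -> (forall x, 0 <= f x) ->
  lebR (fun x => f (vadd x a)) = lebR f.
Proof.
elim: n a f => [|n IH] a f mf f0 /=.
  by congr f; apply: eq_from_tnth => -[].
have mc x : measurable_fun setT (fun t : n.-tuple R => f [tuple of x :: t]).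
  by apply: measurableT_comp => //; apply: measurable_cons.
rewrite -[RHS](@integral_lebesgue_shift (thead a)).
- apply: eq_integral => x _.
  rewrite -[RHS](IH [tuple of behead a])//.
  congr lebR; apply/funext => t; congr f; apply: eq_from_tnth => i.
  rewrite tnth_vadd; case: (unliftP ord0 i) => [j|] ->.
    by rewrite !tnthS tnth_vadd [in LHS](tuple_eta a) tnthS.
  by rewrite !tnth0.
- have -> : (fun x : R => lebR (fun t : n.-tuple R => f [tuple of x :: t])) =
      (fun x => \int[lebT n]_t f [tuple of x :: t]) by apply/funext => x; rewrite lebRE.
  apply: (@measurable_fun_fubini_tonelli_F _ _ _ _ R (lebT n) (f \o @tcons n)) => //.
  by apply: measurableT_comp => //; exact: measurable_tcons.
  by move=> z; exact: f0.
- by move=> x /=; rewrite lebRE//; apply: integral_ge0.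
Qed.

Lemma integral_lebT_shift n (a : n.-tuple R) (f : n.-tuple R -> \bar R) :
  measurable_fun setT f -> (forall x, 0 <= f x) ->
  \int[lebT n]_x f (vadd x a) = \int[lebT n]_x f x.
Proof.
move=> mf f0; rewrite -!lebRE//; first exact: lebR_shift.
by apply: measurableT_comp => //; exact: measurable_vadd.
Qed.

Definition box n (c : n.-tuple R) (e : R) : set (n.-tuple R) :=
  [set y | forall i, `|tnth y i - tnth c i| < e]%R.

Lemma measurable_box n (c : n.-tuple R) e : measurable (box c e).
Proof.
rewrite (_ : box c e = \bigcap_(i in [set: 'I_n]) ((fun y => `|tnth y i - tnth c i|)%R @^-1` [set x | x < e]%R)).
  apply: fin_bigcap_measurable => // i _.
  have mg : measurable_fun setT (fun y : n.-tuple R => `|tnth y i - tnth c i|)%R.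
    apply: measurableT_comp => //; apply: measurable_funB => //.
    exact: measurable_tnth.
  by have := mg measurableT _ (measurable_itv `]-oo, e[); rewrite setTI set_itvE.
by apply/seteqP; split=> [w h j _|w h j]; exact: h.
Qed.

Lemma lebT_box n (c : n.-tuple R) e : (0 <= e)%R -> lebT n (box c e) = ((e *+ 2) ^+ n)%:E.
Proof.
move=> e0; rewrite -lebR_indic; last exact: measurable_box.
elim: n c => [|n IH] c /=.
  by rewrite indicE mem_set//= => -[].
pose a := (thead c - e)%R; pose b := (thead c + e)%R.
transitivity (\int[@lebesgue_measure R]_x (((e *+ 2) ^+ n)%:E * (\1_(`]a, b[%classic) x)%:E)).
  apply: eq_integral => x _; rewrite -(IH [tuple of behead c]).
  have E (t : n.-tuple R) : box c e [tuple of x :: t] <->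
      (`]a, b[%classic x /\ box [tuple of behead c] e t).
    rewrite /= in_itv/=; split=> [h|[h1 h2] i].
      split; first by have := h ord0; rewrite tnth0 ltr_norml /a /b /thead => /andP[h1 h2]; apply/andP; split; lra.
      by move=> i; have := h (lift ord0 i); rewrite tnthS {1}(tuple_eta c) tnthS.
    case: (unliftP ord0 i) => [j|] ->.
      by rewrite tnthS {1}(tuple_eta c) tnthS; exact: h2.
    move: h1 => /andP[h1 h3]; rewrite tnth0 ltr_norml; apply/andP.
    by move: h1 h3; rewrite /a /b /thead => h1 h3; split; lra.
  have [hx|hx] := pselect (`]a, b[%classic x).
    rewrite [in RHS]indicE mem_set// mule1; congr lebR; apply/funext => t.
    by rewrite !indicE; congr ((nat_of_bool _)%:R%:E); apply/idP/idP => /set_mem h; apply: mem_set; have := E t; tauto.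
  rewrite [in RHS]indicE memNset// mule0.
  transitivity (lebR (fun _ : n.-tuple R => 0)).
    congr lebR; apply/funext => t; rewrite indicE memNset//; have := E t; tauto.
  by rewrite lebRE// integral0.
rewrite ge0_integralZl//; [|exact/measurable_EFinP|by rewrite lee_fin exprn_ge0// mulrn_wge0].
rewrite integral_indic// setIT.
have Lab : lebesgue_measure (`]a, b[%classic : set R) = (e *+ 2)%:E.
  rewrite lebesgue_measure_itv/= lte_fin /a /b.
  case: ltP => h; first by rewrite -EFinB; congr EFin; ring.
  have -> : e = 0%R by lra.
  by rewrite mul0rn.
by rewrite [X in _ * X]Lab -EFinM exprSr.
Qed.

End lebesgue_tuple.

(** * Levy processes and the Markov property *)

Local Close Scope ereal_scope.

Lemma cf_unique1 {R : realType} {d : nat}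
    {d1} {O1 : measurableType d1} (m1 : {finite_measure set O1 -> \bar R})
    {d2} {O2 : measurableType d2} (m2 : {finite_measure set O2 -> \bar R})
    (Z1 : O1 -> d.-tuple R) (Z2 : O2 -> d.-tuple R) :
  measurable_fun setT Z1 -> measurable_fun setT Z2 ->
  (forall xi c, \int[m1]_w cos (dotv xi (Z1 w) + c) = \int[m2]_w cos (dotv xi (Z2 w) + c)) ->
  forall A, measurable A -> m1 (Z1 @^-1` A) = m2 (Z2 @^-1` A).
Proof.
move=> mZ1 mZ2 cfE A mA.
have := @cf_unique R d 1 _ _ m1 _ _ m2 (fun w _ => Z1 w) (fun w _ => Z2 w) (fun=> mZ1) (fun=> mZ2) _
  (fun=> A) (fun=> mA).
have E1 : [set w | 'I_1 -> A (Z1 w)] = Z1 @^-1` A.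
  by apply/seteqP; split=> w //= ; apply; exact: ord0.
have E2 : [set w | 'I_1 -> A (Z2 w)] = Z2 @^-1` A.
  by apply/seteqP; split=> w //= ; apply; exact: ord0.
rewrite E1 E2; apply => xi c; rewrite /phase.
by under eq_Rintegral do rewrite big_ord1; under [RHS]eq_Rintegral do rewrite big_ord1.
Qed.

Section levy_process.
Context {R : realType} {d : nat} {dO : measure_display} {O : measurableType dO}.
Local Notation V := (d.-tuple R).
Context {P : V -> probability O R} {X : R -> O -> V}.
Context {nu : {measure set V -> \bar R}} {p : R -> V -> R}.
Hypothesis HX : sym_levy_process P X nu p.
Local Notation psi := (levy_exponent nu).
Local Notation P0 := (P vzero).

Lemma levy_measurable t : 0 <= t -> measurable_fun setT (X t).
Proof. by case: HX => _ [h _]; exact: h. Qed.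

Lemma levy_start x : P x [set w | X 0 w = x] = 1%E.
Proof. by case: HX => _ [_ [h _]]; exact: h. Qed.

Lemma measurable_start x : measurable [set w | X 0 w = x].
Proof.
rewrite (_ : [set w | _] = \bigcap_(i in [set: 'I_d]) ((fun w => tnth (X 0 w) i) @^-1` [set tnth x i])).
  apply: fin_bigcap_measurable => // i _; rewrite -[X in measurable X]setTI.
  by apply: (measurable_tnth_comp i (levy_measurable (lexx 0))).
apply/seteqP; split=> [w /= <- //|w h /=].
by apply: eq_from_tnth => i; exact: h.
Qed.

Lemma ae_start x : {ae P x, forall w, X 0 w = x}.
Proof.
exists (~` [set w | X 0 w = x]); split.
- exact/measurableC/measurable_start.
- by rewrite probability_setC ?levy_start ?subee//; exact: measurable_start.
- by [].
Qed.

Definition incr r w := vsub (X r w) (X 0 w).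

Lemma measurable_incr r : 0 <= r -> measurable_fun setT (incr r).
Proof. by move=> r0; apply: measurable_vsub; exact: levy_measurable. Qed.

(** The hypothesis on the process speaks of step lengths from time 0; telescoping gives back the
    times [s]. The vanishing of the sine integral lets the phase [c] factor out as [cos c]. *)
Lemma fdd_cos x n (s : nat -> R) (xi : 'I_n -> V) c :
  s 0%N = 0 -> (forall k, (k < n)%N -> s k <= s k.+1) ->
  \int[P x]_w cos (\sum_(k < n) dotv (xi k) (vsub (X (s k.+1) w) (X (s k) w)) + c) =
  cos c * \prod_(k < n) expR (- ((s k.+1 - s k) * psi (xi k))).
Proof.
move=> s0 sle.
have sge k : (k <= n)%N -> 0 <= s k.
  by elim: k => [|k IH] kn; [rewrite s0|exact: le_trans (IH (ltnW kn)) (sle k kn)].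
case: HX => _ [_ [_ [_ [_ [fdd _]]]]].
have := fdd x n (fun k : 'I_n => s k.+1 - s k) xi.
have SE k : (k <= n)%N -> \sum_(j < n | (j < k)%N) (s j.+1 - s j) = s k.
  move=> kn; rewrite -(big_ord_widen _ (fun j => s j.+1 - s j) kn).
  by rewrite -(big_mkord xpredT (fun j => s j.+1 - s j)) telescope_sumr// s0 subr0.
pose ph w := \sum_(k < n) dotv (xi k) (vsub (X (s k.+1) w) (X (s k) w)).
have phE w : \sum_(k < n) dotv (xi k) (vsub
    (X (\sum_(j < n | (j < k.+1)%N) (s j.+1 - s j)) w) (X (\sum_(j < n | (j < k)%N) (s j.+1 - s j)) w)) = ph w.
  by apply: eq_bigr => k _; rewrite !SE// ltnW.
have mph : measurable_fun setT ph.
  apply: measurable_sum => k; apply: measurable_dotv.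
  by apply: measurable_vsub; apply: levy_measurable; apply: sge => //; exact: ltnW.
case=> [k|]; first by rewrite subr_ge0 sle.
under eq_integral do rewrite phE; move=> hc.
under eq_integral do rewrite phE; move=> hs.
have icos : (P x).-integrable setT (EFin \o (fun w => cos (ph w))).
  by apply: bmeas_int; exact: bmeas_cos.
have isin : (P x).-integrable setT (EFin \o (fun w => sin (ph w))).
  have : (P x).-integrable setT (EFin \o (fun w => cos (ph w - pi / 2))).
    by apply: bmeas_int; apply: bmeas_cos; exact: measurable_funB.
  by apply: eq_integrable => // w _ /=; rewrite cosBpihalf.
under eq_Rintegral do rewrite cosD [sin _ * sin c]mulrC [cos _ * cos c]mulrC.
rewrite RintegralB//; first last.
- exact: (integrableZl measurableT (sin c) isin).
- exact: (integrableZl measurableT (cos c) icos).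
rewrite !RintegralZl// /Rintegral hc hs /= mulr0 subr0.
by [].
Qed.

Lemma Rintegral_start x (f : O -> V -> R) :
  measurable_fun setT (fun w => f w (X 0 w)) -> measurable_fun setT (fun w => f w x) ->
  \int[P x]_w f w (X 0 w) = \int[P x]_w f w x.
Proof.
move=> m1 m2; congr fine; apply: ae_eq_integral => //; [exact/measurable_EFinP|exact/measurable_EFinP|].
by apply: filterS (ae_start x) => w /= ->.
Qed.

Lemma exchange_tri n (F : 'I_n -> 'I_n -> R) :
  \sum_(j < n) \sum_(k < n | (k <= j)%N) F j k = \sum_(k < n) \sum_(j < n | (k <= j)%N) F j k.
Proof. by rewrite (exchange_big_dep xpredT). Qed.

(** The Markov property on characteristic functions. Abel summation turns positions into increments,
    the increment [k] receiving the sum of the [eta j] with [j >= k]; the last increment then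
    contributes its own factor. *)
Lemma fdd_pos x n (s : nat -> R) (eta : 'I_n -> V) xi r c :
  s 0%N = 0 -> (forall k, (k < n)%N -> s k <= s k.+1) -> 0 <= r ->
  \int[P x]_w cos (\sum_(j < n) dotv (eta j) (X (s j.+1) w) +
                   dotv xi (vsub (X (s n + r) w) (X (s n) w)) + c) =
  expR (- (r * psi xi)) * \int[P x]_w cos (\sum_(j < n) dotv (eta j) (X (s j.+1) w) + c).
Proof.
move=> s0 sle r0.
have sge k : (k <= n)%N -> 0 <= s k.
  by elim: k => [|k IH] kn; [rewrite s0|exact: le_trans (IH (ltnW kn)) (sle k kn)].
pose zeta (k : 'I_n) : V := [tuple \sum_(j < n | (k <= j)%N) tnth (eta j) i | i < d].
have zE (k : 'I_n) y : dotv (zeta k) y = \sum_(j < n | (k <= j)%N) dotv (eta j) y.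
  rewrite /dotv exchange_big/=; apply: eq_bigr => i _.
  by rewrite tnth_mktuple mulr_suml.
have phE w : \sum_(j < n) dotv (eta j) (vsub (X (s j.+1) w) (X 0 w)) =
    \sum_(k < n) dotv (zeta k) (vsub (X (s k.+1) w) (X (s k) w)).
  under [RHS]eq_bigr do rewrite zE.
  rewrite -exchange_tri; apply: eq_bigr => j _.
  have -> : X 0 w = X (s 0%N) w by rewrite s0.
  rewrite dotvBr -[in LHS](telescope_sumr (fun k => dotv (eta j) (X (s k) w)))//.
  rewrite big_mkord (big_ord_widen n (fun k => dotv (eta j) (X (s k.+1) w) - dotv (eta j) (X (s k) w)))//.
  by apply: eq_big => k; rewrite ?ltnS// => _; rewrite dotvBr.
have mX k : (k <= n)%N -> measurable_fun setT (X (s k)).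
  by move=> kn; apply: levy_measurable; exact: sge.
have msum : measurable_fun setT (fun w => \sum_(j < n) dotv (eta j) (X (s j.+1) w)).
  by apply: measurable_sum => j; apply: measurable_dotv; exact: mX.
have mlast : measurable_fun setT (fun w => dotv xi (vsub (X (s n + r) w) (X (s n) w))).
  apply: measurable_dotv; apply: measurable_vsub; last exact: mX.
  by apply: levy_measurable; rewrite addr_ge0// sge.
(* Under [P x] the path starts at [x] almost surely, so the starting position only shifts the
   phase. *)
pose c' := \sum_(j < n) dotv (eta j) x + c.
have E1 w : \sum_(j < n) dotv (eta j) (X (s j.+1) w) + c =
    \sum_(k < n) dotv (zeta k) (vsub (X (s k.+1) w) (X (s k) w)) + (\sum_(j < n) dotv (eta j) (X 0 w) + c).
  rewrite -phE addrA; congr (_ + _); rewrite -big_split; apply: eq_bigr => j _ /=.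
  by rewrite dotvBr subrK.
have mc (g : O -> R) : measurable_fun setT g -> measurable_fun setT (fun w => cos (g w)).
  by move=> mg; have [] := bmeas_cos mg.
have mzeta : measurable_fun setT (fun w => \sum_(k < n) dotv (zeta k) (vsub (X (s k.+1) w) (X (s k) w))).
  by apply: measurable_sum => j; apply: measurable_dotv; apply: measurable_vsub; apply: mX => //; exact: ltnW.
have meta : measurable_fun setT (fun w => \sum_(j < n) dotv (eta j) (X 0 w)).
  by apply: measurable_sum => j; apply: measurable_dotv; exact: levy_measurable.
have -> : \int[P x]_w cos (\sum_(j < n) dotv (eta j) (X (s j.+1) w) + c) =
    \int[P x]_w cos (\sum_(k < n) dotv (zeta k) (vsub (X (s k.+1) w) (X (s k) w)) + c').
  under eq_Rintegral do rewrite E1.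
  apply: (Rintegral_start (f := fun w y => cos (\sum_(k < n) dotv (zeta k) (vsub (X (s k.+1) w) (X (s k) w)) + (\sum_(j < n) dotv (eta j) y + c)))).
    by apply: mc; apply: measurable_funD => //; exact: measurable_funD.
  by apply: mc; exact: measurable_funD.
pose s' k := if (k <= n)%N then s k else s n + r.
pose zeta' (k : 'I_n.+1) := if unlift ord_max k is Some k' then zeta k' else xi.
have zl k : zeta' (widen_ord (leqnSn n) k) = zeta k.
  have -> : widen_ord (leqnSn n) k = lift ord_max k by apply: ord_inj; rewrite lift_max.
  by rewrite /zeta' liftK.
have zm : zeta' ord_max = xi by rewrite /zeta' unlift_none.
have E2 w : \sum_(j < n) dotv (eta j) (X (s j.+1) w) + dotv xi (vsub (X (s n + r) w) (X (s n) w)) + c =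
   \sum_(k < n.+1) dotv (zeta' k) (vsub (X (s' k.+1) w) (X (s' k) w)) + (\sum_(j < n) dotv (eta j) (X 0 w) + c).
  rewrite big_ord_recr/= zm /s' leqnn ltnn addrAC E1 addrAC; congr (_ + _ + _).
  by apply: eq_bigr => k _; rewrite zl/= ltn_ord ltnW.
have mzeta' : measurable_fun setT (fun w => \sum_(k < n.+1) dotv (zeta' k) (vsub (X (s' k.+1) w) (X (s' k) w))).
  apply: measurable_sum => j; apply: measurable_dotv; apply: measurable_vsub; apply: levy_measurable; rewrite /s'.
    by case: ifP => jn; [exact: sge|rewrite addr_ge0// sge].
  by case: ifP => jn; [exact: sge|rewrite addr_ge0// sge].
have -> : \int[P x]_w cos (\sum_(j < n) dotv (eta j) (X (s j.+1) w) + dotv xi (vsub (X (s n + r) w) (X (s n) w)) + c) =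
    \int[P x]_w cos (\sum_(k < n.+1) dotv (zeta' k) (vsub (X (s' k.+1) w) (X (s' k) w)) + c').
  under eq_Rintegral do rewrite E2.
  apply: (Rintegral_start (f := fun w y => cos (\sum_(k < n.+1) dotv (zeta' k) (vsub (X (s' k.+1) w) (X (s' k) w)) + (\sum_(j < n) dotv (eta j) y + c)))).
    by apply: mc; apply: measurable_funD => //; exact: measurable_funD.
  by apply: mc; exact: measurable_funD.
rewrite (@fdd_cos x n.+1 s' zeta' c') ?(@fdd_cos x n s zeta c')//; last first.
  move=> k; rewrite ltnS => kn; rewrite /s' kn; case: ltnP => kn'; first exact: sle.
  have -> : k = n by apply/eqP; rewrite eqn_leq kn.
  by rewrite lerDl.
rewrite big_ord_recr/= [LHS]mulrA [LHS]mulrC; congr (_ * (_ * _)).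
  by rewrite /s' ltnn leqnn zm addrC addKr.
by apply: eq_bigr => k _; rewrite zl /s'/= ltn_ord ltnW.
Qed.

Lemma incr_cos x r xi c : 0 <= r ->
  \int[P x]_w cos (dotv xi (incr r w) + c) = expR (- (r * psi xi)) * cos c.
Proof.
move=> r0; have := @fdd_cos x 1 (fun k => if k is 0%N then 0 else r) (fun=> xi) c.
rewrite big_ord_recl big_ord0 mulr1/= subr0 mulrC => <- //; last by case.
by apply: eq_Rintegral => w _; rewrite big_ord_recl big_ord0 addr0.
Qed.

Lemma incr_law x r (A : set V) : 0 <= r -> measurable A ->
  P x (incr r @^-1` A) = P0 (incr r @^-1` A).
Proof.
move=> r0; have mr := measurable_incr r0.
by apply: (cf_unique1 mr mr) => xi c; rewrite !incr_cos.
Qed.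

End levy_process.
Arguments incr {R d dO O} X r w.

Section finite_product.
Local Open Scope ereal_scope.
Context {R : realType} {d1} {T1 : measurableType d1} {d2} {T2 : measurableType d2}.
Variables (m1 : {finite_measure set T1 -> \bar R}) (m2 : {finite_measure set T2 -> \bar R}).

Definition fprod : set (T1 * T2) -> \bar R := m1 \x m2.

HB.instance Definition _ := Measure.on fprod.

Let fprod_fin : fin_num_fun fprod.
Proof.
apply: lty_fin_num_fun.
have E : fprod setT = m1 setT * m2 setT by rewrite -setXTT; exact: product_measure1E.
by rewrite [X in X < _]E lte_mul_pinfty ?fin_num_measure// ltey_eq fin_num_measure.
Qed.

HB.instance Definition _ := Measure_isFinite.Build _ _ _ fprod fprod_fin.

Lemma ge0_integral_fprod (f : T1 * T2 -> \bar R) : measurable_fun setT f -> (forall z, 0 <= f z) ->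
  \int[fprod]_z f z = \int[m1]_x \int[m2]_y f (x, y).
Proof. by move=> mf f0; exact: fubini_tonelli1. Qed.

Lemma fprodE A B : measurable A -> measurable B -> fprod (A `*` B) = m1 A * m2 B.
Proof. exact: product_measure1E. Qed.

Lemma Rintegral_fprod (f : T1 * T2 -> R) : bmeas f ->
  (\int[fprod]_z f z = \int[m1]_x (\int[m2]_y f (x, y)))%R.
Proof.
move=> bf; have fi := bmeas_int fprod bf.
congr fine; rewrite -(integral12_prod_meas1 fi); apply: eq_integral => x _.
rewrite /fubini_F /Rintegral fineK//.
have [mf [M fM]] := bf.
have bfx : bmeas (fun y => f (x, y)).
  by split; [exact: measurableT_comp|exists M].
by apply: integrable_fin_num => //; exact: (bmeas_int m2 bfx).
Qed.

End finite_product.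

Section markov.
Context {R : realType} {d : nat} {dO : measure_display} {O : measurableType dO}.
Local Notation V := (d.-tuple R).
Context {P : V -> probability O R} {X : R -> O -> V}.
Context {nu : {measure set V -> \bar R}} {p : R -> V -> R}.
Hypothesis HX : sym_levy_process P X nu p.
Local Notation psi := (levy_exponent nu).
Local Notation P0 := (P vzero).
Local Notation incr := (incr X).

Definition cylinder (X : R -> O -> V) (t : R) : set (set O) := [set B | exists n (u : 'I_n -> R) (A : 'I_n -> set V),
  (forall j, 0 <= u j <= t) /\ (forall j, measurable (A j)) /\
  B = [set w | forall j, A j (X (u j) w)]].

Definition past (X : R -> O -> V) (t : R) : set (set O) := <<s cylinder X t >>.

Lemma cylinder_measurable t : cylinder X t `<=` measurable.
Proof.
move=> _ [n [u [A [u0t [mA ->]]]]].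
rewrite (_ : [set w | _] = \bigcap_(i in [set: 'I_n]) (X (u i) @^-1` A i)).
  apply: fin_bigcap_measurable => // i _; rewrite -[X in measurable X]setTI.
  by apply: (levy_measurable HX) => //; have /andP[] := u0t i.
by apply/seteqP; split=> [w h j _|w h j]; exact: h.
Qed.

Lemma past_measurable t : past X t `<=` measurable.
Proof. by apply: smallest_sub; [exact: sigma_algebra_measurable|exact: cylinder_measurable]. Qed.

Lemma past_levy t u A : 0 <= u <= t -> measurable A -> past X t (X u @^-1` A).
Proof.
move=> ut mA; apply: sub_gen_smallest; exists 1%N, (fun=> u), (fun=> A); split => //; split => //.
by apply/seteqP; split=> w //=; apply; exact: ord0.
Qed.

Lemma past_setI t A B : past X t A -> past X t B -> past X t (A `&` B).
Proof. exact: (@measurableI _ (g_sigma_algebraType (cylinder X t))). Qed.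

Lemma past_setC t A : past X t A -> past X t (~` A).
Proof. exact: (@measurableC _ (g_sigma_algebraType (cylinder X t))). Qed.

Lemma past_setT t : past X t setT.
Proof. exact: (@measurableT _ (g_sigma_algebraType (cylinder X t))). Qed.

Lemma past_bigcup t (F : nat -> set O) : (forall k, past X t (F k)) -> past X t (\bigcup_k F k).
Proof. exact: (@bigcupT_measurable _ (g_sigma_algebraType (cylinder X t))). Qed.

Lemma past_bigcap t (F : nat -> set O) : (forall k, past X t (F k)) -> past X t (\bigcap_k F k).
Proof. exact: (@bigcapT_measurable _ (g_sigma_algebraType (cylinder X t))). Qed.

Lemma past_le s t : s <= t -> past X s `<=` past X t.
Proof.
move=> st; apply: smallest_sub; first exact: smallest_sigma_algebra.
move=> _ [n [u [A [u0t [mA ->]]]]]; apply: sub_gen_smallest.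
exists n, u, A; split => // j; have /andP[-> h] := u0t j; exact: le_trans h st.
Qed.

(** The positions on a grid up to [t] and the next increment have under [P x] the same joint
    characteristic function as on the product space, where the increment is taken from an
    independent copy under [P vzero]; [cf_unique] concludes. *)
Lemma markov_cylinder x t r B A : 0 <= t -> 0 <= r -> cylinder X t B -> measurable A ->
  P x (B `&` [set w | A (vsub (X (t + r) w) (X t w))]) = (P x B * P0 (incr r @^-1` A))%E.
Proof.
move=> t0 r0 [n [u [C [u0t [mC BE]]]]] mA.
(* The times of the cylinder are unordered and may repeat; sorted together with [t] they form a grid
   whose last point is [t]. *)
pose ts := sort <=%O (t :: codom u).
have szts : size ts = n.+1 by rewrite size_sort/= size_codom card_ord.
have stot : sorted <=%O ts by apply: sort_sorted; exact: le_total.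
have memts y : y \in ts -> 0 <= y <= t.
  rewrite mem_sort inE => /predU1P[->|/codomP[j ->]]; last exact: u0t.
  by rewrite t0 lexx.
pose s k := if k is k'.+1 then nth t ts k' else 0.
have sle k : (k < n.+1)%N -> s k <= s k.+1.
  case: k => [_|k kn] /=.
    by have /memts/andP[] : nth t ts 0 \in ts by rewrite mem_nth// szts.
  by apply: (sorted_leq_nth le_trans le_refl t stot); rewrite ?inE ?szts// ltnW.
have sn : s n.+1 = t.
  have ht : nth t ts n \in ts by rewrite mem_nth// szts.
  apply/eqP; rewrite eq_le; have /andP[_ ->] /= := memts _ ht.
  have tin : t \in ts by rewrite mem_sort inE eqxx.
  have hi : (index t ts <= n)%N by rewrite -ltnS -szts index_mem.
  rewrite -{1}(nth_index t tin).
  by apply: (sorted_leq_nth le_trans le_refl t stot); rewrite ?inE ?szts// ltnS.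
have us j : exists k : 'I_n.+1, u j = s k.+1.
  have uin : u j \in ts by rewrite mem_sort inE codom_f orbT.
  have hi : (index (u j) ts < n.+1)%N by rewrite -szts index_mem.
  by exists (Ordinal hi) => /=; rewrite nth_index.
have sge k : (k <= n.+1)%N -> 0 <= s k.
  by elim: k => [|k IH] kn //; exact: le_trans (IH (ltnW kn)) (sle k kn).
pose Dl w := vsub (X (t + r) w) (X t w).
have mD : measurable_fun setT Dl.
  by apply: measurable_vsub; apply: (levy_measurable HX); rewrite ?addr_ge0.
have mS (k : 'I_n.+1) : measurable_fun setT (X (s k.+1)) by apply: (levy_measurable HX); exact: sge.
pose Z1 w (j : 'I_n.+2) := if unlift ord_max j is Some k then X (s (k : nat).+1) w else Dl w.
pose Z2 (w : O * O) (j : 'I_n.+2) := if unlift ord_max j is Some k then X (s (k : nat).+1) w.1 else incr r w.2.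
have mZ1 j : measurable_fun setT (fun w => Z1 w j).
  by rewrite /Z1; case: unliftP => [k|] _.
have mZ2 j : measurable_fun setT (fun w => Z2 w j).
  rewrite /Z2; case: unliftP => [k|] _; first exact: measurableT_comp.
  by apply: measurableT_comp => //; exact: measurable_incr HX _ r0.
have wl k : widen_ord (leqnSn n.+1) k = lift ord_max k by apply: ord_inj; rewrite lift_max.
(* Several constraints of the cylinder may bear on the same time; they are collected at the
   corresponding grid point. *)
pose Aj (j : 'I_n.+2) := if unlift ord_max j is Some k then
   [set y | forall i, u i = s (k : nat).+1 -> C i y] else A.
have mAj j : measurable (Aj j).
  rewrite /Aj; case: unliftP => [k|] _ //.
  rewrite (_ : [set y | _] = \bigcap_(i in [set i | u i = s (k : nat).+1]) C i).
    by apply: fin_bigcap_measurable => //; exact: finite_finset.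
  by apply/seteqP; split=> y h i; exact: h.
have AjE (z : 'I_n.+2 -> V) y w : (forall k, z (lift ord_max k) = X (s (k : nat).+1) w) -> z ord_max = y ->
   (forall j, Aj j (z j)) <-> (B w /\ A y).
  move=> zk zm; rewrite BE /=; split=> [h|[h1 h2] j].
    split; last by have := h ord_max; rewrite /Aj unlift_none zm.
    move=> i; have [k uk] := us i; have := h (lift ord_max k).
    by rewrite /Aj liftK zk /= uk; apply.
  rewrite /Aj; case: unliftP => [k|] ->; last by rewrite zm.
  by rewrite zk => i <-; exact: h1.
have := @cf_unique R d n.+2 _ _ (P x) _ _ (fprod (P x) P0) Z1 Z2 mZ1 mZ2 _ Aj mAj.
have -> : [set w | forall j, Aj j (Z1 w j)] = B `&` [set w | A (Dl w)].
  apply/seteqP; split=> w /=; rewrite (AjE _ (Dl w) w)// => [k|]; rewrite /Z1 ?liftK ?unlift_none//.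
have -> : [set w | forall j, Aj j (Z2 w j)] = B `*` (incr r @^-1` A).
  apply/seteqP; split=> -[w w'] /=; rewrite (AjE _ (incr r w') w)// => [k|]; rewrite /Z2 ?liftK ?unlift_none//.
move=> ->.
- apply: fprodE.
    by apply: (@cylinder_measurable t); exists n, u, C.
  by rewrite -[X in measurable X]setTI; exact: (measurable_incr HX).
- move=> xi c.
  pose eta k := xi (widen_ord (leqnSn n.+1) k).
  have ph1 w : phase xi (Z1 w) = \sum_(k < n.+1) dotv (eta k) (X (s k.+1) w) +
      dotv (xi ord_max) (vsub (X (s n.+1 + r) w) (X (s n.+1) w)).
    rewrite sn /phase big_ord_recr/= /Z1 unlift_none; congr (_ + _).
    by apply: eq_bigr => k _; rewrite /eta wl liftK.
  have ph2 z : phase xi (Z2 z) = \sum_(k < n.+1) dotv (eta k) (X (s k.+1) z.1) + dotv (xi ord_max) (incr r z.2).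
    rewrite /phase big_ord_recr/= /Z2 unlift_none; congr (_ + _).
    by apply: eq_bigr => k _; rewrite /eta wl liftK.
  rewrite Rintegral_fprod; last by apply: bmeas_cos; exact: measurable_phase1 mZ2 _ _.
  under eq_Rintegral do rewrite ph1.
  rewrite (fdd_pos HX)//.
  have mc : bmeas (fun w => cos (\sum_(k < n.+1) dotv (eta k) (X (s k.+1) w) + c)).
    apply: bmeas_cos; apply: measurable_funD => //; apply: measurable_sum => k.
    exact: measurable_dotv.
  rewrite -RintegralZl//; last exact: bmeas_int.
  apply: eq_Rintegral => w _.
  under eq_Rintegral do rewrite ph2 /= addrAC addrC.
  by rewrite (incr_cos HX).
Qed.

(** In [B] both sides are finite measures, and cylinders are stable under intersection, so agreement
    on cylinders is enough. *)
Lemma markov_set x t r B A : 0 <= t -> 0 <= r -> past X t B -> measurable A ->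
  P x (B `&` [set w | A (vsub (X (t + r) w) (X t w))]) = (P x B * P0 (incr r @^-1` A))%E.
Proof.
move=> t0 r0 pB mA.
set E := [set w | A (vsub (X (t + r) w) (X t w))].
have mE : measurable E.
  rewrite -[X in measurable X]setTI; apply: measurable_vsub => //; apply: (levy_measurable HX) => //.
  exact: addr_ge0.
have cf : P0 (incr r @^-1` A) \is a fin_num.
  by apply: fin_num_measure; rewrite -[X in measurable X]setTI; exact: (measurable_incr HX).
pose c : {nonneg R} := NngNum (fine_ge0 (measure_ge0 P0 (incr r @^-1` A))).
have := @g_sigma_algebra_measure_unique _ R O (cylinder X t) (@cylinder_measurable t) (fun=> setT) _ _
  (mrestr (P x) mE) (mscale c (P x)) _ _ _ B pB.
rewrite /= /mscale /mrestr /= fineK// muleC; apply.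
- move=> _; exists 0%N, (fun=> 0), (fun=> setT); split; first by case.
  by split => //; apply/seteqP; split => // w _ [].
- by rewrite bigcup_const.
- move=> _ _ [n1 [u1 [A1 [h1 [m1 ->]]]]] [n2 [u2 [A2 [h2 [m2 ->]]]]].
  exists (n1 + n2)%N, (fun j : 'I_(n1 + n2) => match fintype.split j with inl a => u1 a | inr b => u2 b end),
    (fun j : 'I_(n1 + n2) => match fintype.split j with inl a => A1 a | inr b => A2 b end).
  split; first by move=> j; case: (fintype.split j).
  split; first by move=> j; case: (fintype.split j).
  apply/seteqP; split=> [w [g1 g2] j|w h]; first by case: (fintype.split j).
  split=> j; first by have := h (lshift n2 j); rewrite (unsplitK (inl j)).
  by have := h (rshift n1 j); rewrite (unsplitK (inr j)).
- by move=> C cC; rewrite /E markov_cylinder//= muleC.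
- by move=> _; rewrite setTI (le_lt_trans (probability_le1 _ mE))// ltry.
Qed.

(** [U] takes values in an arbitrary measurable space so that it can carry an event of the past
    along with the position at time [t]. *)
Lemma levy_markov {dT} {T : measurableType dT} x t r (U : O -> T) (g : T * V -> \bar R) :
  0 <= t -> 0 <= r -> (forall A, measurable A -> past X t (U @^-1` A)) ->
  measurable_fun setT g -> (forall z, 0 <= g z)%E ->
  (\int[P x]_w g (U w, vsub (X (t + r) w) (X t w)) = \int[P x]_w \int[P0]_w' g (U w, incr r w'))%E.
Proof.
move=> t0 r0 pU mg g0.
have mU : measurable_fun setT U by move=> _ A mA; rewrite setTI; apply: past_measurable; exact: pU.
have mD : measurable_fun setT (fun w => vsub (X (t + r) w) (X t w)).
  by apply: measurable_vsub; apply: (levy_measurable HX); rewrite ?addr_ge0.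
have mi := measurable_incr HX r0.
have mg2 : measurable_fun setT (fun z : O * O => g (U z.1, incr r z.2)).
  by apply: measurableT_comp => //; apply: measurable_fun_pair; exact: measurableT_comp.
rewrite -(@ge0_integral_fprod _ _ _ _ _ (P x) P0 _ mg2)//.
apply: (@eq_law_pair _ _ _ _ _ _ _ _ _ (P x) (fprod (P x) P0) U _ (U \o fst) (incr r \o snd)) => //.
- exact: measurableT_comp.
- exact: measurableT_comp.
move=> A B mA mB.
have -> : (U \o fst) @^-1` A `&` (incr r \o snd) @^-1` B = (U @^-1` A) `*` (incr r @^-1` B) by [].
have mUA : measurable (U @^-1` A) by apply: past_measurable; exact: pU.
have miB : measurable (incr r @^-1` B) by rewrite -[X in measurable X]setTI; exact: mi.
apply: (etrans _ (esym (fprodE (P x) P0 mUA miB))).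
by apply: markov_set => //; exact: pU.
Qed.

End markov.

(** * Exit from an open set *)

Section open_sets.
Context {R : realType} {d : nat}.
Local Notation V := (d.-tuple R).
Implicit Types (U D : set V) (x z : V).

Lemma box_sym (c y : V) e : box c e y -> box y e c.
Proof. by move=> h i; rewrite distrC; exact: h. Qed.

Lemma box_trans (a b c : V) e f : box a e b -> box b f c -> box a (e + f) c.
Proof.
move=> h1 h2 i; have := h1 i; have := h2 i => k2 k1.
rewrite (_ : tnth c i - tnth a i = (tnth c i - tnth b i) + (tnth b i - tnth a i)); last by ring.
by rewrite (le_lt_trans (ler_normD _ _))// addrC ltrD.
Qed.

Lemma box_le (a b : V) e f : e <= f -> box a e b -> box a f b.
Proof. by move=> ef h i; exact: lt_le_trans (h i) ef. Qed.

Lemma box_center (a : V) e : 0 < e -> box a e a.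
Proof. by move=> e0 i; rewrite subrr normr0. Qed.

(* The strict inequalities leave a common margin over the finitely many coordinates. *)
Lemma box_margin (a b : V) e : 0 < e -> box a e b -> exists2 f, 0 < f & forall c, box b f c -> box a e c.
Proof.
move=> e0 ab.
suff [f f0 fP] : exists2 f, 0 < f & box a (e - f) b.
  exists f => // c bc; rewrite (_ : e = e - f + f); last by ring.
  exact: box_trans bc.
have [f f0 fP] : exists2 f, 0 < f & forall i, i \in enum 'I_d -> `|tnth b i - tnth a i| < e - f.
  elim: (enum 'I_d) => [|i s [f f0 IH]]; first by exists e.
  exists (Num.min f ((e - `|tnth b i - tnth a i|) / 2)).
    by rewrite lt_min f0 divr_gt0// subr_gt0.
  move=> j; rewrite inE => /predU1P[->|js].
    have := ab i; rewrite ltrBrDr -ltrBrDl => h.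
    by rewrite gt_min; apply/orP; right; lra.
  by rewrite (lt_le_trans (IH j js))// lerD2l lerN2 ge_min lexx.
by exists f => // i; apply: fP; rewrite mem_enum.
Qed.

Lemma ex_inv_lt (e : R) : 0 < e -> exists k : nat, forall l, (k <= l)%N -> l.+1%:R^-1 < e.
Proof.
move=> e0; exists (Num.bound e^-1) => l kl.
rewrite invf_plt ?posrE//.
rewrite (lt_le_trans (archi_boundP (ltW _)))// ?invr_gt0// ler_nat.
exact: leq_trans kl _.
Qed.

Lemma ex_half_lt (e : R) : 0 < e -> exists k : nat, forall l, (k <= l)%N -> (2 ^+ l)^-1 < e.
Proof.
move=> /ex_inv_lt[k hk]; exists k => l kl.
apply: le_lt_trans (hk l kl); rewrite lef_pV2 ?posrE ?exprn_gt0//.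
by rewrite -natrX ler_nat ltn_expl.
Qed.

(** The set is the union of the cubes with rational center and radius [k.+1%:R^-1] that it contains;
    [F] enumerates these through [unpickle]. *)
Lemma open_Rd_measurable U : open_Rd U -> measurable U.
Proof.
move=> oU.
pose q (c : d.-tuple rat) : V := [tuple ratr (tnth c i) | i < d].
pose F (m : nat) : set V := if unpickle m is Some (c, k) then
  if asbool (box (q c) (k : nat).+1%:R^-1 `<=` U) then box (q c) k.+1%:R^-1 else set0 else set0.
rewrite (_ : U = \bigcup_m F m).
  apply: bigcupT_measurable => m; rewrite /F; case: unpickle => [[c k]|] //.
  by case: ifP => // _; exact: measurable_box.
apply/seteqP; split=> [x Ux|x [m _]]; last first.
  by rewrite /F; case: unpickle => [[c k]|] //; case: ifPn => // /asboolP h /h.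
have [e [e0 eU]] := oU x Ux.
(* Half of [e], because the distance from [x] to a point of the cube is bounded through the center,
   by twice the radius. *)
have [k kP] := ex_inv_lt (divr_gt0 e0 (ltr0n R 2)).
have := kP k (leqnn k); set f := k.+1%:R^-1 => fe.
have f0 : 0 < f by rewrite invr_gt0.
have /choice[c cP] (i : 'I_d) : exists r : rat, `|tnth x i - ratr r| < f.
  have [r] := @rat_in_itvoo R (tnth x i) (tnth x i + f) ltac:(by rewrite ltrDl).
  by rewrite in_itv/= => /andP[r1 r2]; exists r; rewrite ltr_norml; apply/andP; split; lra.
pose cc : d.-tuple rat := [tuple c i | i < d].
have xb : box (q cc) f x by move=> i; rewrite !tnth_mktuple; exact: cP.
exists (pickle (cc, k)) => //; rewrite /F pickleK.
have -> : `[< box (q cc) f `<=` U >] => //.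
apply/asboolP => y yb; apply: eU => i.
have := box_trans (box_sym xb) yb i; lra.
Qed.

End open_sets.

(** * Approximation of the domain from inside by closed sets *)

Section inner_sets.
Context {R : realType} {d : nat}.
Local Notation V := (d.-tuple R).
Variable D : set V.

(** The points at sup-distance at least [n.+1%:R^-1] from the complement of [D]. As boxes are open,
    this is a closed set, so a right-continuous path that leaves it stays out for a while. *)
Definition inner n : set V := [set x | box x n.+1%:R^-1 `<=` D].

Lemma inner_sub n : inner n `<=` D.
Proof. by move=> x; apply; apply: box_center; rewrite invr_gt0. Qed.

Lemma inner_mono n m : (n <= m)%N -> inner n `<=` inner m.
Proof.
move=> nm x h y; move=> yb; apply: h; apply: box_le yb.
by rewrite lef_pV2 ?posrE// ler_nat ltnS.
Qed.

Lemma inner_cover x : open_Rd D -> D x -> exists n, inner n x.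
Proof.
move=> oD Dx; have [e [e0 eD]] := oD x Dx; have [k kP] := ex_inv_lt e0.
by exists k => y yb; apply: eD => i; exact: lt_trans (yb i) (kP k (leqnn k)).
Qed.

(** Half of the margin is given up: [n.*2.+2] equals [2 * n.+1]. *)
Lemma inner_step n x : inner n x -> exists2 e, 0 < e & forall y, box x e y -> inner (n.*2.+1) y.
Proof.
move=> nx; exists (n.*2.+2%:R^-1); first by rewrite invr_gt0.
move=> y xy z yz; apply: nx; apply: box_le (box_trans xy yz).
have -> : (n.*2.+2 = 2 * n.+1)%N by rewrite mul2n.
rewrite natrM invfM -mulrDl ler_piMl ?invr_ge0//; lra.
Qed.

Lemma innerC_open n : open_Rd (~` inner n).
Proof.
move=> x /existsNP[z] /not_implyP[xz nDz].
have i0 : 0 < n.+1%:R^-1 :> R by rewrite invr_gt0.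
have [f f0 fP] := box_margin i0 (box_sym xz).
exists f; split => // y yb h; apply: nDz; apply: h; apply: box_sym; exact: fP.
Qed.

Lemma measurable_inner n : measurable (inner n).
Proof. by rewrite -[inner n]setCK; apply: measurableC; apply: open_Rd_measurable; exact: innerC_open. Qed.

End inner_sets.

(** * Survival as an event of the past, and the lifetime *)

Section paths.
Context {R : realType} {d : nat} {dO : measure_display} {O : measurableType dO}.
Local Notation V := (d.-tuple R).
Context {P : V -> probability O R} {X : R -> O -> V}.
Context {nu : {measure set V -> \bar R}} {p : R -> V -> R}.
Hypothesis HX : sym_levy_process P X nu p.
Variable D : set V.

Lemma levy_right_cont w t e : 0 <= t -> 0 < e ->
  exists2 del, 0 < del & forall s, t <= s < t + del -> box (X t w) e (X s w).
Proof.
move=> t0 e0; case: HX => _ [_ [_ [rc _]]].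
have h : \forall s \near t^'+, forall i, `|tnth (X t w) i - tnth (X s w) i| < e.
  apply: filter_forall => i; have /cvgrPdist_lt/(_ _ e0) := rc w t i t0; exact.
case: h => del /= del0 hd; exists del => // s /andP[].
rewrite le_eqVlt => /predU1P[<- _|ts sd]; first exact: box_center.
apply: box_sym => i; apply: (hd s) => //=.
by rewrite ltr0_norm ?subr_lt0// opprB ltrBlDl.
Qed.

Definition stay n a b : set O := [set w | forall s, a <= s <= b -> inner D n (X s w)].
(** Survival with a margin that is uniform on [0, t]: left limits, too, keep away from the
    complement of [D]. This is stronger than having [X s w] in [D] for all [s <= t]. *)
Definition alive t : set O := [set w | exists n, stay n 0 t w].

Lemma ex_dyadic (a s del t : R) : a <= s < t -> 0 < del -> exists k0 : nat, forall k, (k0 <= k)%N ->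
  exists j : nat, s < a + j%:R * ((t - a) / 2 ^+ k) < s + del /\ (j <= 2 ^ k)%N.
Proof.
move=> /andP[as_ st] del0; have ta : 0 < t - a by lra.
have [k0 kP] := ex_half_lt (divr_gt0 del0 ta).
exists k0 => k /kP kd; pose h := (t - a) / 2 ^+ k.
have p2 : 0 < 2 ^+ k :> R by rewrite exprn_gt0.
have h0 : 0 < h by rewrite divr_gt0.
have hd : h < del by rewrite /h -ltr_pdivlMl// mulrC.
pose j := (Num.truncn ((s - a) / h)).+1.
have js : (s - a) / h < j%:R by rewrite truncnS_gt.
have js' : j%:R <= (s - a) / h + 1.
  by rewrite /j -natr1 lerD2r truncn_le divr_ge0 ?subr_ge0// ltW.
exists j; rewrite -/h; split.
  apply/andP; split; first by move: js; rewrite ltr_pdivrMr//; lra.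
  move: js'; rewrite -lerBlDr ler_pdivlMr// => js'.
  have := js'; rewrite mulrBl mul1r; lra.
have h1 : (s - a) / h < 2 ^+ k by rewrite ltr_pdivrMr// /h mulrC divfK ?gt_eqF//; lra.
have : ((Num.truncn ((s - a) / h))%:R < (2 ^ k)%:R :> R).
  rewrite natrX (le_lt_trans _ h1)// truncn_le divr_ge0 ?subr_ge0// ltW//.
by rewrite ltr_nat.
Qed.

Lemma dyadic_itv (a t : R) j k : a <= t -> (j <= 2 ^ k)%N ->
  a <= a + j%:R * ((t - a) / 2 ^+ k) <= t.
Proof.
move=> at_ jk; have p2 : 0 < 2 ^+ k :> R by rewrite exprn_gt0.
have q0 : 0 <= (t - a) / 2 ^+ k by rewrite divr_ge0 ?subr_ge0// ltW.
rewrite lerDl mulr_ge0//= -lerBrDl mulrA ler_pdivrMr// mulrC ler_wpM2l ?subr_ge0//.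
by rewrite -natrX ler_nat.
Qed.

(** If the path is outside the closed set at a time [s < t], by right continuity it remains outside
    up to some dyadic time. The end point [t] has no such neighbourhood in the interval, but it is
    itself a grid point. *)
Lemma stay_grid n a t w : 0 <= a -> a <= t ->
  stay n a t w <-> forall k j : nat, (j <= 2 ^ k)%N -> inner D n (X (a + j%:R * ((t - a) / 2 ^+ k)) w).
Proof.
move=> a0 at_; split=> [h k j jk|h s /andP[as_ st]].
  by apply: h; exact: dyadic_itv.
move: st; rewrite le_eqVlt => /predU1P[->|st].
  by have := h 0%N 1%N (leqnn _); rewrite expr0 divr1 mul1r addrC subrK.
apply: contrapT => /innerC_open[e [e0 eP]].
have [del del0 dP] := @levy_right_cont w s e (le_trans a0 as_) e0.
have [|k0 /(_ k0 (leqnn _))[j [/andP[j1 j2] jk]]] := @ex_dyadic a s del t _ del0; first by rewrite as_.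
by apply: (eP (X (a + j%:R * ((t - a) / 2 ^+ k0)) w)); [apply: dP; rewrite ltW|exact: h].
Qed.

(** [minn] lets [j] run over all naturals, so that the intersection is countable without a side
    condition. *)
Lemma stay_bigcap n a t : 0 <= a -> a <= t ->
  stay n a t = \bigcap_k \bigcap_j
    (X (a + (minn j (2 ^ k))%:R * ((t - a) / 2 ^+ k)) @^-1` inner D n).
Proof.
move=> a0 at_; apply/seteqP; split=> w.
  by move=> /stay_grid h k _ j _; apply: h => //; exact: geq_minr.
by move=> h; apply/stay_grid => // k j jk; have := h k Logic.I j Logic.I; rewrite /= (minn_idPl jk).
Qed.

Lemma past_stay n a t : 0 <= a -> a <= t -> past X t (stay n a t).
Proof.
move=> a0 at_; rewrite stay_bigcap//; apply: past_bigcap => k; apply: past_bigcap => j.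
apply: past_levy; last exact: measurable_inner.
by have /andP[h ->] := dyadic_itv at_ (geq_minr j (2 ^ k)); rewrite (le_trans a0 h).
Qed.

Lemma alive_bigcup t : alive t = \bigcup_n stay n 0 t.
Proof. by apply/seteqP; split=> [w [n h]|w [n _ h]]; exists n. Qed.

Lemma past_alive t : 0 <= t -> past X t (alive t).
Proof. by move=> t0; rewrite alive_bigcup; apply: past_bigcup => n; exact: past_stay. Qed.

Lemma measurable_alive t : 0 <= t -> measurable (alive t).
Proof. by move=> t0; apply: (past_measurable HX); exact: past_alive. Qed.

Lemma measurable_stay n a t : 0 <= a -> a <= t -> measurable (stay n a t).
Proof. by move=> a0 at_; apply: (past_measurable HX); exact: past_stay. Qed.

Lemma stay_mono n m a t : (n <= m)%N -> stay n a t `<=` stay m a t.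
Proof. by move=> nm w h s st; apply: inner_mono nm _ _; exact: h. Qed.

Lemma alive_le s t : s <= t -> alive t `<=` alive s.
Proof. by move=> st w [n h]; exists n => u /andP[u0 us]; apply: h; rewrite u0 (le_trans us). Qed.

Lemma alive_in t s w : 0 <= s <= t -> alive t w -> D (X s w).
Proof. by move=> st [n h]; apply: inner_sub (h s st). Qed.

(** The margin leaves room to move: by right continuity the path spends a little more time in a
    slightly larger inner set. This makes the inequality strict in [lifetime_gt]. *)
Lemma alive_right t w : 0 <= t -> alive t w -> exists2 e, 0 < e & alive (t + e) w.
Proof.
move=> t0 [n h].
have /inner_step[e e0 eP] : inner D n (X t w) by apply: h; rewrite t0 lexx.
have [del del0 dP] := levy_right_cont w t0 e0.
exists (del / 2); first by rewrite divr_gt0.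
exists (n.*2.+1) => s /andP[s0 st]; have [ts|ts] := leP t s.
  by apply: eP; apply: dP; rewrite ts/=; lra.
apply: inner_mono (h s _); last by rewrite s0 ltW.
by rewrite -addnn -addSn leq_addl.
Qed.

Lemma alive_split s t : 0 <= s -> 0 <= t ->
  alive (s + t) = alive s `&` \bigcup_n stay n s (s + t).
Proof.
move=> s0 t0; apply/seteqP; split=> w.
  move=> [n h]; split; last exists n => //.
    by exists n => u /andP[u0 us]; apply: h; rewrite u0 (le_trans us)// lerDl.
  by move=> u /andP[su ut]; apply: h; rewrite ut (le_trans s0).
move=> [[n h] [m _ k]]; exists (maxn n m) => u /andP[u0 ut].
have [us|su] := leP u s; first by apply: inner_mono (leq_maxl n m) _ _; apply: h; rewrite u0.
by apply: inner_mono (leq_maxr n m) _ _; apply: k; rewrite ltW.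
Qed.

(** The limit of the exit times from the sets [inner D n]; it never exceeds the exit time from [D]
    for a path started in [D], but may precede it. *)
Definition lifetime w : \bar R := ereal_inf [set t%:E | t in [set t : R | 0 <= t /\ ~ alive t w]].

Lemma lifetime_ge0 w : (0 <= lifetime w)%E.
Proof. by apply: le_ereal_inf_tmp => _ [t [t0 _] <-]; rewrite lee_fin. Qed.

Lemma lifetime_gt t w : 0 <= t -> (t%:E < lifetime w)%E <-> alive t w.
Proof.
move=> t0; split=> [tl|/alive_right-/(_ t0)[e e0 h]].
  apply: contrapT => nt; have : (lifetime w <= t%:E)%E by apply: ereal_inf_lbound; exists t.
  by rewrite leNgt tl.
apply: (@lt_le_trans _ _ (t + e)%:E); first by rewrite lte_fin ltrDl.
apply: le_ereal_inf_tmp => _ [s [s0 ns] <-]; rewrite lee_fin leNgt.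
by apply/negP => se; apply: ns; apply: alive_le h; exact: ltW.
Qed.

Lemma lifetime_le_exit w : D (X 0 w) -> (lifetime w <= exit_time X D w)%E.
Proof.
move=> Dx; apply: le_ereal_inf_tmp => _ [t [t0 nD] <-].
apply: ereal_inf_lbound; exists t => //; split; first exact: ltW.
by move=> h; apply: nD; apply: alive_in h; rewrite lexx ltW.
Qed.

Lemma measurable_lifetime : measurable_fun setT lifetime.
Proof.
apply: (measurability _ (ErealGenOInfty.measurableE R)) => // _ [_ [x ->] <-].
rewrite setTI; have [x0|x0] := ltP x 0.
  rewrite (_ : _ @^-1` _ = setT)//; apply/seteqP; split=> // w _ /=.
  by rewrite in_itv/= andbT (lt_le_trans _ (lifetime_ge0 w))// lte_fin.
rewrite (_ : _ @^-1` _ = alive x); first exact: measurable_alive.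
by apply/seteqP; split=> w /=; rewrite in_itv/= andbT => /(lifetime_gt _ x0).
Qed.

End paths.
Arguments stay {R d dO O} X D n a b.
Arguments alive {R d dO O} X D t.
Arguments lifetime {R d dO O} X D w.

(** * Almost sure equality of lifetime and exit time *)

Section eventually.
Local Open Scope ereal_scope.
Context {R : realType} {dO : measure_display} {O : measurableType dO}.
Variable m : {measure set O -> \bar R}.
Implicit Types F : nat -> set O.

(** The limit inferior of the events [F k]. *)
Definition ev F : set O := \bigcup_K \bigcap_k F (K + k)%N.

Lemma evI F w : (exists K, forall k, (K <= k)%N -> F k w) -> ev F w.
Proof. by move=> [K h]; exists K => // k _; apply: h; exact: leq_addr. Qed.

Lemma measurable_ev F : (forall k, measurable (F k)) -> measurable (ev F).
Proof. by move=> mF; apply: bigcupT_measurable => K; apply: bigcapT_measurable. Qed.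

Lemma ev_le_tail F c : (forall k, measurable (F k)) -> (forall K, m (\bigcap_k F (K + k)%N) <= c) ->
  m (ev F) <= c.
Proof.
move=> mF Fc; have mB K : measurable (\bigcap_k F (K + k)%N) by exact: bigcapT_measurable.
have nd : nondecreasing_seq (fun K => \bigcap_k F (K + k)%N).
  move=> K K' KK; apply/subsetPset => w h k _.
  by rewrite -(subnKC KK) -addnA; exact: h.
have h : m (\bigcap_k F (K + k)%N) @[K --> \oo] --> m (ev F).
  exact: (nondecreasing_cvg_mu mB (bigcupT_measurable _ mB) nd).
by rewrite -(cvg_lim _ h)//; apply: lime_le; [apply/cvg_ex; eexists; exact: h|exact: nearW].
Qed.

Lemma ev_le F c : (forall k, measurable (F k)) -> (forall k, m (F k) <= c) -> m (ev F) <= c.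
Proof.
move=> mF Fc; apply: ev_le_tail => // K; apply: le_trans (Fc K).
apply: le_measure; rewrite ?inE//; first exact: bigcapT_measurable.
by move=> w /(_ 0%N Logic.I); rewrite addn0.
Qed.

Lemma ev_null F (c : nat -> \bar R) : (forall k, measurable (F k)) -> (forall k, m (F k) <= c k) ->
  c @ \oo --> 0 -> m (ev F) = 0.
Proof.
move=> mF Fc c0; apply/eqP; rewrite -measure_le0; apply: ev_le_tail => // K.
rewrite -(cvg_lim _ c0)//; apply: lime_ge; first by apply/cvg_ex; eexists; exact: c0.
exists K => // k /= Kk; apply: le_trans (Fc k).
apply: le_measure; rewrite ?inE//; first exact: bigcapT_measurable.
by move=> w /(_ (k - K)%N Logic.I); rewrite subnKC.
Qed.

End eventually.

Section exit.
Context {R : realType} {d : nat} {dO : measure_display} {O : measurableType dO}.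
Local Notation V := (d.-tuple R).
Context {P : V -> probability O R} {X : R -> O -> V}.
Context {nu : {measure set V -> \bar R}} {p : R -> V -> R}.
Hypothesis HX : sym_levy_process P X nu p.
Variable D : set V.
Hypothesis oD : open_Rd D.
Local Notation P0 := (P vzero).
Local Notation incr := (incr X).
Local Notation lifetime := (lifetime X D).
Local Notation alive := (alive X D).

Definition first_out n (del : R) (j : nat) : set O := (\bigcap_i if (i < j)%N then X (i%:R * del) @^-1` inner D n else setT)
   `&` ~` (X (j%:R * del) @^-1` inner D n).

(* The path is displaced by more than [e] during the [h] units of time that follow its first
   observed exit from [inner D n] along the grid of mesh [del]. *)
Definition exit_jump e h n del : set O := \bigcup_j (first_out n del j `&`
  [set w | (~` box vzero e) (vsub (X (j%:R * del + h) w) (X (j%:R * del) w))]).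

Lemma past_first_out n del j : 0 <= del -> past X (j%:R * del) (first_out n del j).
Proof.
move=> d0; apply: past_setI.
  apply: past_bigcap => i; case: ifP => ij; last exact: past_setT.
  apply: past_levy; last exact: measurable_inner.
  by rewrite mulr_ge0// ler_wpM2r// ler_nat ltnW.
apply: past_setC; apply: past_levy; last exact: measurable_inner.
by rewrite mulr_ge0//= lexx.
Qed.

Lemma measurable_jump_set e h n del j : 0 <= h -> 0 <= del ->
  measurable (first_out n del j `&`
  [set w | (~` box vzero e) (vsub (X (j%:R * del + h) w) (X (j%:R * del) w))]).
Proof.
move=> h0 d0; apply: measurableI.
  by apply: (past_measurable HX); exact: past_first_out.
have mv : measurable_fun setT (fun w => vsub (X (j%:R * del + h) w) (X (j%:R * del) w)).
  by apply: measurable_vsub; apply: (levy_measurable HX); rewrite ?addr_ge0// mulr_ge0.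
by have := mv measurableT _ (measurableC (measurable_box vzero e)); rewrite setTI.
Qed.

Lemma measurable_exit_jump e h n del : 0 <= h -> 0 <= del -> measurable (exit_jump e h n del).
Proof. by move=> h0 d0; apply: bigcupT_measurable => j; exact: measurable_jump_set. Qed.

(** Strong Markov property at the first grid exit, a time with countably many values: each
    [first_out n del j] lies in the past of its time, hence is independent of the displacement that
    follows, and these disjoint events have total probability at most 1. *)
Lemma exit_jump_le x e h n del : 0 <= h -> 0 <= del ->
  (P x (exit_jump e h n del) <= P0 (incr h @^-1` (~` box vzero e)))%E.
Proof.
move=> h0 d0; set c := P0 _.
have mF j : measurable (first_out n del j).
  by apply: (past_measurable HX); exact: past_first_out.
have tF : trivIset setT (first_out n del).
  apply: ltn_trivIset => j i ij.
  apply/seteqP; split=> w // [[_ h1] [h2 _]]; apply: h1.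
  by have := h2 i Logic.I; rewrite ij.
rewrite /exit_jump measure_bigcup//; last 2 first.
- by move=> j _; exact: measurable_jump_set.
- exact: trivIset_setIr.
have E j : P x (first_out n del j `&`
  [set w | (~` box vzero e) (vsub (X (j%:R * del + h) w) (X (j%:R * del) w))]) =
  (c * P x (first_out n del j))%E.
  have jd : 0 <= j%:R * del by rewrite mulr_ge0.
  by rewrite (markov_set HX x jd h0 (@past_first_out n del j d0) (measurableC (measurable_box vzero e))) muleC.
have cE : c = (fine c)%:E.
  rewrite fineK//; apply: fin_num_measure.
  by have := measurable_incr HX h0 measurableT (measurableC (measurable_box vzero e)); rewrite setTI.
rewrite (eq_eseriesr (fun j _ => E j)) cE nneseriesZl//.
rewrite -[leRHS]mule1; apply: lee_wpmul2l; first by rewrite lee_fin; apply: fine_ge0; exact: measure_ge0.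
rewrite (_ : (\sum_(_ <oo | _) _)%E = P x (\bigcup_j first_out n del j)).
  by rewrite probability_le1//; exact: bigcupT_measurable.
by rewrite measure_bigcup.
Qed.

(** Right continuity of the paths at time 0 and dominated convergence. *)
Lemma incr_small e : 0 < e ->
  P0 (incr l.+1%:R^-1 @^-1` (~` box vzero e)) @[l --> \oo] --> 0%E.
Proof.
move=> e0.
have mb : measurable (~` box (vzero : V) e) by apply: measurableC; exact: measurable_box.
have mi l : measurable (incr l.+1%:R^-1 @^-1` (~` box vzero e)).
  by have := @measurable_incr _ _ _ _ _ _ _ _ HX l.+1%:R^-1 ltac:(by rewrite invr_ge0) measurableT _ mb; rewrite setTI.
have E A : measurable A -> P0 A = (\int[P0]_w \1_A w)%:E.
  move=> mA; rewrite /Rintegral integral_indic// setIT fineK//; exact: fin_num_measure.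
under eq_fun do rewrite E//.
apply: cvg_EFin; first exact: nearW.
have -> : 0 = \int[P0]_w (fun=> 0) w :> R by rewrite /Rintegral integral0.
apply: (@bounded_cvg _ _ _ _ _ _ 1) => [l|l w|w].
- exact: measurable_indic.
- by rewrite indicE; case: (_ \in _); rewrite ?normr1 ?normr0.
have [del del0 dP] := levy_right_cont HX w (lexx 0) e0.
have [k kP] := ex_inv_lt del0.
apply: cvg_near_cst; exists k => // l /= kl; rewrite indicE memNset//=; apply.
move=> i; rewrite tnth_vzero subr0 tnth_vsub.
by apply: (dP l.+1%:R^-1); rewrite invr_ge0 ler0n add0r kP.
Qed.

(** A quarter of the margin of [inner D q]; three errors of at most this size are added up in
    [not_bad_exit]. *)
Let eps q : R := (4 * q.+1%:R)^-1.

(** The limits go from the inside out: the mesh tends to 0, then the inner sets grow to [D], and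
    last the window [l.+1%:R^-1] shrinks to 0. The bound of [exit_jump_le] is uniform in the first
    two, and the third sends it to 0. *)
Definition bad_set : set O :=
  \bigcup_q ev (fun l => ev (fun n => ev (fun k => exit_jump (eps q) l.+1%:R^-1 n (2 ^+ k)^-1))).

Let mjump q l n k : measurable (exit_jump (eps q) l.+1%:R^-1 n (2 ^+ k)^-1).
Proof. by apply: measurable_exit_jump; rewrite invr_ge0// exprn_ge0. Qed.

Lemma measurable_bad_set : measurable bad_set.
Proof.
apply: bigcupT_measurable => q; apply: measurable_ev => l; apply: measurable_ev => n.
by apply: measurable_ev => k; exact: mjump.
Qed.

Lemma bad_set_null x : P x bad_set = 0%E.
Proof.
apply: measure_negligible; first exact: measurable_bad_set.
apply: negligible_bigcup => q.
have q0 : 0 < eps q by rewrite invr_gt0 mulr_gt0.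
apply/negligibleP; first by do 3 (apply: measurable_ev => ?); exact: mjump.
apply: (ev_null _ _ (incr_small q0)) => l.
  by do 2 (apply: measurable_ev => ?); exact: mjump.
apply: ev_le => [n|n]; first by apply: measurable_ev => k; exact: mjump.
apply: ev_le => [k|k]; first exact: mjump.
by apply: exit_jump_le; rewrite invr_ge0// exprn_ge0.
Qed.

(* If [X] is still in [D] when [lifetime] ends, the path came arbitrarily close to the complement
   of [D] just before and then jumped back inside. *)
Lemma not_bad_exit w t : D (X 0 w) -> lifetime w = t%:E -> D (X t w) -> bad_set w.
Proof.
move=> D0 Lt Dt.
have t0 : 0 <= t by rewrite -lee_fin -Lt; exact: lifetime_ge0.
have nalive : ~ alive t w by move=> /(lifetime_gt HX _ _ t0); rewrite Lt ltxx.
have alive_lt s : 0 <= s < t -> alive s w.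
  by move=> /andP[s0 st]; apply/(lifetime_gt HX _ _ s0); rewrite Lt lte_fin.
have tp : 0 < t.
  rewrite lt_neqAle t0 andbT eq_sym; apply/eqP => tz; apply: nalive.
  have [n n0] := inner_cover oD D0; exists n => s; rewrite tz => s0.
  by have <- : 0 = s by apply/eqP; rewrite eq_le.
have [q qt] := inner_cover oD Dt.
exists q => //.
have q0 : 0 < eps q by rewrite invr_gt0 mulr_gt0.
have [eta eta0 etaP] := levy_right_cont HX w t0 q0.
have [l0 l0P] := ex_inv_lt eta0.
apply: evI; exists l0 => l /l0P; set h := l.+1%:R^-1 => heta.
have h0 : 0 < h by rewrite invr_gt0.
(* Up to [u] the path is alive, so for [n] large it stays in [inner D n]; the first grid exit is
   thereby confined to the window of length [h] before [t]. *)
pose u := Num.max (t - h) 0.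
have ut : u < t by rewrite gt_max; apply/andP; split; lra.
have u0 : 0 <= u by rewrite le_max lexx orbT.
have [n0 n0P] : alive u w by apply: alive_lt; rewrite u0.
have [n1 n1P] := ex_inv_lt q0.
apply: evI; exists (maxn q (maxn n0 n1)) => n; rewrite !geq_max => /andP[qn /andP[n0n n1n]].
(* As the path is not alive at [t], it is outside [inner D n] at some time up to [t], and not at [t]
   itself, where it is in [inner D q]. *)
have [s /andP[s0 st] nin] : exists2 s, 0 <= s <= t & ~ inner D n (X s w).
  apply: contrapT => H; apply: nalive; exists n => s sI; apply: contrapT => ns.
  by apply: H; exists s.
have {}st : s < t.
  rewrite lt_neqAle st andbT; apply/eqP => sE; apply: nin; rewrite sE.
  exact: inner_mono qn _ qt.
have [e [e0 eP]] := innerC_open nin.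
have [del del0 dP] := levy_right_cont HX w s0 e0.
have dt0 : 0 < Num.min del (t - s) by rewrite lt_min del0 subr_gt0.
have [k0 k0P] := ex_half_lt dt0.
apply: evI; exists k0 => k /k0P; set g := (2 ^+ k)^-1 => gdt.
have g0 : 0 < g by rewrite invr_gt0 exprn_gt0.
have [j jP] : exists j : nat, ~ inner D n (X (j%:R * g) w) /\ j%:R * g < t.
  exists (Num.truncn (s / g)).+1.
  have h1 : s < (Num.truncn (s / g)).+1%:R * g by rewrite -ltr_pdivrMr// truncnS_gt.
  have h2 : (Num.truncn (s / g)).+1%:R * g <= s + g.
    rewrite -natr1 mulrDl mul1r lerD2r -ler_pdivlMr// truncn_le divr_ge0// ltW.
    by [].
    by [].
  move: gdt; rewrite lt_min => /andP[gd gt]; split; last by lra.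
  by apply: eP; apply: dP; apply/andP; split; lra.
have exj : exists j, `[< ~ inner D n (X (j%:R * g) w) >] by exists j; apply/asboolP; case: jP.
pose J := ex_minn exj.
have [/asboolP JN Jmin] : `[< ~ inner D n (X (J%:R * g) w) >] /\ forall i, `[< ~ inner D n (X (i%:R * g) w) >] -> (J <= i)%N.
  by rewrite /J; case: ex_minnP.
have Jt : J%:R * g < t.
  apply: le_lt_trans jP.2; rewrite ler_wpM2r ?(ltW g0)// ler_nat; apply: Jmin.
  by apply/asboolP; exact: jP.1.
have Ju : u < J%:R * g.
  rewrite ltNge; apply/negP => Ju; apply: JN; apply: inner_mono n0n _ _; apply: n0P.
  by rewrite mulr_ge0// ltW.
have Jh : t - h < J%:R * g by apply: le_lt_trans Ju; rewrite le_max lexx.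
exists J => //; split.
  split; last exact: JN.
  move=> i _; case: ifPn => // iJ /=; apply: contrapT => ni.
  by have := Jmin i; rewrite leqNgt iJ => H; have := H ltac:(by apply/asboolP).
(* At the first grid exit the path is within [n.+1%:R^-1] of a point [z] outside [D], and [h] later
   it is past [t] and close to [X t w]. Without a displacement larger than [eps q] in between, [z]
   would lie within the margin of [X t w]. *)
move=> /= small.
have [z zP] : exists z, box (X (J%:R * g) w) n.+1%:R^-1 z /\ ~ D z.
  by apply: contrapT => H; apply: JN => z zb; apply: contrapT => nz; apply: H; exists z.
apply: zP.2; apply: qt.
have b1 : box (X t w) (eps q) (X (J%:R * g + h) w).
  by apply: etaP; apply/andP; split; lra.
have b2 : box (X (J%:R * g + h) w) (eps q) (X (J%:R * g) w).
  by apply: box_sym => i; have := small i; rewrite tnth_vzero subr0 tnth_vsub.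
apply: box_le (box_trans (box_trans b1 b2) zP.1).
have := n1P n n1n; rewrite /eps invfM; have : 0 < q.+1%:R^-1 :> R by rewrite invr_gt0.
by move: (q.+1%:R^-1 : R) (n.+1%:R^-1 : R) => a b a0 ba; lra.
Qed.

Lemma exit_lifetime w : D (X 0 w) -> ~ bad_set w -> exit_time X D w = lifetime w.
Proof.
move=> D0 nb; apply/eqP; rewrite eq_le lifetime_le_exit// andbT.
case E : (lifetime w) => [t| |]; last 2 first.
- by rewrite leey.
- by have := @lifetime_ge0 _ _ _ _ X D w; rewrite E.
have nD : ~ D (X t w) by move=> Dt; apply: nb; exact: not_bad_exit Dt.
have t0 : 0 <= t by rewrite -lee_fin -E; exact: lifetime_ge0.
apply: ereal_inf_lbound; exists t => //; split => //.
(* [exit_time] counts only positive times, so a lifetime equal to 0 is ruled out by the start in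
   [D]. *)
rewrite lt_neqAle t0 andbT eq_sym; apply/eqP => tz; apply: nD.
by rewrite tz.
Qed.

End exit.

(** * The killed semigroup *)

Local Open Scope ereal_scope.

Section chains.
Context {R : realType} {d : nat} {dO : measure_display} {O : measurableType dO}.
Local Notation V := (d.-tuple R).
Context {P : V -> probability O R} {X : R -> O -> V}.
Context {nu : {measure set V -> \bar R}} {p : R -> V -> R}.
Hypothesis HX : sym_levy_process P X nu p.
Local Notation P0 := (P vzero).
Local Notation incr := (incr X).
Implicit Types (K A : set V).

(** Increments under [P vzero] replace the process under [P x]: nothing is assumed on how [P]
    depends on the starting point, and in this form measurability in [x] follows from Tonelli. *)
Definition transop (P : V -> probability O R) (X : R -> O -> V) r (f : V -> \bar R) (x : V) : \bar R :=
  \int[P vzero]_w f (vadd x (vsub (X r w) (X 0%R w))).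

Definition stepop (P : V -> probability O R) (X : R -> O -> V) K r (f : V -> \bar R) (x : V) : \bar R :=
  (\1_K x)%:E * transop P X r f x.

Local Notation trans := (transop P X).
Local Notation step := (stepop P X).

Definition nnmeas {dT} {T : measurableType dT} (f : T -> \bar R) := measurable_fun setT f /\ forall x, 0 <= f x.

Lemma nnmeas_indic {dT} {T : measurableType dT} (B : set T) : measurable B ->
  nnmeas (fun x => (\1_B x)%:E).
Proof. by move=> mB; split=> [|x]; [exact/measurable_EFinP|rewrite lee_fin]. Qed.

Lemma nnmeasM {dT} {T : measurableType dT} (f g : T -> \bar R) : nnmeas f -> nnmeas g ->
  nnmeas (fun x => f x * g x).
Proof. by move=> [mf f0] [mg g0]; split=> [|x]; [exact: emeasurable_funM|exact: mule_ge0]. Qed.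

Lemma nnmeas_comp {dT} {T : measurableType dT} (f : V -> \bar R) (u : T -> V) :
  nnmeas f -> measurable_fun setT u -> nnmeas (fun x => f (u x)).
Proof. by move=> [mf f0] mu; split=> [|x]; [exact: measurableT_comp|exact: f0]. Qed.

Lemma nnmeas_trans r (f : V -> \bar R) : (0 <= r)%R -> nnmeas f -> nnmeas (trans r f).
Proof.
move=> r0 [mf f0]; split=> [|x]; last exact: integral_ge0.
apply: (@measurable_fun_fubini_tonelli_F _ _ _ _ R P0 (fun z : V * O => f (vadd z.1 (incr r z.2)))) => //.
apply: measurableT_comp => //; apply: measurable_vadd => //.
by apply: measurableT_comp => //; exact: (measurable_incr HX).
Qed.

Lemma nnmeas_step K r (f : V -> \bar R) : measurable K -> (0 <= r)%R -> nnmeas f -> nnmeas (step K r f).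
Proof. by move=> mK r0 mf; apply: nnmeasM; [exact: nnmeas_indic|exact: nnmeas_trans]. Qed.

Lemma nnmeas_iter K r (f : V -> \bar R) N : measurable K -> (0 <= r)%R -> nnmeas f -> nnmeas (iter N (step K r) f).
Proof. by move=> mK r0 mf; elim: N => [//|N IH]; exact: nnmeas_step. Qed.

Lemma indic_mule_setI {T : Type} (A B : set T) (w : T) :
  (\1_(A `&` B) w)%:E = (\1_A w)%:E * (\1_B w)%:E :> \bar R.
Proof. by rewrite !indicE in_setI -EFinM; case: (_ \in _) => /=; rewrite ?mul1r ?mul0r. Qed.

Lemma markov_indic (x : V) s r (S : set O) (f : V -> \bar R) : (0 <= s)%R -> (0 <= r)%R -> past X s S -> nnmeas f ->
  \int[P x]_w ((\1_S w)%:E * f (X (s + r)%R w)) = \int[P x]_w ((\1_S w)%:E * trans r f (X s w)).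
Proof.
move=> s0 r0 pS [mf f0].
(* The event [S] travels as a boolean coordinate, so that [levy_markov] applies to the pair. *)
pose U w : bool * V := (w \in S, X s w).
pose g (z : (bool * V) * V) : \bar R := ((z.1.1)%:R)%:E * f (vadd z.1.2 z.2).
have mb : measurable_fun setT (fun b : bool => ((b)%:R : R)).
  by move=> _ Y _.
have mg : measurable_fun setT g.
  apply: emeasurable_funM.
    by apply/measurable_EFinP; apply: (measurableT_comp mb); exact: measurableT_comp.
  apply: measurableT_comp => //; apply: measurable_vadd => //; exact: measurableT_comp.
have g0 z : 0 <= g z by rewrite mule_ge0// lee_fin.
have pU (C : set (bool * V)) : measurable C -> past X s (U @^-1` C).
  move=> mC; rewrite (_ : U @^-1` C = (S `&` X s @^-1` (xsection C true)) `|` (~` S `&` X s @^-1` (xsection C false))).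
    rewrite -[_ `|` _]setCK setCU; apply: past_setC; apply: past_setI; apply: past_setC; apply: past_setI => //.
    - by apply: past_levy; [rewrite s0 lexx|exact: measurable_xsection].
    - exact: past_setC.
    - by apply: past_levy; [rewrite s0 lexx|exact: measurable_xsection].
  apply/seteqP; split=> w /=; rewrite /xsection/= /U.
    have [wS|wS] := pselect (S w); first by rewrite mem_set// => h; left; split => //; apply: mem_set.
    by rewrite memNset// => h; right; split => //; apply: mem_set.
  by move=> [[wS /set_mem]|[wS /set_mem]]; [rewrite mem_set|rewrite memNset].
have := levy_markov HX x s0 r0 pU mg g0.
have -> : (fun w => g (U w, vsub (X (s + r)%R w) (X s w))) = (fun w => (\1_S w)%:E * f (X (s + r)%R w)).
  by apply/funext => w; rewrite /g /U/= vadd_vsub indicE.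
move=> ->; apply: eq_integral => w _.
rewrite /g /U/= -indicE /transop ge0_integralZl//.
- apply: measurableT_comp => //; apply: measurable_vadd => //; exact: (measurable_incr HX).
Qed.

Definition grid (X : R -> O -> V) K a del N : set O := [set w | forall j, (j <= N)%N -> K (X (a + j%:R * del)%R w)].

Lemma gridS K a del N : grid X K a del N.+1 = grid X K a del N `&` X (a + N.+1%:R * del)%R @^-1` K.
Proof.
apply/seteqP; split=> w; first by move=> h; split=> [j jN|]; apply: h => //; exact: leqW.
by move=> [h1 h2] j; rewrite leq_eqVlt => /predU1P[->//|]; rewrite ltnS; exact: h1.
Qed.

Lemma past_grid K a del N : measurable K -> (0 <= a)%R -> (0 <= del)%R ->
  past X (a + N%:R * del)%R (grid X K a del N).
Proof.
move=> mK a0 d0; elim: N => [|N IH].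
  rewrite (_ : grid _ _ _ _ _ = X (a + 0%:R * del)%R @^-1` K); last first.
    by apply/seteqP; split=> w; [apply|move=> h j; rewrite leqn0 => /eqP ->].
  by apply: past_levy => //; rewrite mul0r addr0 a0 lexx.
rewrite gridS; apply: past_setI.
  by apply: past_le IH; rewrite lerD2l ler_wpM2r// ler_nat.
by apply: past_levy => //; rewrite addr_ge0 ?mulr_ge0//= lexx.
Qed.

(** The last step is peeled off with [markov_indic] and absorbed into [f], which is why the
    induction is over all [f]. *)
Lemma chain (x : V) a del K N (S : set O) (f : V -> \bar R) : measurable K -> (0 <= a)%R -> (0 <= del)%R ->
  past X a S -> nnmeas f ->
  \int[P x]_w ((\1_(S `&` grid X K a del N) w)%:E * f (X (a + N%:R * del)%R w)) =
  \int[P x]_w ((\1_S w)%:E * iter N (step K del) (fun y => (\1_K y)%:E * f y) (X a w)).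
Proof.
move=> mK a0 d0 pS; elim: N f => [|N IH] f nf.
  apply: eq_integral => w _; rewrite /= mul0r addr0 indic_mule_setI -muleA; congr (_ * (_ * _)).
  rewrite !indicE; congr ((nat_of_bool _)%:R%:E); apply/idP/idP => /set_mem h; apply: mem_set.
    by have := h 0%N (leqnn _); rewrite mul0r addr0.
  by move=> j; rewrite leqn0 => /eqP ->; rewrite mul0r addr0.
have nKf : nnmeas (fun y => (\1_K y)%:E * f y) by apply: nnmeasM => //; exact: nnmeas_indic.
transitivity (\int[P x]_w ((\1_(S `&` grid X K a del N) w)%:E * trans del (fun y => (\1_K y)%:E * f y) (X (a + N%:R * del)%R w))).
  rewrite -markov_indic//; last 2 first.
  - by rewrite addr_ge0// mulr_ge0.
  - apply: past_setI; last exact: past_grid.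
    by apply: past_le pS; rewrite lerDl mulr_ge0.
  apply: eq_integral => w _.
  have -> : (a + N%:R * del + del = a + N.+1%:R * del)%R by rewrite -natr1; ring.
  by rewrite gridS setIA indic_mule_setI -muleA.
by rewrite IH ?iterSr//; exact: nnmeas_trans.
Qed.

End chains.

Section killed_definitions.
Context {R : realType} {d : nat} {dO : measure_display} {O : measurableType dO}.
Local Notation V := (d.-tuple R).
Variables (P : V -> probability O R) (X : R -> O -> V) (D : set V).

(* The probability, from [x], to be in [inner D n] at the times [j t / 2 ^ k], [j <= 2 ^ k],
   and in [A] at time [t]. *)
Definition grid_kernel n k t (A : set V) (x : V) : \bar R :=
  iter (2 ^ k) (stepop P X (inner D n) (t / 2 ^+ k)%R) (fun y => (\1_(inner D n) y)%:E * (\1_A y)%:E) x.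

Definition stay_kernel n t (A : set V) (x : V) : \bar R := P x (stay X D n 0%R t `&` X t @^-1` A).

(** The quantity [Q_t(x, A)] of the overview. *)
Definition killed t (A : set V) (x : V) : \bar R := P x (alive X D t `&` X t @^-1` A).

End killed_definitions.

Section killed_semigroup.
Context {R : realType} {d : nat} {dO : measure_display} {O : measurableType dO}.
Local Notation V := (d.-tuple R).
Context {P : V -> probability O R} {X : R -> O -> V}.
Context {nu : {measure set V -> \bar R}} {p : R -> V -> R}.
Hypothesis HX : sym_levy_process P X nu p.
Variable D : set V.
Local Notation P0 := (P vzero).
Local Notation incr := (incr X).
Local Notation step := (stepop P X).
Local Notation trans := (transop P X).
Local Notation stay := (stay X D).
Local Notation alive := (alive X D).
Local Notation grid_kernel := (grid_kernel P X D).
Local Notation stay_kernel := (stay_kernel P X D).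
Local Notation killed := (killed P X D).

Lemma integral_start x (f : V -> \bar R) : nnmeas f -> \int[P x]_w f (X 0%R w) = f x.
Proof.
move=> nf; have [mfX _] := nnmeas_comp nf (levy_measurable HX (lexx 0%R)).
rewrite (ae_eq_integral (fun=> f x))//; last first.
  by apply: filterS (ae_start HX x) => w /= ->.
by rewrite integral_cst// [X in _ * X](_ : _ = 1) ?mule1//; exact: probability_setT.
Qed.

Lemma dyadic_step_ge0 t k : (0 <= t)%R -> (0 <= t / 2 ^+ k :> R)%R.
Proof. by move=> t0; rewrite divr_ge0// exprn_ge0. Qed.

Lemma nnmeas_grid_kernel n k t A : (0 <= t)%R -> measurable A -> nnmeas (grid_kernel n k t A).
Proof.
move=> t0 mA; apply: (nnmeas_iter HX); [exact: measurable_inner|exact: dyadic_step_ge0|].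
by apply: nnmeasM; apply: nnmeas_indic => //; exact: measurable_inner.
Qed.

Lemma measurable_levy_preimage t A : (0 <= t)%R -> measurable A -> measurable (X t @^-1` A).
Proof. by move=> t0 mA; have := levy_measurable HX t0 measurableT mA; rewrite setTI. Qed.

Lemma chain_grid x a t n k S A : (0 <= a)%R -> (0 <= t)%R -> past X a S -> measurable A ->
  P x (S `&` grid X (inner D n) a (t / 2 ^+ k) (2 ^ k) `&` X (a + t)%R @^-1` A) =
  \int[P x]_w ((\1_S w)%:E * grid_kernel n k t A (X a w)).
Proof.
move=> a0 t0 pS mA; have d0 := dyadic_step_ge0 k t0.
rewrite -(chain HX x (2 ^ k) (measurable_inner D n) a0 d0 pS (nnmeas_indic mA)).
have -> : (a + (2 ^ k)%:R * (t / 2 ^+ k) = a + t)%R.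
  by rewrite natrX mulrC divfK// expf_neq0.
rewrite -[in LHS](setIT (_ `&` _)) -integral_indic//.
  by apply: eq_integral => w _; rewrite indic_mule_setI.
apply: measurableI; last by apply: measurable_levy_preimage => //; exact: addr_ge0.
apply: (past_measurable HX (t := (a + (2 ^ k)%:R * (t / 2 ^+ k))%R)); apply: past_setI.
  by apply: past_le pS; rewrite lerDl mulr_ge0.
by apply: past_grid => //; exact: measurable_inner.
Qed.

Lemma measurable_grid n a t k : (0 <= a)%R -> (0 <= t)%R ->
  measurable (grid X (inner D n) a (t / 2 ^+ k) (2 ^ k)).
Proof.
move=> a0 t0; apply: (past_measurable HX); apply: past_grid => //; first exact: measurable_inner.
exact: dyadic_step_ge0.
Qed.

Lemma stay_gridE n a t : (0 <= a)%R -> (0 <= t)%R ->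
  stay n a (a + t)%R = \bigcap_k grid X (inner D n) a (t / 2 ^+ k) (2 ^ k).
Proof.
move=> a0 t0; have at_ : (a <= a + t)%R by rewrite lerDl.
apply/seteqP; split=> w.
  by move=> /(stay_grid HX _ _ _ a0 at_) h k _ j jk; have := h k j jk; rewrite addrAC subrr add0r.
by move=> h; apply/(stay_grid HX _ _ _ a0 at_) => k j jk; rewrite addrAC subrr add0r; exact: h.
Qed.

Lemma grid_nested n a t : nonincreasing_seq (fun k => grid X (inner D n) a (t / 2 ^+ k) (2 ^ k)).
Proof.
apply/nonincreasing_seqP => k; apply/subsetPset => w h j jk.
have := h (j * 2)%N; rewrite expnSr leq_pmul2r// => /(_ jk).
by rewrite natrM exprSr invfM [(2 ^- k / 2)%R]mulrC !mulrA -[(_ * 2 * t)%R]mulrA [(2 * t)%R]mulrC mulrA mulfK.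
Qed.

Lemma cvg_stay x S n a t A : (0 <= a)%R -> (0 <= t)%R -> measurable S -> measurable A ->
  P x (S `&` grid X (inner D n) a (t / 2 ^+ k) (2 ^ k) `&` X (a + t)%R @^-1` A) @[k --> \oo] -->
  P x (S `&` stay n a (a + t)%R `&` X (a + t)%R @^-1` A).
Proof.
move=> a0 t0 mS mA.
have -> : S `&` stay n a (a + t)%R `&` X (a + t)%R @^-1` A =
    \bigcap_k (S `&` grid X (inner D n) a (t / 2 ^+ k) (2 ^ k) `&` X (a + t)%R @^-1` A).
  rewrite stay_gridE//; apply/seteqP; split=> w.
    by move=> [[h1 h2] h3] k _; split => //; split => //; exact: h2.
  move=> h; have [[h1 _] h3] := h 0%N Logic.I; split => //; split => // k _.
  by have [[]] := h k Logic.I.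
have mF k : measurable (S `&` grid X (inner D n) a (t / 2 ^+ k) (2 ^ k) `&` X (a + t)%R @^-1` A).
  apply: measurableI; last by apply: measurable_levy_preimage => //; exact: addr_ge0.
  by apply: measurableI => //; exact: measurable_grid.
apply: nonincreasing_cvg_mu => //.
- by rewrite (le_lt_trans (probability_le1 _ _))// ltry.
- exact: bigcapT_measurable.
- move=> k l kl; apply/subsetPset; apply: setSI; apply: setIS.
  exact/subsetPset/grid_nested.
Qed.

Lemma grid_kernelE x n k t A : (0 <= t)%R -> measurable A ->
  grid_kernel n k t A x = P x (grid X (inner D n) 0%R (t / 2 ^+ k) (2 ^ k) `&` X t @^-1` A).
Proof.
move=> t0 mA; have := chain_grid x n k (lexx 0%R) t0 (@past_setT R d dO O X 0%R) mA.
rewrite setTI add0r => ->; rewrite -(integral_start x (nnmeas_grid_kernel n k t0 mA)).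
by apply: eq_integral => w _; rewrite indicT mul1e.
Qed.

Lemma cvg_grid_kernel x n t A : (0 <= t)%R -> measurable A ->
  grid_kernel n k t A x @[k --> \oo] --> stay_kernel n t A x.
Proof.
move=> t0 mA; under eq_fun do rewrite grid_kernelE//.
have := @cvg_stay x setT n 0%R t A (lexx 0%R) t0 measurableT mA.
by under eq_fun do rewrite setTI add0r; rewrite setTI add0r.
Qed.

Lemma grid_kernel_le n k t A x : (0 <= t)%R -> measurable A -> grid_kernel n k t A x <= 1.
Proof.
move=> t0 mA; rewrite grid_kernelE// probability_le1//.
by apply: measurableI; [exact: measurable_grid|exact: measurable_levy_preimage].
Qed.

(** The measurability in the starting point is inherited from the grid kernels, which are built on
    [transop], by passing to the limit. *)
Lemma nnmeas_stay_kernel n t A : (0 <= t)%R -> measurable A -> nnmeas (stay_kernel n t A).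
Proof.
move=> t0 mA; split=> [|x]; last exact: measure_ge0.
apply: (emeasurable_fun_cvg (fun k => grid_kernel n k t A)) => [k|x _].
  by have [] := nnmeas_grid_kernel n k t0 mA.
exact: cvg_grid_kernel.
Qed.

Lemma stay_kernel_le1 n t A x : (0 <= t)%R -> measurable A -> stay_kernel n t A x <= 1.
Proof.
move=> t0 mA; rewrite probability_le1//.
by apply: measurableI; [exact: (measurable_stay HX)|exact: measurable_levy_preimage].
Qed.

Lemma killed_le1 t A x : (0 <= t)%R -> measurable A -> killed t A x <= 1.
Proof.
move=> t0 mA; rewrite probability_le1//.
by apply: measurableI; [exact: (measurable_alive HX)|exact: measurable_levy_preimage].
Qed.

Lemma nd_stay a b : nondecreasing_seq (fun n => stay n a b).
Proof. by move=> k l kl; apply/subsetPset; exact: stay_mono. Qed.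

Lemma markov_stay x a t n S A : (0 <= a)%R -> (0 <= t)%R -> past X a S -> measurable A ->
  P x (S `&` stay n a (a + t)%R `&` X (a + t)%R @^-1` A) =
  \int[P x]_w ((\1_S w)%:E * stay_kernel n t A (X a w)).
Proof.
move=> a0 t0 pS mA; have mS := past_measurable HX pS.
have c1 := @cvg_stay x S n a t A a0 t0 mS mA.
have nS : nnmeas (fun w => (\1_S w)%:E : \bar R) by exact: nnmeas_indic.
have mXa := levy_measurable HX a0.
have c2 : \int[P x]_w ((\1_S w)%:E * grid_kernel n k t A (X a w)) @[k --> \oo] -->
    \int[P x]_w ((\1_S w)%:E * stay_kernel n t A (X a w)).
  apply: (@dominated_cvg _ _ _ (P x) setT measurableT _ _ (fun=> 1)) => //.
  - by move=> k; have [] := nnmeasM nS (nnmeas_comp (nnmeas_grid_kernel n k t0 mA) mXa).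
  - move=> w _; apply: cvgeZl => //; exact: cvg_grid_kernel.
  - exact: (@finite_measure_integrable_cst _ _ _ (P x) setT 1%R).
  - move=> k w _; have [_ g0] := nnmeas_grid_kernel n k t0 mA.
    rewrite gee0_abs ?mule_ge0 ?lee_fin//.
    rewrite -[leRHS]mule1; apply: lee_pmul; [by rewrite lee_fin|exact: g0| |exact: grid_kernel_le].
    by rewrite lee_fin indicE lern1 leq_b1.
rewrite -(cvg_lim _ c1)// -(cvg_lim _ c2)//.
by congr (limn _); apply/funext => k; rewrite chain_grid.
Qed.

Lemma killed_bigcup t A : alive t `&` X t @^-1` A = \bigcup_n (stay n 0%R t `&` X t @^-1` A).
Proof. by rewrite alive_bigcup setI_bigcupl. Qed.

Lemma cvg_stay_kernel x t A : (0 <= t)%R -> measurable A ->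
  stay_kernel n t A x @[n --> \oo] --> killed t A x.
Proof.
move=> t0 mA; rewrite /killed killed_bigcup.
have mF n : measurable (stay n 0%R t `&` X t @^-1` A).
  by apply: measurableI; [exact: (measurable_stay HX)|exact: measurable_levy_preimage].
apply: nondecreasing_cvg_mu => //; first exact: bigcupT_measurable.
by move=> k l kl; apply/subsetPset; apply: setSI; exact/subsetPset/nd_stay.
Qed.

Lemma nnmeas_killed t A : (0 <= t)%R -> measurable A -> nnmeas (killed t A).
Proof.
move=> t0 mA; split=> [|x]; last exact: measure_ge0.
apply: (emeasurable_fun_cvg (fun n => stay_kernel n t A)) => [n|x _].
  by have [] := nnmeas_stay_kernel n t0 mA.
exact: cvg_stay_kernel.
Qed.

Lemma markov_killed x s t S A : (0 <= s)%R -> (0 <= t)%R -> past X s S -> measurable A ->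
  P x (S `&` \bigcup_n stay n s (s + t)%R `&` X (s + t)%R @^-1` A) =
  \int[P x]_w ((\1_S w)%:E * killed t A (X s w)).
Proof.
move=> s0 t0 pS mA; have mS := past_measurable HX pS.
have st0 : (0 <= s + t)%R by exact: addr_ge0.
have nS : nnmeas (fun w => (\1_S w)%:E : \bar R) by exact: nnmeas_indic.
have mXs := levy_measurable HX s0.
have mF n : measurable (S `&` stay n s (s + t)%R `&` X (s + t)%R @^-1` A).
  apply: measurableI; last exact: measurable_levy_preimage.
  by apply: measurableI => //; apply: (measurable_stay HX) => //; rewrite lerDl.
have c1 : P x (S `&` stay n s (s + t)%R `&` X (s + t)%R @^-1` A) @[n --> \oo] -->
    P x (S `&` \bigcup_n stay n s (s + t)%R `&` X (s + t)%R @^-1` A).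
  rewrite setI_bigcupr setI_bigcupl.
  apply: nondecreasing_cvg_mu => //; first exact: bigcupT_measurable.
  by move=> k l kl; apply/subsetPset; apply: setSI; apply: setIS; exact/subsetPset/nd_stay.
have c2 : \int[P x]_w ((\1_S w)%:E * stay_kernel n t A (X s w)) @[n --> \oo] -->
    \int[P x]_w ((\1_S w)%:E * killed t A (X s w)).
  apply: (@dominated_cvg _ _ _ (P x) setT measurableT _ _ (fun=> 1)) => //.
  - by move=> k; have [] := nnmeasM nS (nnmeas_comp (nnmeas_stay_kernel k t0 mA) mXs).
  - move=> w _; apply: cvgeZl => //; exact: cvg_stay_kernel.
  - exact: (@finite_measure_integrable_cst _ _ _ (P x) setT 1%R).
  - move=> k w _; rewrite gee0_abs ?mule_ge0 ?lee_fin// ?measure_ge0//.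
    rewrite -[leRHS]mule1; apply: lee_pmul; [by rewrite lee_fin|exact: measure_ge0| |exact: stay_kernel_le1].
    by rewrite lee_fin indicE lern1 leq_b1.
rewrite -(cvg_lim _ c1)// -(cvg_lim _ c2)//.
by congr (limn _); apply/funext => k; rewrite markov_stay.
Qed.

Lemma killed_add s t A x : (0 <= s)%R -> (0 <= t)%R -> measurable A ->
  killed (s + t)%R A x = \int[P x]_w ((\1_(alive s) w)%:E * killed t A (X s w)).
Proof.
move=> s0 t0 mA; rewrite -markov_killed//; last exact: (past_alive HX).
by rewrite -alive_split.
Qed.

Lemma killed_add_le s t A x (c : \bar R) : (0 <= s)%R -> (0 <= t)%R -> measurable A ->
  (forall y, killed t A y <= c) -> killed (s + t)%R A x <= killed s setT x * c.
Proof.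
move=> s0 t0 mA h.
have c0 : 0 <= c by apply: le_trans (h x); exact: measure_ge0.
have mal := measurable_alive HX D s0.
have nS : nnmeas (fun w => (\1_(alive s) w)%:E : \bar R) by exact: nnmeas_indic.
rewrite killed_add//; apply: (@le_trans _ _ (\int[P x]_w ((\1_(alive s) w)%:E * c))).
  apply: ge0_le_integral => //.
  - by move=> w _; rewrite mule_ge0 ?lee_fin// measure_ge0.
  - exact: (nnmeasM nS (nnmeas_comp (nnmeas_killed t0 mA) (levy_measurable HX s0))).1.
  - by apply: emeasurable_funM => //; exact: nS.1.
  - by move=> w _; rewrite lee_wpmul2l ?lee_fin.
rewrite ge0_integralZr//; last exact: nS.1.
by rewrite integral_indic// setIT /killed preimage_setT setIT.
Qed.

End killed_semigroup.

(** * From a comparison of increments to one of killed semigroups *)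

Section comparison.
Context {R : realType} {d : nat}.
Local Notation V := (d.-tuple R).
Context {dX : measure_display} {OX : measurableType dX}.
Context {PX : V -> probability OX R} {X : R -> OX -> V}.
Context {nuX : {measure set V -> \bar R}} {pX : R -> V -> R}.
Hypothesis HX : sym_levy_process PX X nuX pX.
Context {dY : measure_display} {OY : measurableType dY}.
Context {PY : V -> probability OY R} {Y : R -> OY -> V}.
Context {nuY : {measure set V -> \bar R}} {pY : R -> V -> R}.
Hypothesis HY : sym_levy_process PY Y nuY pY.
Variable m : R.
Hypothesis lawYX : forall r A, (0 <= r)%R -> measurable A ->
  PY vzero (incr Y r @^-1` A) <= (expR (m * r))%:E * PX vzero (incr X r @^-1` A).

Lemma trans_le r (f : V -> \bar R) x : (0 <= r)%R -> nnmeas f ->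
  transop PY Y r f x <= (expR (m * r))%:E * transop PX X r f x.
Proof.
move=> r0 nf; have mY := measurable_incr HY r0; have mX := measurable_incr HX r0.
have [mf f0] : nnmeas (fun y => f (vadd x y)).
  by apply: nnmeas_comp => //; exact: measurable_vadd.
rewrite /transop -(ge0_integral_law _ mY mf f0) -(ge0_integral_law _ mX mf f0).
pose c : {nonneg R} := NngNum (expR_ge0 (m * r)).
have := @ge0_integral_mscale _ _ R (law (PX vzero) mX) setT measurableT c (fun y => f (vadd x y)) mf (fun y _ => f0 y).
move=> /= <-; apply: ge0_le_measure_integral => // A mA.
exact: lawYX.
Qed.

Lemma iter_step_le K r (f : V -> \bar R) N x : (0 <= r)%R -> measurable K -> nnmeas f ->
  iter N (stepop PY Y K r) f x <= (expR (m * r * N%:R))%:E * iter N (stepop PX X K r) f x.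
Proof.
move=> r0 mK nf; elim: N x => [|N IH] x /=; first by rewrite mulr0 expR0 mul1e.
have nY := nnmeas_iter HY N mK r0 nf; have nX := nnmeas_iter HX N mK r0 nf.
rewrite [in leLHS]/stepop [in leRHS]/stepop muleCA; apply: lee_wpmul2l; first by rewrite lee_fin.
apply: le_trans (trans_le x r0 nY) _.
rewrite -natr1 mulrDr mulr1 addrC expRD EFinM -muleA; apply: lee_wpmul2l; first by rewrite lee_fin expR_ge0.
have mX := measurable_incr HX r0.
have mv : measurable_fun setT (fun w => vadd x (incr X r w)) by exact: measurable_vadd.
rewrite /transop -ge0_integralZl//.
- apply: ge0_le_integral => //.
  + by move=> w _; have [_] := nY; exact.
  + exact: (nnmeas_comp nY mv).1.
  + by apply: emeasurable_funM => //; exact: (nnmeas_comp nX mv).1.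
- exact: (nnmeas_comp nX mv).1.
- by move=> w _; have [_] := nX; exact.
Qed.

(** The [2 ^ k] steps together cost [expR (m * t)], independently of [k] and [n], so the bound
    survives both limits. *)
Lemma killed_le D t A x : (0 <= t)%R -> measurable A ->
  killed PY Y D t A x <= (expR (m * t))%:E * killed PX X D t A x.
Proof.
move=> t0 mA.
have efin : (expR (m * t))%:E \is a fin_num by [].
have cY : stay_kernel PY Y D n t A x @[n --> \oo] --> killed PY Y D t A x by exact: (cvg_stay_kernel HY).
have cX : stay_kernel PX X D n t A x @[n --> \oo] --> killed PX X D t A x by exact: (cvg_stay_kernel HX).
apply: (lee_cvg_to cY (cvgeZl efin cX)).
apply: nearW => n.
have gY : grid_kernel PY Y D n k t A x @[k --> \oo] --> stay_kernel PY Y D n t A x by exact: (cvg_grid_kernel HY).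
have gX : grid_kernel PX X D n k t A x @[k --> \oo] --> stay_kernel PX X D n t A x by exact: (cvg_grid_kernel HX).
apply: (lee_cvg_to gY (cvgeZl efin gX)).
apply: nearW => k.
have -> : (m * t = m * (t / 2 ^+ k) * (2 ^ k)%:R)%R.
  by rewrite natrX -mulrA divfK// expf_neq0.
apply: iter_step_le; [exact: dyadic_step_ge0|exact: measurable_inner|].
by apply: nnmeasM; apply: nnmeas_indic => //; exact: measurable_inner.
Qed.

End comparison.

(** * Symmetry of the killed semigroup and bounded densities *)

Section duality.
Context {R : realType} {d : nat} {dO : measure_display} {O : measurableType dO}.
Local Notation V := (d.-tuple R).
Context {P : V -> probability O R} {X : R -> O -> V}.
Context {nu : {measure set V -> \bar R}} {p : R -> V -> R}.
Hypothesis HX : sym_levy_process P X nu p.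
Variable D : set V.
Hypothesis bD : bounded_Rd D.
Local Notation P0 := (P vzero).
Local Notation incr := (incr X).
Local Notation step := (stepop P X).
Local Notation trans := (transop P X).
Local Notation stay_kernel := (stay_kernel P X D).
Local Notation grid_kernel := (grid_kernel P X D).
Local Notation killed := (killed P X D).

Lemma levy_exponentN (xi : V) : levy_exponent nu (vneg xi) = levy_exponent nu xi.
Proof. by congr fine; apply: eq_integral => z _; rewrite dotvNl cosN. Qed.

Lemma incr_law_sym r A : (0 <= r)%R -> measurable A ->
  P0 ((fun w => vneg (incr r w)) @^-1` A) = P0 (incr r @^-1` A).
Proof.
move=> r0; have mi := measurable_incr HX r0.
apply: (cf_unique1 (measurable_vneg mi) mi) => xi c.
under eq_Rintegral do rewrite dotvNr -dotvNl.
by rewrite (@incr_cos _ _ _ _ _ _ _ _ HX vzero r (vneg xi) c r0)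
  (@incr_cos _ _ _ _ _ _ _ _ HX vzero r xi c r0) levy_exponentN.
Qed.

(** For a fixed path, translate the Lebesgue integral by the increment; then replace the increment
    by its opposite, which has the same law. *)
Lemma trans_dual r (f g : V -> \bar R) : (0 <= r)%R -> nnmeas f -> nnmeas g ->
  \int[lebT d]_x (g x * trans r f x) = \int[lebT d]_x (f x * trans r g x).
Proof.
move=> r0 nf ng; have [mf f0] := nf; have [mg g0] := ng.
have mi := measurable_incr HX r0.
have mi2 : measurable_fun setT (fun z : V * O => incr r z.2) by exact: measurableT_comp.
have m1 : measurable_fun setT (fun z : V * O => vadd z.1 (incr r z.2)) by exact: measurable_vadd.
have m2 : measurable_fun setT (fun z : V * O => vadd z.1 (vneg (incr r z.2))).
  by apply: measurable_vadd => //; exact: measurable_vneg.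
have mF : measurable_fun setT (fun z : V * O => g z.1 * f (vadd z.1 (incr r z.2))).
  by apply: emeasurable_funM; [exact: measurableT_comp|exact: measurableT_comp].
have mG : measurable_fun setT (fun z : V * O => f z.1 * g (vadd z.1 (vneg (incr r z.2)))).
  by apply: emeasurable_funM; [exact: measurableT_comp|exact: measurableT_comp].
transitivity (\int[lebT d]_x \int[P0]_w (g x * f (vadd x (incr r w)))).
  apply: eq_integral => x _; rewrite ge0_integralZl//.
  by apply: measurableT_comp => //; exact: measurable_vadd.
rewrite (@fubini_tonelli _ _ _ _ R (lebT d) P0 _ mF); last by move=> z; rewrite mule_ge0.
transitivity (\int[P0]_w \int[lebT d]_x (f x * g (vadd x (vneg (incr r w))))).
  apply: eq_integral => w _.
  have mh : measurable_fun setT (fun x => g x * f (vadd x (incr r w))).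
    by apply: emeasurable_funM => //; apply: measurableT_comp => //; exact: measurable_vadd.
  rewrite -(integral_lebT_shift (vneg (incr r w)) mh); last by move=> z; rewrite mule_ge0.
  apply: eq_integral => x _; rewrite muleC; congr (f _ * _).
  by rewrite -vaddA [vadd (vneg _) _]vaddC vadd_vneg vsubxx vadd0.
rewrite -(@fubini_tonelli _ _ _ _ R (lebT d) P0 _ mG); last by move=> z; rewrite mule_ge0.
apply: eq_integral => x _; rewrite /= ge0_integralZl//; last first.
  by apply: measurableT_comp => //; apply: measurable_vadd => //; exact: measurable_vneg.
congr (_ * _).
apply: (eq_law_ge0_integral (g := fun y => g (vadd x y)) (measurable_vneg mi) mi) => //.
  by move=> A mA; exact: incr_law_sym.
by apply: measurableT_comp => //; exact: measurable_vadd.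
Qed.

(** [step] imposes [K] at the start of each step and the extra indicator imposes it at the final
    time, so that the chain reads the same backwards. *)
Lemma iter_step_dual K r N (f g : V -> \bar R) : measurable K -> (0 <= r)%R -> nnmeas f -> nnmeas g ->
  \int[lebT d]_x (g x * iter N (step K r) (fun y => (\1_K y)%:E * f y) x) =
  \int[lebT d]_x (f x * iter N (step K r) (fun y => (\1_K y)%:E * g y) x).
Proof.
move=> mK r0; elim: N f g => [|N IH] f g nf ng.
  by apply: eq_integral => x _ /=; rewrite muleCA [RHS]muleCA [f x * g x]muleC.
have nK : nnmeas (fun y => (\1_K y)%:E : \bar R) by exact: nnmeas_indic.
have nKf := nnmeasM nK nf; have nKg := nnmeasM nK ng.
rewrite iterSr IH//; last exact: (nnmeas_trans HX).
have ni := nnmeas_iter HX N mK r0 nKg.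
under eq_integral do rewrite muleC.
rewrite trans_dual//.
by apply: eq_integral => x _; rewrite /= /step [(\1_K x)%:E * f x]muleC -muleA.
Qed.

Lemma bounded_sub_box : exists2 L : R, (0 < L)%R & D `<=` box vzero L.
Proof.
have [M MP] := bD; exists (`|M| + 1)%R; first by rewrite ltr_wpDl.
move=> x /MP h i; rewrite tnth_vzero subr0.
by apply: le_lt_trans (h i) _; rewrite ltr_pwDr// ler_norm.
Qed.

(** Provides the domination for the limits under the Lebesgue integral, as [D] sits in a box of
    finite volume. *)
Lemma grid_kernel_le_D n k t A x : (0 <= t)%R -> measurable A ->
  grid_kernel n k t A x <= (\1_(inner D n) x)%:E.
Proof.
move=> t0 mA; have [xD|xD] := pselect (inner D n x).
  by rewrite indicE mem_set//; exact: (grid_kernel_le HX).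
have -> : (\1_(inner D n) x)%:E = 0 :> \bar R by rewrite indicE memNset.
rewrite (grid_kernelE HX)//.
have null : P x (~` [set w | X 0%R w = x]) = 0.
  by rewrite probability_setC ?(levy_start HX) ?subee//; exact: (measurable_start HX).
rewrite -null; apply: le_measure; rewrite ?inE.
- apply: measurableI; first exact: (measurable_grid HX).
  exact: (measurable_levy_preimage HX).
- by apply: measurableC; exact: (measurable_start HX).
- by move=> w [h _] /= E; apply: xD; have := h 0%N isT; rewrite mul0r addr0 E.
Qed.

(** The symmetry of [Q_t], tested on [\1_A] and the constant 1, passes from the grid kernels to the
    limit. *)
Lemma killed_dual t A : (0 <= t)%R -> measurable A ->
  \int[lebT d]_x killed t A x = \int[lebT d]_x ((\1_A x)%:E * killed t setT x).
Proof.
move=> t0 mA.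
have [L L0 DL] := bounded_sub_box.
have nA : nnmeas (fun x => (\1_A x)%:E : \bar R) by exact: nnmeas_indic.
have ib : (lebT d).-integrable setT (fun x => (\1_(box vzero L) x)%:E).
  apply/integrableP; split; first by apply/measurable_EFinP; apply: measurable_indic; exact: measurable_box.
  under eq_integral do rewrite gee0_abs ?lee_fin//.
  rewrite integral_indic//; last exact: measurable_box.
  rewrite setIT [X in X < _](_ : _ = ((L *+ 2) ^+ d)%:E) ?ltry//.
  exact: (lebT_box _ (ltW L0)).
have gk n k B x : measurable B -> grid_kernel n k t B x <= (\1_(box vzero L) x)%:E.
  move=> mB; apply: le_trans (grid_kernel_le_D n k x t0 mB) _.
  rewrite lee_fin !indicE ler_nat; case: (boolP (x \in inner D n)) => // /set_mem xn.
  by rewrite mem_set//; apply: DL; exact: inner_sub xn.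
have A1 x : (0 <= (\1_A x : R) <= 1)%R by rewrite indicE lern1 leq_b1 ler0n.
(* One passage to the limit that serves twice: for the mesh, then for the inner sets. *)
have lim2 (F G : nat -> V -> \bar R) F' G' : (forall k, nnmeas (F k)) -> (forall k, nnmeas (G k)) ->
    (forall k x, F k x <= (\1_(box vzero L) x)%:E) -> (forall k x, G k x <= (\1_(box vzero L) x)%:E) ->
    (forall x, F k x @[k --> \oo] --> F' x) -> (forall x, G k x @[k --> \oo] --> G' x) ->
    nnmeas F' -> nnmeas G' ->
    (forall k, \int[lebT d]_x F k x = \int[lebT d]_x ((\1_A x)%:E * G k x)) ->
    \int[lebT d]_x F' x = \int[lebT d]_x ((\1_A x)%:E * G' x).
  move=> nF nG bF bG cF cG nF' nG' E.
  have c1 : \int[lebT d]_x F k x @[k --> \oo] --> \int[lebT d]_x F' x.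
    apply: (@dominated_cvg _ _ _ (lebT d) setT measurableT _ _ (fun x => (\1_(box vzero L) x)%:E)) => //.
    - by move=> k; exact: (nF k).1.
    - by move=> k x _; rewrite gee0_abs; [exact: bF|exact: (nF k).2].
  have c2 : \int[lebT d]_x ((\1_A x)%:E * G k x) @[k --> \oo] --> \int[lebT d]_x ((\1_A x)%:E * G' x).
    apply: (@dominated_cvg _ _ _ (lebT d) setT measurableT _ _ (fun x => (\1_(box vzero L) x)%:E)) => //.
    - by move=> k; exact: (nnmeasM nA (nG k)).1.
    - by move=> x _; exact: cvgeZl.
    - move=> k x _; have /andP[a0 a1] := A1 x.
      rewrite gee0_abs; last exact: (nnmeasM nA (nG k)).2.
      rewrite -[leRHS]mul1e; apply: lee_pmul; [by rewrite lee_fin|exact: (nG k).2|by rewrite lee_fin|exact: bG].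
  by rewrite -(cvg_lim _ c1)// -(cvg_lim _ c2)//; congr (limn _); apply/funext.
have nT : nnmeas (cst 1 : V -> \bar R) by split => //; exact: measurable_cst.
have sk n B x : measurable B -> stay_kernel n t B x <= (\1_(box vzero L) x)%:E.
  move=> mB; have c : grid_kernel n k t B x @[k --> \oo] --> stay_kernel n t B x by exact: (cvg_grid_kernel HX).
  by apply: (cvge_le _ c); apply: nearW => k; exact: gk.
apply: (lim2 (fun n => stay_kernel n t A) (fun n => stay_kernel n t setT)).
- by move=> n; exact: (nnmeas_stay_kernel HX).
- by move=> n; exact: (nnmeas_stay_kernel HX).
- by move=> n x; exact: sk.
- by move=> n x; exact: sk.
- by move=> x; exact: (cvg_stay_kernel HX).
- by move=> x; exact: (cvg_stay_kernel HX).
- exact: (nnmeas_killed HX).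
- exact: (nnmeas_killed HX).
move=> n; apply: (lim2 (fun k => grid_kernel n k t A) (fun k => grid_kernel n k t setT)).
- by move=> k; exact: (nnmeas_grid_kernel HX).
- by move=> k; exact: (nnmeas_grid_kernel HX).
- by move=> k x; exact: gk.
- by move=> k x; exact: gk.
- by move=> x; exact: (cvg_grid_kernel HX).
- by move=> x; exact: (cvg_grid_kernel HX).
- exact: (nnmeas_stay_kernel HX).
- exact: (nnmeas_stay_kernel HX).
move=> k.
have := iter_step_dual (2 ^ k) (measurable_inner D n) (dyadic_step_ge0 k t0) nA nT.
rewrite (eq_integral (grid_kernel n k t A)); last by move=> x _; rewrite /= mul1e.
move=> ->; apply: eq_integral => x _; congr (_ * _).
by congr (iter _ _ _ _); apply/funext => y; rewrite indicT.
Qed.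

Lemma continuous_tuple_measurable (f : V -> R) : continuous_tuple f -> measurable_fun setT f.
Proof.
move=> cf; apply: (measurability _ (RGenOInfty.measurableE R)) => // _ [_ [a ->] <-].
rewrite setTI; apply: open_Rd_measurable => y /=; rewrite in_itv/= andbT => ay.
have [del [del0 h]] := cf y (f y - a)%R ltac:(by rewrite subr_gt0).
exists del; split => // z /h; rewrite /= in_itv/= andbT ltr_norml => /andP[]; lra.
Qed.

Lemma incr_density t A : (0 < t)%R -> measurable A ->
  P0 (incr t @^-1` A) = \int[lebT d]_y ((\1_A y)%:E * (p t y)%:E).
Proof.
case: HX => _ [_ [_ [_ [_ [_ den]]]]] t0 mA; have [p0 [_ [cp E]]] := den t t0.
rewrite [LHS]E// lebRE; first by apply: eq_integral => y _; rewrite EFinM.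
  apply/measurable_EFinP; apply: measurable_funM => //.
  exact: continuous_tuple_measurable.
by move=> y; rewrite lee_fin mulr_ge0.
Qed.

Lemma density_nonneg t y : (0 < t)%R -> (0 <= p t y)%R.
Proof. by case: HX => _ [_ [_ [_ [_ [_ den]]]]] t0; have [p0 _] := den t t0; exact: p0. Qed.

Lemma density_measurable t : (0 < t)%R -> measurable_fun setT (p t).
Proof.
by case: HX => _ [_ [_ [_ [_ [_ den]]]]] t0; have [_ [_ [cp _]]] := den t t0; exact: continuous_tuple_measurable.
Qed.

Lemma trans_bound t : (0 < t)%R -> exists2 M : R, (0 <= M)%R &
  forall f x, nnmeas f -> trans t f x <= M%:E * \int[lebT d]_y f y.
Proof.
move=> t0; case: HX => _ [_ [_ [_ [_ [_ den]]]]].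
have [p0 [[M pM] _]] := den t t0; have M0 : (0 <= M)%R by apply: le_trans (pM vzero).
exists M => // f x nf; have mi := measurable_incr HX (ltW t0).
have [mf f0] : nnmeas (fun y => f (vadd x y)) by apply: nnmeas_comp => //; exact: measurable_vadd.
rewrite /transop -(ge0_integral_law _ mi mf f0).
have -> : \int[lebT d]_y f y = \int[lebT d]_y f (vadd x y).
  have [mf' f0'] := nf; rewrite -(integral_lebT_shift x mf' f0').
  by apply: eq_integral => y _; rewrite vaddC.
have := @ge0_integral_mscale _ _ R (lebT d) setT measurableT (NngNum M0) (fun y => f (vadd x y)) mf (fun y _ => f0 y).
move=> /= <-; apply: ge0_le_measure_integral => // A mA.
apply: (@le_trans _ _ (\int[lebT d]_y ((\1_A y)%:E * M%:E))).
  rewrite [leLHS](incr_density t0 mA); apply: ge0_le_integral => //.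
  - by move=> y _; rewrite mule_ge0 ?lee_fin.
  - by apply/measurable_EFinP; apply: measurable_funM => //; exact: density_measurable.
  - by apply/measurable_EFinP; apply: measurable_funM.
  - by move=> y _; rewrite lee_wpmul2l ?lee_fin.
rewrite ge0_integralZr//; last exact/measurable_EFinP.
by rewrite integral_indic// setIT muleC.
Qed.

Lemma levy_bound t : (0 < t)%R -> exists2 M : R, (0 <= M)%R &
  forall f x, nnmeas f -> \int[P x]_w f (X t w) <= M%:E * \int[lebT d]_y f y.
Proof.
move=> t0; have [M M0 MP] := trans_bound t0; exists M => // f x nf.
have := @markov_indic _ _ _ _ _ _ _ _ HX x 0%R t setT f (lexx 0%R) (ltW t0) (@past_setT R d dO O X 0%R) nf.
under eq_integral do rewrite indicT mul1e add0r.
under [X in _ = X -> _]eq_integral do rewrite indicT mul1e.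
move=> ->; rewrite (integral_start HX); first exact: MP.
by apply: (nnmeas_trans HX) => //; exact: ltW.
Qed.

(* One unit of time makes the law absolutely continuous with bounded density, a second one is then
   turned around by duality. *)
Lemma killed_two_bound : exists2 M : R, (0 <= M)%R & forall A x, measurable A ->
  killed (1 + 1)%R A x <= M%:E * \int[lebT d]_y ((\1_A y)%:E * killed 1%R setT y).
Proof.
have [M M0 MP] := levy_bound (ltr01 : (0 < 1 :> R)%R); exists M => // A x mA.
have nk : nnmeas (killed 1%R A) by exact: (nnmeas_killed HX).
have nX1 : nnmeas (fun w => killed 1%R A (X 1%R w)) by apply: nnmeas_comp => //; exact: (levy_measurable HX).
rewrite (killed_add HX)// -killed_dual//; apply: le_trans (MP _ x nk).
have mal := measurable_alive HX D (ler01 : (0 <= 1 :> R)%R).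
apply: ge0_le_integral => //.
- by move=> w _; rewrite mule_ge0 ?lee_fin//; exact: nX1.2.
- by apply: emeasurable_funM; [apply/measurable_EFinP|exact: nX1.1].
- exact: nX1.1.
- move=> w _; rewrite -[leRHS]mul1e; apply: lee_wpmul2r; first exact: nX1.2.
  by rewrite lee_fin indicE lern1 leq_b1.
Qed.


End duality.

(** * Exponents and exponential decay *)

Local Close Scope ereal_scope.

Section cosine_bounds.
Context {R : realType}.
Implicit Types u v : R.

Lemma sin_le_id v : 0 <= v -> sin v <= v.
Proof.
rewrite le_eqVlt => /predU1P[<-|v0]; first by rewrite sin0.
have [|c _] := @MVT R sin cos 0 v v0 (fun x _ => is_derive_sin x).
  by apply: continuous_subspaceT => x; exact: continuous_sin.
by rewrite sin0 !subr0 => ->; rewrite ler_piMl ?cos_le1// ltW.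
Qed.

Lemma sqr_sin_le v : sin v ^+ 2 <= v ^+ 2.
Proof.
wlog v0 : v / 0 <= v => [H|].
  have [/H//|v0] := leP 0 v; rewrite -sqrrN -sinN -[leRHS]sqrrN; apply: H; rewrite oppr_ge0 ltW//.
have [v1|v1] := leP v 1; last first.
  apply: (@le_trans _ _ 1); first by have := cos2Dsin2 v; have := sqr_ge0 (cos v); lra.
  by rewrite expr_ge1// ltW.
rewrite ler_sqr ?nnegrE//; first exact: sin_le_id.
by apply: sin_ge0_pi; rewrite v0 (le_trans v1)// (le_trans _ (pi_ge2 R))// ler1n.
Qed.

Lemma one_sub_cos_ge0 u : 0 <= 1 - cos u.
Proof. by rewrite subr_ge0 cos_le1. Qed.

Lemma one_sub_cos_le u : 1 - cos u <= u ^+ 2.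
Proof.
have -> : u = (u / 2) *+ 2 by rewrite -mulr_natr divfK.
rewrite cos_mulr2n; have := sqr_sin_le (u / 2); have := cos2Dsin2 (u / 2).
have := sqr_ge0 (u / 2); move: (u / 2) => v.
move=> v0 h1 h2; have -> : (v *+ 2) ^+ 2 = 4 * v ^+ 2 by ring.
lra.
Qed.

Lemma cos1_le u : `|u| <= 1 -> cos 1 <= cos u.
Proof.
move=> u1; rewrite -(cos_norm u); move: u1; rewrite le_eqVlt => /predU1P[->//|u1].
have p1 : (1 : R) <= pi by rewrite (le_trans _ (pi_ge2 R))// ler1n.
by apply: ltW; rewrite ltr_cos ?in_itv/= ?normr_ge0 ?ler01 ?p1// (le_trans (ltW u1)).
Qed.

Lemma cos_eq1_small u : `|u| <= 1 -> cos u = 1 -> u = 0.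
Proof.
move=> u1; have p1 : (1 : R) <= pi by rewrite (le_trans _ (pi_ge2 R))// ler1n.
rewrite -cos_norm -cos0 => /cos_inj h; apply/eqP; rewrite -normr_eq0; apply/eqP; apply: h.
  by rewrite in_itv/= normr_ge0 (le_trans u1).
by rewrite in_itv/= lexx (le_trans ler01 p1).
Qed.

End cosine_bounds.

Section levy_exponent.
Context {R : realType} {d : nat}.
Local Notation V := (d.-tuple R).
Variable nu : {measure set V -> \bar R}.
Hypothesis Hnu : symmetric_levy_measure nu.
Local Notation psi := (levy_exponent nu).
Implicit Types xi z : V.

Lemma sqr_dotv_le xi z : dotv xi z ^+ 2 <= (\sum_(i < d) `|tnth xi i|) ^+ 2 * sqnorm z.
Proof.
have s0 : 0 <= sqnorm z by apply: sumr_ge0 => i _; exact: sqr_ge0.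
have -> : sqnorm z = Num.sqrt (sqnorm z) ^+ 2 by rewrite sqr_sqrtr.
rewrite -exprMn -[leLHS]real_normK ?num_real// ler_sqr ?nnegrE//; last first.
  by rewrite mulr_ge0 ?sqrtr_ge0// sumr_ge0.
rewrite mulr_suml (le_trans (ler_norm_sum _ _ _))//; apply: ler_sum => i _.
rewrite normrM ler_wpM2l// -sqrtr_sqr ler_wsqrtr// /sqnorm (bigD1 i)//= lerDl.
by apply: sumr_ge0 => j _; exact: sqr_ge0.
Qed.

Lemma measurable_one_sub_cos xi : measurable_fun setT (fun z => 1 - cos (dotv xi z)).
Proof.
apply: measurable_funB => //; apply: (bmeas_cos _).1; exact: measurable_dotv.
Qed.

(** [levy_exponent] is taken through [fine], which sends [+oo] to 0; finiteness makes it the actual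
    integral. *)
Lemma levy_exponent_int xi : (\int[nu]_z (1 - cos (dotv xi z))%:E < +oo)%E.
Proof.
case: Hnu => _ [fin _]; set c := \sum_(i < d) `|tnth xi i|.
have msq : measurable_fun setT (fun z : V => sqnorm z).
  by apply: measurable_sum => i; apply: measurable_funX; exact: measurable_tnth.
have mmin : measurable_fun setT (fun z : V => Num.min 1 (sqnorm z)) by exact: measurable_minr.
have s0 z : 0 <= sqnorm z by apply: sumr_ge0 => i _; exact: sqr_ge0.
(* The 2 bounds [1 - cos] where [sqnorm z] is above 1, and [c ^+ 2] is the Cauchy-Schwarz type
   factor where it is below. *)
apply: (@le_lt_trans _ _ (\int[nu]_z ((2 + c ^+ 2)%:E * (Num.min 1 (sqnorm z))%:E)))%E.
  apply: ge0_le_integral; first by [].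
  - by move=> z _; rewrite lee_fin one_sub_cos_ge0.
  - by apply/measurable_EFinP; exact: measurable_one_sub_cos.
  - by apply/measurable_EFinP; apply: measurable_funM.
  - move=> z _; rewrite lee_fin; have h1 := one_sub_cos_le (dotv xi z); have h2 := sqr_dotv_le xi z.
    have h3 := cos_geN1 (dotv xi z); rewrite -/c in h2; have c0 := sqr_ge0 c; have := s0 z.
    by rewrite /Num.min; case: ltP => h; nra.
rewrite ge0_integralZl//.
- by rewrite lte_mul_pinfty// lee_fin addr_ge0// sqr_ge0.
- exact/measurable_EFinP.
- by move=> z _; rewrite lee_fin le_min ler01 s0.
- by rewrite lee_fin addr_ge0// sqr_ge0.
Qed.

Lemma levy_exponentE xi : (psi xi)%:E = (\int[nu]_z (1 - cos (dotv xi z))%:E)%E.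
Proof.
rewrite fineK// ge0_fin_numE ?levy_exponent_int//.
by apply: integral_ge0 => z _; rewrite lee_fin one_sub_cos_ge0.
Qed.

Lemma levy_exponent_ge0 xi : 0 <= psi xi.
Proof.
by rewrite -lee_fin levy_exponentE; apply: integral_ge0 => z _; rewrite lee_fin one_sub_cos_ge0.
Qed.

(** Otherwise, for [nu]-almost every [z], the cosines at all frequencies [del / k.+1%:R] along each
    axis equal 1. For [k] large the argument is at most 1 in absolute value, which forces each
    coordinate of [z] to vanish; so [nu] would live on the origin, where it has no mass. *)
Lemma levy_exponent_neq0 (del : R) : 0 < del -> exists2 xi, \sum_(i < d) `|tnth xi i| <= del & 0 < psi xi.
Proof.
move=> del0; apply: contrapT => H.
have psi0 xi : \sum_(i < d) `|tnth xi i| <= del -> psi xi = 0.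
  move=> h; apply/eqP; rewrite eq_le levy_exponent_ge0 andbT leNgt; apply/negP => h'; apply: H.
  by exists xi.
pose e i k : V := [tuple if l == i then del / k.+1%:R else 0 | l < d].
have eE i k : psi (e i k) = 0.
  apply: psi0; rewrite (bigD1 i)//= big1 => [|j ji]; rewrite tnth_mktuple ?eqxx.
    rewrite addr0 gtr0_norm ?divr_gt0//.
    by rewrite ler_pdivrMr// ler_peMr ?ler1n// ltW.
  by rewrite (negbTE ji) normr0.
have ae0 i k : {ae nu, forall z, 1 - cos (dotv (e i k) z) = 0}.
  have mc := measurable_one_sub_cos (e i k).
  have /(ae_eq_integral_abs nu measurableT) : measurable_fun setT (fun z : V => (1 - cos (dotv (e i k) z))%:E).
    exact/measurable_EFinP.
  case=> + _; have -> : (\int[nu]_x `|(1 - cos (dotv (e i k) x))%:E| = 0)%E.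
    under eq_integral do rewrite gee0_abs ?lee_fin ?one_sub_cos_ge0//.
    by rewrite -levy_exponentE eE.
  move=> /(_ erefl); apply: filterS => z /= /(_ Logic.I) [].
  exact.
have aeall : {ae nu, forall z, forall i k, 1 - cos (dotv (e i k) z) = 0}.
  apply: filter_forall => i.
  by apply/ae_foralln => k; exact: ae0.
case: Hnu => nu0 [_ [_ /negP nuT]]; apply: nuT; rewrite -measure_le0 -nu0.
have mz : measurable [set [tuple 0 | _ < d] : V].
  rewrite (_ : [set _] = \bigcap_(i in [set: 'I_d]) ((fun z : V => tnth z i) @^-1` [set 0])).
    apply: fin_bigcap_measurable => // i _; rewrite -[X in measurable X]setTI.
    exact: (measurable_tnth i).
  apply/seteqP; split=> [z -> i _ /=|z h]; first by rewrite tnth_mktuple.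
  by apply: eq_from_tnth => i; rewrite tnth_mktuple; exact: h.
have [N [mN N0 NP]] := aeall.
have TU : setT `<=` N `|` [set [tuple 0 | _ < d] : V].
  move=> z _; have [zN|zN] := pselect (N z); [by left|right].
  have hz i k : 1 - cos (dotv (e i k) z) = 0.
    by apply: contrapT => h; apply: zN; apply: NP => /= /(_ i k).
  apply: eq_from_tnth => i; rewrite tnth_mktuple.
  have [k kP] := ex_inv_lt (divr_gt0 ltr01 (ltr_wpDr (mulr_ge0 (ltW del0) (normr_ge0 (tnth z i))) ltr01)).
  have := hz i k => /eqP; rewrite subr_eq0 eq_sym => /eqP hc.
  have : dotv (e i k) z = 0.
    apply: cos_eq1_small hc; rewrite dotv_delta normrM normrM (gtr0_norm del0) [`|_^-1|]gtr0_norm ?invr_gt0//.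
    have := kP k (leqnn k); rewrite div1r => h.
    have p0 : 0 <= del * `|tnth z i| by rewrite mulr_ge0// ltW.
    rewrite mulrAC -ler_pdivlMr ?invr_gt0// invrK mul1r.
    move: h; rewrite ltf_pV2 ?posrE//; last by rewrite ltr_wpDr.
    by move=> h; rewrite ltW// (le_lt_trans _ h)// lerDr.
  rewrite dotv_delta => /eqP; rewrite mulf_eq0 => /orP[|/eqP//].
  by rewrite mulf_eq0 invr_eq0 pnatr_eq0 orbF gt_eqF.
apply: (@le_trans _ _ (nu (N `|` [set [tuple 0 | _ < d] : V]))).
  by apply: le_measure; rewrite ?inE//; exact: measurableU.
have h := measureU2 nu mN mz; apply: (le_trans h).
by rewrite [X in (X + _ <= _)%E]N0 add0e.
Qed.

End levy_exponent.

Local Open Scope ereal_scope.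

(** * Exponential decay of the survival probability *)

Section decay.
Context {R : realType} {d : nat} {dO : measure_display} {O : measurableType dO}.
Local Notation V := (d.-tuple R).
Context {P : V -> probability O R} {X : R -> O -> V}.
Context {nu : {measure set V -> \bar R}} {p : R -> V -> R}.
Hypothesis HX : sym_levy_process P X nu p.
Variable D : set V.
Hypothesis bD : bounded_Rd D.
Local Notation P0 := (P vzero).
Local Notation incr := (incr X).
Local Notation killed := (killed P X D).

(* Were all increments confined to a fixed box, their characteristic function would stay away from 0
   near the origin; but it decays exponentially in time wherever the exponent is positive. *)
Lemma incr_spread (L : R) : (0 < L)%R -> exists2 s : R, (0 < s)%R & P0 (incr s @^-1` box vzero L) < 1.
Proof.
move=> L0; have [Hnu _] := HX.
have Li : (0 < L^-1)%R by rewrite invr_gt0.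
have [xi xiL psi0] := levy_exponent_neq0 Hnu Li.
have c1 : (0 < cos 1 :> R)%R := cos1_gt0 R.
(* This makes [s * levy_exponent nu xi] equal to [a = (cos 1)^-1], and [expR (- a) < a^-1 = cos 1].
   If the increments stayed in the box, their phases would be at most 1 and the mean cosine at least
   [cos 1]. *)
pose s := ((cos 1)^-1 / levy_exponent nu xi)%R.
have s0 : (0 < s)%R by rewrite divr_gt0// invr_gt0.
have mi := measurable_incr HX (ltW s0).
have mB : measurable (incr s @^-1` box vzero L).
  by have := mi measurableT _ (measurable_box vzero L); rewrite setTI.
exists s => //; rewrite lt_neqAle probability_le1// andbT; apply/negP => /eqP P1.
have mcos : measurable_fun setT (fun w => cos (dotv xi (incr s w) + 0)%R).
  by apply: (bmeas_cos _).1; apply: measurable_funD => //; exact: measurable_dotv.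
have icos : P0.-integrable setT (EFin \o (fun w => cos (dotv xi (incr s w) + 0)%R)).
  by apply: bmeas_int; apply: bmeas_cos; apply: measurable_funD => //; exact: measurable_dotv.
have cosE := incr_cos HX vzero xi 0%R (ltW s0); rewrite cos0 mulr1 in cosE.
have : \int[P0]_w (1 - cos (dotv xi (incr s w) + 0))%:E <= \int[P0]_w (1 - cos 1)%:E.
  apply: ae_ge0_le_integral; first by [].
  - by move=> w _; rewrite lee_fin one_sub_cos_ge0.
  - by apply/measurable_EFinP; exact: measurable_funB.
  - by move=> w _; rewrite lee_fin one_sub_cos_ge0.
  - exact: measurable_cst.
  have N0 : P0 (~` (incr s @^-1` box vzero L)) = 0 by rewrite probability_setC// P1 subee.
  exists (~` (incr s @^-1` box vzero L)); split; [exact: measurableC|exact: N0|].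
  move=> w /= h hb; apply: h => _; rewrite lee_fin lerD2l lerN2; apply: cos1_le; rewrite addr0.
  apply: le_trans (ler_norm_sum _ _ _) _.
  apply: (@le_trans _ _ (\sum_(i < d) `|tnth xi i| * L)%R).
    apply: ler_sum => i _; rewrite normrM ler_wpM2l// ltW//.
    by have := hb i; rewrite tnth_vzero subr0.
  by rewrite -mulr_suml -ler_pdivlMr// div1r.
have -> : \int[P0]_w (1 - cos (dotv xi (incr s w) + 0))%:E = (1 - expR (- (s * levy_exponent nu xi)))%:E.
  have i1 : P0.-integrable setT (EFin \o (fun=> 1%R)) by exact: finite_measure_integrable_cst.
  have := @integralB_EFin _ _ _ P0 setT (fun=> 1%R) (fun w => cos (dotv xi (incr s w) + 0)%R) measurableT i1 icos.
  under eq_integral do rewrite -EFinB.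
  move=> ->; rewrite integral_cst// EFinB; congr (_ - _).
    by rewrite [X in _ * X](_ : _ = 1) ?mule1//; exact: probability_setT.
  rewrite -cosE /Rintegral fineK//; exact: integrable_fin_num.
rewrite integral_cst// [X in _ * X](_ : _ = 1) ?mule1; last exact: probability_setT.
rewrite lee_fin lerD2l lerN2 => h.
have sp : (s * levy_exponent nu xi = (cos 1)^-1)%R by rewrite /s divfK// gt_eqF.
move: h; rewrite sp expRN -[X in (X <= _)%R]invrK lef_pV2 ?posrE ?expR_gt0 ?invr_gt0//.
apply/negP; rewrite -ltNge; apply: lt_le_trans (expR_ge1Dx _).
by rewrite ltrDr.
Qed.

(** Two points of [D] differ by less than [L + L] in each coordinate, so survival during a time [s]
    confines the increment to a box of probability [q < 1]; the semigroup property iterates this. *)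
Lemma killed_decay : exists s0 q : R, [/\ (0 < s0)%R, (0 <= q < 1)%R &
  forall n t x, (n%:R * s0 <= t)%R -> killed t setT x <= (q ^+ n)%:E].
Proof.
have [L L0 DL] := bounded_sub_box bD.
have L2 : (0 < L + L)%R by rewrite addr_gt0.
have [s s0 Ps] := incr_spread L2.
have mi := measurable_incr HX (ltW s0).
have mB : measurable (incr s @^-1` box vzero (L + L)%R).
  by have := mi measurableT _ (measurable_box vzero (L + L)%R); rewrite setTI.
have fB := fin_num_measure P0 _ mB.
pose q := fine (P0 (incr s @^-1` box vzero (L + L)%R)).
have qE : P0 (incr s @^-1` box vzero (L + L)%R) = q%:E by rewrite fineK.
have q0 : (0 <= q)%R by rewrite fine_ge0.
exists s, q; split => //; first by rewrite q0 -lte_fin -qE.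
have mK t : (0 <= t)%R -> measurable (alive X D t `&` X t @^-1` setT).
  by move=> t0; rewrite preimage_setT setIT; exact: (measurable_alive HX).
have k1 x : killed s setT x <= q%:E.
  rewrite -qE -(incr_law HX x (ltW s0) (measurable_box _ _)).
  apply: le_measure; rewrite ?inE.
  - exact: (mK _ (ltW s0)).
  - by [].
  - move=> w [al _]; have b0 : box vzero L (X 0%R w) by apply: DL; apply: alive_in al; rewrite lexx ltW.
    have b1 : box vzero L (X s w) by apply: DL; apply: alive_in al; rewrite lexx ltW.
    move=> i; have := box_trans (box_sym b0) b1 i.
    by rewrite tnth_vzero subr0 tnth_vsub.
have kn n x : killed (n%:R * s)%R setT x <= (q ^+ n)%:E.
  elim: n x => [|n IH] x.
    by rewrite expr0; apply: (killed_le1 HX) => //; rewrite mul0r.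
  rewrite -natr1 mulrDl mul1r addrC.
  apply: le_trans (killed_add_le HX _ (ltW s0) _ measurableT (fun y => IH y)) _.
    by rewrite mulr_ge0// ltW.
  rewrite exprS EFinM; apply: lee_wpmul2r; first by rewrite lee_fin exprn_ge0.
  exact: k1.
move=> n t x nst; apply: le_trans (kn n x).
have ns0 : (0 <= n%:R * s)%R by rewrite mulr_ge0// ltW.
apply: le_measure; rewrite ?inE.
- by apply: mK; exact: le_trans nst.
- exact: mK.
- by move=> w [al _]; split => //; exact: alive_le al.
Qed.

End decay.

(** * Adding a compound Poisson process *)

Lemma Rintegral_law {R : realType} {d1} {T : measurableType d1} {d2} {U : measurableType d2}
    (mu : {finite_measure set T -> \bar R}) (f : T -> U) (mf : measurable_fun setT f) (g : U -> R) :
  bmeas g -> (\int[law mu mf]_y g y = \int[mu]_x g (f x))%R.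
Proof.
move=> [mg [M gM]]; congr fine.
have bgf : bmeas (g \o f) by split; [exact: measurableT_comp|exists M => w; exact: gM].
have ig := bmeas_int mu bgf.
have meg : measurable_fun setT (EFin \o g) by exact/measurable_EFinP.
have := @integral_pushforward _ _ _ _ R f mf mu setT (EFin \o g) meg.
by rewrite preimage_setT; apply.
Qed.

Section symmetrization.
Context {R : realType} {d : nat}.
Local Notation V := (d.-tuple R).
Variable s : {measure set V -> \bar R}.

Lemma measurable_vneg_id : measurable_fun setT (@vneg R d).
Proof. exact: measurable_vneg. Qed.

Definition half : {nonneg R} := NngNum (ltac:(by []) : (0 <= 2^-1 :> R)%R).

(** The finiteness of [s] is an argument so that the finite-measure structure can be inferred from
    the term. *)
Definition symm of s setT < +oo : set V -> \bar R :=
  mscale half (measure_add s (law s measurable_vneg_id)).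

Variable fs : s setT < +oo.
HB.instance Definition _ := Measure.on (symm fs).

Lemma symmE A : symm fs A = (2^-1)%:E * (s A + s (@vneg R d @^-1` A)).
Proof. by congr (_ * _); exact: measure_addE. Qed.

Let symm_fin : fin_num_fun (symm fs).
Proof.
apply: lty_fin_num_fun; rewrite [X in X < _]symmE lte_mul_pinfty ?lee_fin//.
by rewrite preimage_setT lte_add_pinfty.
Qed.

HB.instance Definition _ := Measure_isFinite.Build _ _ _ (symm fs) symm_fin.

Lemma symm_vneg A : symm fs (@vneg R d @^-1` A) = symm fs A.
Proof.
rewrite !symmE addeC; congr (_ * (s _ + _)); apply/seteqP; split=> x /=; rewrite vnegK//.
Qed.

(** Averaging over [z] and its opposite cancels the sine term of the addition formula. *)
Lemma symm_cos xi c : (\int[symm fs]_z cos (dotv xi z + c) = cos c * \int[symm fs]_z cos (dotv xi z))%R.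
Proof.
have mz : measurable_fun setT (fun z : V => z) by exact: measurable_id.
have md : measurable_fun setT (fun z : V => dotv xi z) by exact: measurable_dotv.
have md' : measurable_fun setT (fun z : V => dotv xi (vneg z)) by apply: measurable_dotv; exact: measurable_vneg_id.
have b1 : (symm fs).-integrable setT (EFin \o (fun z => cos (dotv xi z + c)%R)).
  by apply: bmeas_int; apply: bmeas_cos; exact: measurable_funD.
have b2 : (symm fs).-integrable setT (EFin \o (fun z => cos (dotv xi (vneg z) + c)%R)).
  by apply: bmeas_int; apply: bmeas_cos; exact: measurable_funD.
have b3 : (symm fs).-integrable setT (EFin \o (fun z => cos (dotv xi z)%R)).
  by apply: bmeas_int; exact: bmeas_cos.
have E : (\int[symm fs]_z cos (dotv xi z + c) = \int[symm fs]_z cos (dotv xi (vneg z) + c))%R.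
  rewrite -(Rintegral_law (symm fs) measurable_vneg_id (g := fun z => cos (dotv xi z + c)%R)).
    congr fine; apply: eq_measure_integral => A mA _.
    by rewrite [RHS]lawE; apply/esym; exact: symm_vneg.
  by apply: bmeas_cos; exact: measurable_funD.
have h2 : (2 * \int[symm fs]_z cos (dotv xi z + c) = 2 * (cos c * \int[symm fs]_z cos (dotv xi z)))%R.
  rewrite mulr_natl mulr2n {2}E -RintegralD// mulrA -RintegralZl//.
  apply: eq_Rintegral => z _; rewrite dotvNr !cosD cosN sinN; ring.
by apply: (mulfI _ h2); rewrite pnatr_eq0.
Qed.

End symmetrization.

Section poisson.
Context {R : realType} {d : nat}.
Local Notation V := (d.-tuple R).
Variables (rho0 s : {finite_measure set V -> \bar R}).

Lemma measurable_vadd2 : measurable_fun setT (fun z : V * V => vadd z.1 z.2).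
Proof. by apply: measurable_vadd. Qed.

(** Starting from [rho0] instead of a unit mass at 0 makes the Poisson series below give directly
    the law of the independent sum. *)
Fixpoint conv_pow k : {finite_measure set V -> \bar R} :=
  if k is k'.+1 then law (fprod (conv_pow k') s) measurable_vadd2 else rho0.

Hypothesis scos : forall xi c, (\int[s]_z cos (dotv xi z + c) = cos c * \int[s]_z cos (dotv xi z))%R.

Lemma conv_pow_cos k xi c : (\int[conv_pow k]_z cos (dotv xi z + c) =
  (\int[s]_z cos (dotv xi z)) ^+ k * \int[rho0]_z cos (dotv xi z + c))%R.
Proof.
elim: k c => [|k IH] c; first by rewrite expr0 mul1r.
have md : measurable_fun setT (fun z : V => (dotv xi z + c)%R).
  by apply: measurable_funD => //; apply: measurable_dotv; exact: measurable_id.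
have bg : bmeas (fun z : V => cos (dotv xi z + c)%R) by exact: bmeas_cos.
rewrite [LHS](Rintegral_law (fprod (conv_pow k) s) measurable_vadd2 bg) Rintegral_fprod; last first.
  have [mg [M gM]] := bg; split; last by exists M => w; exact: gM.
  by apply: (measurableT_comp mg); exact: measurable_vadd2.
under eq_Rintegral => x _.
  have -> : (\int[s]_y cos (dotv xi (vadd (x, y).1 (x, y).2) + c) =
     (\int[s]_z cos (dotv xi z)) * cos (dotv xi x + c))%R.
    by rewrite -[RHS]mulrC -scos; apply: eq_Rintegral => z _; rewrite dotvDr; congr cos; ring.
  over.
rewrite RintegralZl ?IH 1?exprS ?mulrA//.
exact: (bmeas_int (conv_pow k) bg).
Qed.

Lemma conv_pow_setT k : conv_pow k setT = rho0 setT * ((fine (s setT)) ^+ k)%:E.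
Proof.
elim: k => [|k IH]; first by rewrite expr0 mule1.
rewrite [LHS]lawE preimage_setT -setXTT.
apply: (etrans (fprodE (conv_pow k) s measurableT measurableT)).
by rewrite IH exprSr EFinM muleA fineK// fin_num_measure.
Qed.

Variable r : R.
Hypothesis r0 : (0 <= r)%R.
Hypothesis rho01 : rho0 setT = 1.
Local Notation m := (fine (s setT)).

Let wt_ge0 k : (0 <= expR (- (m * r)) * exp_coeff r k :> R)%R.
Proof. by rewrite mulr_ge0 ?expR_ge0// exp_coeff_ge0. Qed.

Let wt k : {nonneg R} := NngNum (wt_ge0 k).

(* The law at time [r] of the compound Poisson process of jump measure [s], started from [rho0]. *)
Definition poisson_law : set V -> \bar R := mseries (fun k => mscale (wt k) (conv_pow k)) 0.

HB.instance Definition _ := Measure.on poisson_law.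

Lemma nneseries_cvg (u : nat -> R) (l : R) : (forall k, 0 <= u k)%R -> series u @ \oo --> l ->
  \sum_(k <oo) (u k)%:E = l%:E.
Proof.
move=> u0 ul; apply/cvg_lim => //.
rewrite (_ : (fun _ => _) = EFin \o series u); last by apply/funext => n /=; rewrite sumEFin.
by apply: cvg_EFin; [exact: nearW|exact: ul].
Qed.

Lemma cvg_exp_series (a b : R) : series (fun k => a * (exp_coeff r k * b ^+ k))%R @ \oo --> (a * expR (r * b))%R.
Proof.
have -> : series (fun k => a * (exp_coeff r k * b ^+ k))%R = (fun n => a * series (exp_coeff (r * b)) n)%R.
  apply/funext => n; rewrite /series/= mulr_sumr; apply: eq_bigr => k _.
  by rewrite /exp_coeff/= exprMn; congr (_ * _)%R; ring.
by apply: cvgMl_tmp; exact: is_cvg_series_exp_coeff.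
Qed.

Lemma poisson_law_ge0_int (g : V -> R) : measurable_fun setT g -> (forall z, 0 <= g z)%R ->
  \int[poisson_law]_z (g z)%:E =
  \sum_(k <oo) (expR (- (m * r)) * exp_coeff r k)%:E * \int[conv_pow k]_z (g z)%:E.
Proof.
move=> mg g0; have meg : measurable_fun setT (fun z => (g z)%:E) by exact/measurable_EFinP.
rewrite (ge0_integral_measure_series _ measurableT) => [|z _|]; [|by rewrite lee_fin|by []].
by apply: eq_eseriesr => k _; rewrite ge0_integral_mscale// => z _; rewrite lee_fin.
Qed.

Lemma m_ge0 : (0 <= m)%R. Proof. by rewrite fine_ge0. Qed.

Lemma poisson_law_setT : poisson_law setT = 1.
Proof.
have -> : poisson_law setT = \int[poisson_law]_z (1%R)%:E.
  by rewrite integral_cst// mul1e.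
rewrite (poisson_law_ge0_int (g := fun=> 1%R))//.
under eq_eseriesr => k _.
  rewrite integral_cst// mul1e [X in _ * X]conv_pow_setT rho01 mul1e -EFinM -mulrA.
  over.
rewrite (@nneseries_cvg _ (expR (- (m * r)) * expR (r * m))%R).
- by rewrite -expRD mulrC addNr expR0.
- by move=> k; rewrite mulrA mulr_ge0 ?wt_ge0// exprn_ge0// m_ge0.
- exact: cvg_exp_series.
Qed.

Let poisson_fin : fin_num_fun poisson_law.
Proof. by apply: lty_fin_num_fun; rewrite [X in X < _]poisson_law_setT ltry. Qed.

HB.instance Definition _ := Measure_isFinite.Build _ _ _ poisson_law poisson_fin.

(** Termwise integration against the series of measures concerns nonnegative functions; hence 1 is
    added to the cosine, and its contribution, the total mass 1, cancels at the end. *)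
Lemma poisson_law_cos xi c : (\int[poisson_law]_z cos (dotv xi z + c) =
  expR (- (r * (m - \int[s]_z cos (dotv xi z)))) * \int[rho0]_z cos (dotv xi z + c))%R.
Proof.
set sh := (\int[s]_z cos (dotv xi z))%R; set rh := (\int[rho0]_z cos (dotv xi z + c))%R.
have md : measurable_fun setT (fun z : V => (dotv xi z + c)%R).
  by apply: measurable_funD => //; apply: measurable_dotv; exact: measurable_id.
have bg : bmeas (fun z : V => cos (dotv xi z + c)%R) by exact: bmeas_cos.
have b1 : bmeas (fun z : V => 1%R : R) by exact: bmeas_cst.
have E (mu : {finite_measure set V -> \bar R}) :
    \int[mu]_z (1 + cos (dotv xi z + c))%:E = (fine (mu setT) + \int[mu]_z cos (dotv xi z + c))%R%:E.
  have ig := bmeas_int mu bg; have i1 := bmeas_int mu b1.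
  transitivity (\int[mu]_z (1%:E + (cos (dotv xi z + c))%:E)); first by [].
  rewrite integralD// integral_cst// mul1e EFinD fineK ?fin_num_measure//.
  by rewrite /Rintegral fineK//; exact: integrable_fin_num ig.
have c0 (z : V) : (0 <= 1 + cos (dotv xi z + c))%R by have := cos_geN1 (dotv xi z + c)%R; lra.
have mg : measurable_fun setT (fun z : V => (1 + cos (dotv xi z + c))%R).
  by apply: measurable_funD => //; exact: bg.1.
have := poisson_law_ge0_int mg c0; rewrite E [X in fine X]poisson_law_setT /=.
have Ek k : \int[conv_pow k]_z (1 + cos (dotv xi z + c))%:E = (m ^+ k + sh ^+ k * rh)%R%:E.
  by rewrite E [X in fine X]conv_pow_setT rho01 mul1e conv_pow_cos.
under eq_eseriesr do rewrite Ek -EFinM.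
rewrite (@nneseries_cvg _ (expR (- (m * r)) * expR (r * m) + (expR (- (m * r)) * rh) * expR (r * sh))%R).
- move=> [] /eqP; rewrite -expRD mulrC addNr expR0 (inj_eq (addrI _)) => /eqP ->.
  by rewrite mulrAC -expRD; congr (expR _ * _)%R; ring.
- move=> k; rewrite mulr_ge0 ?wt_ge0// -lee_fin -Ek.
  by apply: integral_ge0 => z _; rewrite lee_fin.
- have -> : series (fun k => expR (- (m * r)) * exp_coeff r k * (m ^+ k + sh ^+ k * rh))%R =
     (fun n => series (fun k => expR (- (m * r)) * (exp_coeff r k * m ^+ k)) n +
      series (fun k => (expR (- (m * r)) * rh) * (exp_coeff r k * sh ^+ k)) n)%R.
    by apply/funext => n; rewrite /series/= -big_split/=; apply: eq_bigr => k _; ring.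
  by apply: cvgD; exact: cvg_exp_series.
Qed.

(** The term [k = 0] of the series: no jump occurs up to time [r]. *)
Lemma poisson_law_ge A : measurable A -> (expR (- (m * r)))%:E * rho0 A <= poisson_law A.
Proof.
move=> mA.
have := nneseries_lim_ge 1 (u_ := fun k => mscale (wt k) (conv_pow k) A) (P := xpredT) (m := 0%N).
rewrite big_nat1 /= => h; apply: le_trans (h _) => //.
by rewrite [leRHS]/mscale/= /exp_coeff/= expr0 fact0 divr1 mulr1.
Qed.

End poisson.

(** * Comparison of the laws of the increments *)

Section law_comparison.
Context {R : realType} {d : nat}.
Local Notation V := (d.-tuple R).
Context {dX : measure_display} {OX : measurableType dX} {PX : V -> probability OX R} {X : R -> OX -> V}.
Context {nuX : {measure set V -> \bar R}} {pX : R -> V -> R}.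
Context {dY : measure_display} {OY : measurableType dY} {PY : V -> probability OY R} {Y : R -> OY -> V}.
Context {nuY : {measure set V -> \bar R}} {pY : R -> V -> R}.
Hypothesis HX : sym_levy_process PX X nuX pX.
Hypothesis HY : sym_levy_process PY Y nuY pY.
Variable sg : {measure set V -> \bar R}.
Hypothesis fsg : sg setT < +oo.
Hypothesis nuE : forall A, measurable A -> nuX A = nuY A + sg A.
Local Notation s := (symm fsg).
Local Notation m := (fine (s setT)).

Lemma vneg_image (A : set V) : @vneg R d @` A = @vneg R d @^-1` A.
Proof.
apply/seteqP; split=> [_ [z Az <-]|z Az] /=; first by rewrite vnegK.
by exists (vneg z) => //; rewrite vnegK.
Qed.

(** Where [nuY A] is infinite both sides are [+oo]. Elsewhere it can be cancelled, and the symmetry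
    of [nuX] and [nuY] gives [sg] the same value on [A] and on its reflection. *)
Lemma nu_symm A : measurable A -> nuX A = nuY A + s A.
Proof.
move=> mA; have [[_ [_ [sX _]]] _] := HX; have [[_ [_ [sY _]]] _] := HY.
have mNA : measurable (@vneg R d @^-1` A).
  by rewrite -[X in measurable X]setTI; exact: measurable_vneg_id.
have h1 := nuE mA; have h2 := nuE mNA.
rewrite -vneg_image sX// sY// vneg_image in h2.
rewrite [X in _ + X]symmE.
have f1 : sg A \is a fin_num.
  by rewrite ge0_fin_numE// (le_lt_trans _ fsg)// le_measure ?inE.
have f2 : sg (@vneg R d @^-1` A) \is a fin_num.
  by rewrite ge0_fin_numE// (le_lt_trans _ fsg)// le_measure ?inE.
rewrite h1; have [->|yoo] := eqVneq (nuY A) +oo.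
  have sgt0 (B : set V) : sg B != -oo by rewrite gt_eqF// (lt_le_trans _ (measure_ge0 sg B)).
  rewrite !addye// gt_eqF// (lt_le_trans (y := 0))// mule_ge0// ?lee_fin//.
  exact: adde_ge0.
have f3 : nuY A \is a fin_num by rewrite ge0_fin_numE// ltey.
have : nuY A + sg A = nuY A + sg (@vneg R d @^-1` A) by rewrite -h1.
move/(congr1 (fun z => z - nuY A)); rewrite ![nuY A + _]addeC !addeK// => <-.
by congr (_ + _); move: (sg A) f1 => [a| |]// _; rewrite -EFinD -EFinM; congr EFin; lra.
Qed.

Lemma levy_exponent_add xi :
  (levy_exponent nuX xi = levy_exponent nuY xi + (m - \int[s]_z cos (dotv xi z)))%R.
Proof.
have [HnX _] := HX; have [HnY _] := HY.
apply: EFin_inj; rewrite (levy_exponentE HnX) EFinD (levy_exponentE HnY).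
have mc : measurable_fun setT (fun z : V => (1 - cos (dotv xi z))%:E).
  by apply/measurable_EFinP; exact: measurable_one_sub_cos.
have bg : bmeas (fun z : V => cos (dotv xi z)) by apply: bmeas_cos; apply: measurable_dotv; exact: measurable_id.
rewrite (@eq_measure_integral _ _ _ _ (measure_add nuY s)); last first.
  by move=> A mA _; rewrite [RHS]measure_addE; exact: nu_symm.
rewrite ge0_integral_measure_add//.
congr (_ + _); have ig := bmeas_int s bg; have i1 := bmeas_int s (bmeas_cst (1%R : R)).
transitivity (\int[s]_z (1%:E - (cos (dotv xi z))%:E)); first by [].
rewrite integralB// integral_cst// mul1e EFinB fineK ?fin_num_measure//.
by rewrite /Rintegral fineK//; exact: integrable_fin_num ig.
Qed.

(** The exponents differ by that of the compound Poisson process, so by uniqueness the increment of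
    [X] has the law [poisson_law] started from the increment of [Y]; [poisson_law_ge] bounds it
    below. *)
Lemma law_comparison r A : (0 <= r)%R -> measurable A ->
  PY vzero (incr Y r @^-1` A) <= (expR (m * r))%:E * PX vzero (incr X r @^-1` A).
Proof.
move=> r0 mA; set rho0 := law (PY vzero) (measurable_incr HY r0).
have rho01 : rho0 setT = 1 by rewrite [LHS]lawE preimage_setT; exact: probability_setT.
have E : PX vzero (incr X r @^-1` A) = poisson_law rho0 s r0 A.
  have h := @cf_unique1 R d _ _ (PX vzero) _ _ (poisson_law rho0 s r0) (incr X r) id
    (measurable_incr HX r0) (@measurable_id _ _ _) _ A mA.
  rewrite (h rho01)// => xi c; rewrite (incr_cos HX vzero xi c r0).
  rewrite (poisson_law_cos (symm_cos fsg) r0 rho01).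
  have bg : bmeas (fun z : V => cos (dotv xi z + c)%R).
    by apply: bmeas_cos; apply: measurable_funD => //; apply: measurable_dotv; exact: measurable_id.
  rewrite [in RHS](Rintegral_law _ _ bg) (incr_cos HY vzero xi c r0) mulrA -expRD.
  by rewrite levy_exponent_add; congr (expR _ * _)%R; ring.
have := poisson_law_ge rho0 s r0 mA; rewrite -E [X in _ * X]lawE => h.
rewrite -lee_pdivrMl ?expR_gt0// -expRN.
exact: h.
Qed.

End law_comparison.

(** * The killed density *)

Lemma measurable_fun_pieces {d1} {T : measurableType d1} {d2} {U : measurableType d2} (f : T -> U)
    (E : nat -> set T) (g : nat -> T -> U) :
  (forall k, measurable (E k)) -> (forall k, measurable_fun setT (g k)) ->
  (forall t, exists k, E k t) -> (forall k t, E k t -> f t = g k t) -> measurable_fun setT f.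
Proof.
move=> mE mg cov fg _ A mA; rewrite setTI.
have -> : f @^-1` A = \bigcup_k (E k `&` g k @^-1` A).
  apply/seteqP; split=> [t /= ft|t [k _ [Et /=]]]; last by rewrite -fg.
  by have [k Et] := cov t; exists k => //; split => //=; rewrite -fg.
apply: bigcupT_measurable => k; apply: measurableI => //; rewrite -[X in measurable X]setTI; exact: mg.
Qed.

(** * Joint measurability of paths and densities in time *)

Section joint_measurability.
Context {R : realType} {d : nat} {dO : measure_display} {O : measurableType dO}.
Local Notation V := (d.-tuple R).
Context {P : V -> probability O R} {X : R -> O -> V}.
Context {nu : {measure set V -> \bar R}} {p : R -> V -> R}.
Hypothesis HX : sym_levy_process P X nu p.
Local Notation P0 := (P vzero).
Local Notation incr := (incr X).

(** Negative times are sent to 0, because the hypotheses on [X] bear on nonnegative times; this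
    gives a measurable function on all of [R * O]. *)
Definition path_at (X : R -> O -> V) (z : R * O) : V := X (Num.max z.1 0%R) z.2.

Lemma path_atE s w : (0 <= s)%R -> path_at X (s, w) = X s w.
Proof. by move=> s0; rewrite /path_at/= max_l. Qed.

Lemma measurable_path_at : measurable_fun setT (path_at X).
Proof.
pose m (z : R * O) : R := Num.max z.1 0%R.
have mm : measurable_fun setT m by apply: measurable_maxr => //; exact: measurable_fst.
have m0 z : (0 <= m z)%R by rewrite le_max lexx orbT.
(* The [.+1] rounds to a dyadic time on the right, the side on which the path is continuous. *)
pose sn n (s : R) : R := ((Num.truncn (s * 2 ^+ n)).+1%:R / 2 ^+ n)%R.
have p2 n : (0 < 2 ^+ n :> R)%R by rewrite exprn_gt0.
have ma n : measurable_fun setT (fun z : R * O => X (sn n (m z)) z.2).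
  apply: (@measurable_fun_pieces _ (R * O)%type _ V _
    (fun k => (fun z : R * O => (m z * 2 ^+ n)%R) @^-1` [set` `[k%:R, k.+1%:R[%R])
    (fun k (z : R * O) => X (k.+1%:R / 2 ^+ n)%R z.2)).
  - move=> k; rewrite -[X in measurable X]setTI.
    have : measurable_fun setT (fun z : R * O => (m z * 2 ^+ n)%R) by apply: measurable_funM.
    by apply => //; exact: measurable_itv.
  - move=> k; apply: measurableT_comp; last exact: measurable_snd.
    by apply: (levy_measurable HX); rewrite divr_ge0// ltW.
  - move=> z; exists (Num.truncn (m z * 2 ^+ n)) => /=; rewrite in_itv/=.
    by apply: truncn_itv; rewrite mulr_ge0// ltW.
  - move=> k z /=; rewrite in_itv/= => h; rewrite /sn (_ : Num.truncn _ = k)//.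
    exact: truncn_def.
have cv z i : tnth (X (sn n (m z)) z.2) i @[n --> \oo] --> tnth (path_at X z) i.
  apply/cvgrPdist_lt => e e0.
  have [del del0 hd] := levy_right_cont HX z.2 (m0 z) e0.
  have [k kP] := ex_half_lt del0; exists k => // n /= /kP hn.
  rewrite distrC; apply: hd; rewrite /sn.
  have /andP[h1 h2] := truncn_itv (mulr_ge0 (m0 z) (ltW (p2 n))).
  apply/andP; split; first by rewrite ler_pdivlMr// ltW.
  rewrite -natr1 mulrDl mul1r ler_ltD//.
  by rewrite ler_pdivrMr.
apply/measurable_fun_tnthP => i /=.
apply: (measurable_fun_cvg (h := fun n z => tnth (X (sn n (m z)) z.2) i)) => [n|z _].
  exact: measurable_tnth_comp.
exact: cv.
Qed.

(** [p] is constrained at positive times only. The default 0 also serves the killed density: for a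
    path that does not leave before [t] the remaining time is 0, and nothing is subtracted. *)
Definition dens (p : R -> V -> R) (z : R * V) : R := if (0 < z.1)%R then p z.1 z.2 else 0%R.

Lemma dens_ge0 z : (0 <= dens p z)%R.
Proof. by rewrite /dens; case: ifPn => // z0; exact: (density_nonneg HX). Qed.

Lemma box_average (f : V -> R) c e (l u : R) : measurable_fun setT f -> (forall y, 0 <= f y)%R -> (0 < e)%R ->
  (forall y, box c e y -> l <= f y <= u)%R ->
  (l * (e *+ 2) ^+ d)%:E <= \int[lebT d]_y ((\1_(box c e) y)%:E * (f y)%:E) <= (u * (e *+ 2) ^+ d)%:E.
Proof.
move=> mf f0 e0 h; have mb := @measurable_box R d c e.
have mi : measurable_fun setT (fun y => (\1_(box c e) y)%:E : \bar R) by apply/measurable_EFinP.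
have I (a : R) : (0 <= a)%R -> \int[lebT d]_y ((\1_(box c e) y)%:E * a%:E) = (a * (e *+ 2) ^+ d)%:E.
  move=> a0; under eq_integral do rewrite muleC.
  rewrite ge0_integralZl//.
  by rewrite integral_indic// setIT [X in _ * X]lebT_box ?ltW.
have u0 : (0 <= u)%R by apply: le_trans (f0 c) _; have /andP[] := h c (box_center c e0).
have mif : measurable_fun setT (fun y => (\1_(box c e) y)%:E * (f y)%:E).
  by apply: emeasurable_funM => //; exact/measurable_EFinP.
apply/andP; split.
  have [l0|l0] := leP 0%R l; last first.
    apply: (@le_trans _ _ 0).
      by rewrite lee_fin pmulr_lle0 ?ltW// exprn_gt0// pmulrn_lgt0.
    by apply: integral_ge0 => y _; rewrite -EFinM lee_fin mulr_ge0.
  rewrite -I//; apply: ge0_le_integral => //.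
  - by move=> y _; rewrite -EFinM lee_fin mulr_ge0.
  - by apply: emeasurable_funM.
  - move=> y _; rewrite indicE; have [/set_mem/h/andP[h1 _]|_] := boolP (y \in _).
      by rewrite !mul1e lee_fin.
    by rewrite !mul0e.
rewrite -I//; apply: ge0_le_integral => //.
- by move=> y _; rewrite -EFinM lee_fin mulr_ge0.
- by apply: emeasurable_funM.
- move=> y _; rewrite indicE; have [/set_mem/h/andP[_ h1]|_] := boolP (y \in _).
    by rewrite !mul1e lee_fin.
  by rewrite !mul0e.
Qed.

(** No regularity of [p] in time is given. By continuity in space, [p t y] is the limit of its
    averages over shrinking boxes around [y]; such an average is the probability that the increment
    falls in the box, divided by the volume, and depends measurably on [(t, y)] because the paths
    are jointly measurable. *)
Lemma measurable_dens : measurable_fun setT (dens p).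
Proof.
pose e n : R := (n.+1%:R^-1)%R; have e0 n : (0 < e n)%R by rewrite invr_gt0.
pose vol n : R := ((e n *+ 2) ^+ d)%R.
have v0 n : (0 < vol n)%R by rewrite exprn_gt0// pmulrn_lgt0.
pose B n : set ((R * V) * O) :=
  [set u | box u.1.2 (e n) (vsub (path_at X (u.1.1, u.2)) (path_at X (0%R, u.2)))].
have mB n : measurable (B n).
  rewrite (_ : B n = \bigcap_(i in [set: 'I_d]) ((fun u : (R * V) * O =>
     `|tnth (vsub (path_at X (u.1.1, u.2)) (path_at X (0%R, u.2))) i - tnth u.1.2 i|)%R @^-1` [set x | x < e n]%R)).
    apply: fin_bigcap_measurable => // i _; rewrite -[X in measurable X]setTI.
    have : measurable_fun setT (fun u : (R * V) * O =>
       `|tnth (vsub (path_at X (u.1.1, u.2)) (path_at X (0%R, u.2))) i - tnth u.1.2 i|)%R.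
      apply: measurableT_comp => //; apply: measurable_funB; apply: measurable_tnth_comp.
        apply: measurable_vsub; apply: (measurableT_comp measurable_path_at); apply: measurable_fun_pair => //.
        by apply: measurableT_comp.
      by apply: measurableT_comp.
    apply => //; rewrite (_ : [set x | _]%R = [set` `]-oo, e n[%R]); last first.
      by apply/seteqP; split=> y /=; rewrite in_itv.
    exact: measurable_itv.
  by apply/seteqP; split=> u h i //=; exact: h.
have miB n : measurable_fun setT (fun u => (\1_(B n) u)%:E : \bar R) by exact/measurable_EFinP.
pose a n (z : R * V) : \bar R := \int[P0]_w (\1_(B n) (z, w))%:E.
have ma n : measurable_fun setT (a n).
  by apply: (@measurable_fun_fubini_tonelli_F _ _ _ _ R P0 (fun u => (\1_(B n) u)%:E)).
have aE n s y : (0 < s)%R -> a n (s, y) = \int[lebT d]_u ((\1_(box y (e n)) u)%:E * (p s u)%:E).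
  move=> s0; rewrite -(incr_density HX s0)//; last exact: measurable_box.
  have mi : measurable (incr s @^-1` box y (e n)).
    by rewrite -[X in measurable X]setTI; apply: (measurable_incr HX (ltW s0)) => //; exact: measurable_box.
  transitivity (\int[P0]_w (\1_(incr s @^-1` box y (e n)) w)%:E); last by rewrite integral_indic// setIT.
  apply: eq_integral => w _; congr EFin; rewrite !indicE; congr ((nat_of_bool _)%:R).
  by apply/idP/idP => /set_mem h; apply/mem_set; move: h; rewrite /B /= !path_atE// ltW.
apply: (measurable_fun_cvg
  (h := fun n z => \1_[set z : R * V | 0 < z.1]%R z * ((vol n)^-1 * fine (a n z)))%R) => [n|[s y] _].
  apply: measurable_funM.
    apply: measurable_indic; rewrite (_ : [set z | _] = [set z : R * V | z.1 \in `]0%R, +oo[%R]); last first.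
      by apply/seteqP; split=> z /=; rewrite in_itv/= andbT.
    have m1 : measurable_fun setT (fun z : R * V => z.1) by exact: measurable_fst.
    by have := m1 measurableT _ (@measurable_itv R `]0%R, +oo[%R); rewrite setTI.
  by apply: measurable_funM => //; apply: (measurableT_comp (fine_measurable measurableT)).
rewrite /dens/= indicE; have [s0|s0] := ltP 0%R s; last first.
  rewrite memNset/=; last by rewrite ltNge s0.
  by under eq_fun do rewrite mul0r; exact: cvg_cst.
rewrite mem_set//=; under eq_fun do rewrite mul1r.
apply/cvgrPdist_le => eps eps0.
have [_ [_ [_ [_ [_ [_ den]]]]]] := HX; have [p0 [_ [cp _]]] := den s s0.
have [del [del0 hd]] := cp y eps eps0; have [k kP] := ex_inv_lt del0.
exists k => // n /= /kP /ltW ne; rewrite aE//.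
have := @box_average (p s) y (e n) (p s y - eps)%R (p s y + eps)%R (density_measurable HX s0) p0 (e0 n) _.
case/(_ _)/andP => [u ub|h1 h2].
  have : (`|p s u - p s y| < eps)%R by apply: hd => i; apply: lt_le_trans (ub i) ne.
  by rewrite ltr_norml => /andP[]; lra.
move: h1 h2; case: (\int[_]_y _) => [r| |]// h1 h2.
rewrite ler_distlC /= -/(vol n) in h1 h2 *; rewrite !lee_fin in h1 h2.
by rewrite mulrC ler_pdivlMr// ler_pdivrMr// h1 h2.
Qed.

End joint_measurability.

Local Close Scope ereal_scope.

Lemma cvg_sum_seq {R : realType} {I : Type} (r : seq I) (F : I -> nat -> R) (l : I -> R) :
  (forall i, F i n @[n --> \oo] --> l i) ->
  \sum_(i <- r) F i n @[n --> \oo] --> \sum_(i <- r) l i.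
Proof.
move=> Fl; elim: r => [|i r IH]; first by under eq_fun do rewrite big_nil; rewrite big_nil; exact: cvg_cst.
by under eq_fun do rewrite big_cons; rewrite big_cons; apply: cvgD.
Qed.

(** Discrete stopping: once a coefficient [a j] is false all later ones are, so the sum telescopes
    up to the first such index, or to [N]. *)
Lemma stopped_sum {R : realType} (u : nat -> R) (a : nat -> bool) N :
  (forall i j, (i <= j)%N -> a j -> a i) -> exists k, [/\ (k <= N)%N, (forall j, (j < k)%N -> a j),
    ((k < N)%N -> ~~ a k) & u 0%N + \sum_(j < N) (a j)%:R * (u j.+1 - u j) = u k].
Proof.
move=> amono; elim: N => [|N [k [kN ak nak uk]]].
  by exists 0%N; split => //; rewrite big_ord0 addr0.
rewrite big_ord_recr/= addrA uk; have [aN|naN] := boolP (a N).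
  have kE : k = N.
    apply/eqP; rewrite eqn_leq kN /= leqNgt; apply/negP => /[dup] kN' /nak /negP; apply.
    exact: amono aN.
  exists N.+1; split => //; last by rewrite kE mul1r addrC subrK.
    by move=> j; rewrite ltnS => jN; exact: amono aN.
  by rewrite ltnn.
exists k; split => //; first exact: leqW.
  by rewrite ltnS leq_eqVlt => /predU1P[->//|/nak].
by rewrite mul0r addr0.
Qed.

(** * Strong Markov property at the lifetime *)

Section stopping_definitions.
Context {R : realType} {d : nat} {dO : measure_display} {O : measurableType dO}.
Local Notation V := (d.-tuple R).
Variables (X : R -> O -> V) (D : set V).

Definition stop_time t w : R := fine (mine (lifetime X D w) t%:E).

(** The first path up to its stopping time, continued for the remaining time by the increment of a
    second path, which is independent under the product measure. *)
Definition post_stop t (z : O * O) : V :=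
  vadd (path_at X (stop_time t z.1, z.1)) (vsub (path_at X (t - stop_time t z.1, z.2)) (X 0 z.2)).

End stopping_definitions.

Section stopping.
Context {R : realType} {d : nat} {dO : measure_display} {O : measurableType dO}.
Local Notation V := (d.-tuple R).
Context {P : V -> probability O R} {X : R -> O -> V}.
Context {nu : {measure set V -> \bar R}} {p : R -> V -> R}.
Hypothesis HX : sym_levy_process P X nu p.
Variable D : set V.
Local Notation P0 := (P vzero).
Local Notation psi := (levy_exponent nu).
Local Notation lifetime := (lifetime X D).
Local Notation alive := (alive X D).

Lemma stop_time_lt t w : (lifetime w < t%:E)%E -> (stop_time X D t w)%:E = lifetime w.
Proof.
move=> h; rewrite /stop_time min_l ?(ltW h)// fineK// ge0_fin_numE ?lifetime_ge0//.
exact: lt_trans h (ltry _).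
Qed.

Lemma stop_time_ge t w : (t%:E <= lifetime w)%E -> stop_time X D t w = t.
Proof. by move=> h; rewrite /stop_time min_r. Qed.

Lemma stop_time_itv t w : 0 <= t -> 0 <= stop_time X D t w <= t.
Proof.
move=> t0; have [h|h] := ltP (lifetime w) t%:E; last by rewrite stop_time_ge// t0 lexx.
by rewrite -!lee_fin stop_time_lt// lifetime_ge0 ltW.
Qed.

Lemma measurable_stop_time : measurable_fun setT (fun z : R * O => stop_time X D z.1 z.2).
Proof.
apply: (measurableT_comp (fine_measurable measurableT)); apply: measurable_mine.
  exact: (measurableT_comp (measurable_lifetime HX D) measurable_snd).
by apply/measurable_EFinP; exact: measurable_fst.
Qed.

Lemma cos_martingale x (B : set O) s h xi c : 0 <= s -> 0 <= h -> past X s B ->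
  \int[P x]_w (\1_B w * cos (dotv xi (X (s + h) w) + c)) =
  expR (- (h * psi xi)) * \int[P x]_w (\1_B w * cos (dotv xi (X s w) + c)).
Proof.
move=> s0 h0 pB; have mB := past_measurable HX pB.
have mX r : 0 <= r -> measurable_fun setT (fun w => dotv xi (X r w) + c).
  by move=> r0; apply: measurable_funD => //; apply: measurable_dotv; exact: (levy_measurable HX).
(* [markov_indic] concerns nonnegative functions, hence [1 + cos]; the contribution of the constant
   is the same on both sides. *)
have c0 (u : R) : 0 <= 1 + cos u by have := cos_geN1 u; lra.
have nf : nnmeas (fun y : V => (1 + cos (dotv xi y + c))%:E).
  split=> [|y]; last by rewrite lee_fin.
  apply/measurable_EFinP; apply: measurable_funD => //; apply: (bmeas_cos _).1.
  by apply: measurable_funD => //; apply: measurable_dotv; exact: measurable_id.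
have bi : bmeas (\1_B : O -> R) := bmeas_indic mB.
have i1 := bmeas_int (P x) bi.
have bc r : 0 <= r -> bmeas (fun w => \1_B w * cos (dotv xi (X r w) + c)).
  by move=> r0; apply: bmeasM => //; apply: bmeas_cos; exact: mX.
have tE w : transop P X h (fun y : V => (1 + cos (dotv xi y + c))%:E) (X s w) =
    (1 + expR (- (h * psi xi)) * cos (dotv xi (X s w) + c))%:E.
  rewrite /transop.
  have bu : bmeas (fun w' => cos (dotv xi (incr X h w') + (dotv xi (X s w) + c))).
    apply: bmeas_cos; apply: measurable_funD => //; apply: measurable_dotv.
    exact: (measurable_incr HX).
  transitivity (\int[P0]_w' (1%:E + (cos (dotv xi (incr X h w') + (dotv xi (X s w) + c)))%:E))%E.
    by apply: eq_integral => w' _; rewrite -EFinD dotvDr; congr (_ + cos _)%:E; rewrite /incr; ring.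
  have iu := bmeas_int P0 bu.
  rewrite integralD//; last exact: (bmeas_int P0 (bmeas_cst (1 : R))).
  rewrite integral_cst// mul1e [X in (X + _)%E](@probability_setT _ _ _ P0) EFinD; congr (_ + _)%E.
  rewrite -(incr_cos HX vzero xi (dotv xi (X s w) + c) h0) /Rintegral fineK//.
  exact: integrable_fin_num.
have := markov_indic HX x s0 h0 pB nf.
under [RHS]eq_integral do rewrite tE -EFinM.
under [LHS]eq_integral do rewrite -EFinM.
move=> /(congr1 fine) E.
have {E} : \int[P x]_w (\1_B w * (1 + cos (dotv xi (X (s + h) w) + c))) =
  \int[P x]_w (\1_B w * (1 + expR (- (h * psi xi)) * cos (dotv xi (X s w) + c))) by exact: E.
under eq_Rintegral do rewrite mulrDr mulr1.
under [RHS]eq_Rintegral do rewrite mulrDr mulr1 mulrCA.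
rewrite RintegralD//; last by apply: (bmeas_int (P x)); apply: bc; exact: addr_ge0.
rewrite RintegralD//; last by apply: (bmeas_int (P x)); apply: bmeasM; [exact: bmeas_cst|exact: bc].
move=> /addrI ->; rewrite RintegralZl//.
by apply: (bmeas_int (P x)); exact: bc.
Qed.

(* The process [cos (xi . X_s + c) e^(-(t - s) psi)] is a martingale on [0, t]; stop it at [lifetime]. *)
Lemma stopped_cos x t xi c : 0 < t ->
  \int[P x]_w cos (dotv xi (X t w) + c) =
  \int[P x]_w (expR (- ((t - stop_time X D t w) * psi xi)) *
    cos (dotv xi (path_at X (stop_time X D t w, w)) + c)).
Proof.
move=> t0; pose g s w := expR (- ((t - s) * psi xi)) * cos (dotv xi (X s w) + c).
have psi0 : 0 <= psi xi by case: HX => Hnu _; exact: levy_exponent_ge0.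
have gE w : expR (- ((t - stop_time X D t w) * psi xi)) * cos (dotv xi (path_at X (stop_time X D t w, w)) + c) =
    g (stop_time X D t w) w.
  by have /andP[T0 _] := stop_time_itv w (ltW t0); rewrite path_atE.
under [RHS]eq_Rintegral do rewrite gE.
pose del N : R := t / N.+1%:R; have del0 N : 0 < del N by rewrite divr_gt0.
have delN N : N.+1%:R * del N = t by rewrite mulrC divfK.
have mX r : 0 <= r -> measurable_fun setT (fun w => dotv xi (X r w) + c).
  by move=> r0; apply: measurable_funD => //; apply: measurable_dotv; exact: (levy_measurable HX).
have bg s : 0 <= s -> bmeas (g s) by move=> s0; apply: bmeasM; [exact: bmeas_cst|apply: bmeas_cos; exact: mX].
have jd0 N j : 0 <= j%:R * del N by rewrite mulr_ge0// ltW.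
have mart s h (B : set O) : 0 <= s -> 0 <= h -> past X s B ->
    \int[P x]_w (\1_B w * g (s + h) w) = \int[P x]_w (\1_B w * g s w).
  move=> s0 h0 pB; have mB := past_measurable HX pB.
  have bc r : 0 <= r -> bmeas (fun w => \1_B w * cos (dotv xi (X r w) + c)).
    by move=> r0; apply: bmeasM; [exact: bmeas_indic|apply: bmeas_cos; exact: mX].
  under eq_Rintegral do rewrite mulrCA; under [RHS]eq_Rintegral do rewrite mulrCA.
  rewrite RintegralZl//; last by apply: (bmeas_int (P x)); apply: bc; exact: addr_ge0.
  rewrite RintegralZl//; last by apply: (bmeas_int (P x)); exact: bc.
  rewrite cos_martingale// mulrA -expRD; congr (expR _ * _); ring.
(* The martingale stopped on the grid: an increment counts when the path is alive at its left end,
   so the sum ends at the first grid time not before [lifetime], or at [t]. Each term has mean 0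
   since [alive] at the left end is an event of the past. *)
pose S N w := g 0 w + \sum_(j < N.+1) \1_(alive (j%:R * del N)) w * (g (j.+1%:R * del N) w - g (j%:R * del N) w).
have bterm N j : bmeas (fun w => \1_(alive (j%:R * del N)) w * (g (j.+1%:R * del N) w - g (j%:R * del N) w)).
  apply: bmeasM; first by apply: bmeas_indic; exact: (measurable_alive HX).
  apply: (@bmeasD _ _ _ _ (fun w => - g (j%:R * del N) w)); first exact: bg.
  have [mg [M gM]] := bg _ (jd0 N j); split; last by exists M => w; rewrite normrN.
  exact: measurableT_comp.
have bsum N n : bmeas (fun w => \sum_(j < n) \1_(alive (j%:R * del N)) w * (g (j.+1%:R * del N) w - g (j%:R * del N) w)).
  elim: n => [|n IH]; first by under eq_fun do rewrite big_ord0; exact: bmeas_cst.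
  by under eq_fun do rewrite big_ord_recr; exact: bmeasD.
have sum0 N n : \int[P x]_w (\sum_(j < n) \1_(alive (j%:R * del N)) w * (g (j.+1%:R * del N) w - g (j%:R * del N) w)) = 0.
  elim: n => [|n IH]; first by under eq_Rintegral do rewrite big_ord0; rewrite Rintegral_cst// mul0r.
  under eq_Rintegral do rewrite big_ord_recr.
  rewrite RintegralD//; [|exact: (bmeas_int (P x) (bsum N n))|exact: (bmeas_int (P x) (bterm N n))].
  have mal := measurable_alive HX D (jd0 N n).
  have bi : bmeas (\1_(alive (n%:R * del N)) : O -> R) := bmeas_indic mal.
  rewrite IH add0r; under eq_Rintegral do rewrite mulrBr.
  rewrite RintegralB//.
  - rewrite -natr1 mulrDl mul1r mart//; [by rewrite subrr|exact: ltW|exact: (past_alive HX)].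
  - by apply: (bmeas_int (P x)); apply: bmeasM => //; exact: bg.
  - by apply: (bmeas_int (P x)); apply: bmeasM => //; exact: bg.
have SI N : \int[P x]_w S N w = \int[P x]_w cos (dotv xi (X t w) + c).
  rewrite /S RintegralD//; [|exact: (bmeas_int (P x) (bg 0 (lexx 0)))|exact: (bmeas_int (P x) (bsum N N.+1))].
  rewrite sum0 addr0.
  have := mart 0 t setT (lexx 0) (ltW t0) (@past_setT R d dO O X 0).
  under eq_Rintegral do rewrite indicT mul1r add0r; under [RHS]eq_Rintegral do rewrite indicT mul1r.
  move=> <-; apply: eq_Rintegral => w _; by rewrite /g subrr mul0r oppr0 expR0 mul1r.
have SE N w : exists k : nat, [/\ (k <= N.+1)%N,
    stop_time X D t w <= k%:R * del N <= stop_time X D t w + del N & S N w = g (k%:R * del N) w].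
  have [|k [kN ak nak uk]] := @stopped_sum R (fun j => g (j%:R * del N) w)
      (fun j => w \in alive (j%:R * del N)) N.+1.
    move=> i j ij /set_mem h; apply/mem_set; apply: alive_le h.
    by rewrite ler_wpM2r ?ler_nat// ltW.
  have kt : k%:R * del N <= t by rewrite -[leRHS](delN N) ler_wpM2r ?ler_nat// ltW.
  have /andP[T0 Tt] := stop_time_itv w (ltW t0).
  exists k; split => //; last by rewrite -uk /S mul0r.
  apply/andP; split.
    have [->|kN'] := eqVneq k N.+1; first by rewrite delN.
    have /nak/negP nk : (k < N.+1)%N by rewrite ltn_neqAle kN' kN.
    have : ~ ((k%:R * del N)%:E < lifetime w)%E.
      by move=> /(lifetime_gt HX D w (jd0 N k)) h; apply: nk; exact/mem_set.
    move=> /negP; rewrite -leNgt => Tk.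
    have [h|h] := ltP (lifetime w) t%:E; first by rewrite -lee_fin stop_time_lt.
    by rewrite stop_time_ge// -lee_fin (le_trans h).
  case: k {kN nak uk} ak kt => [|k] ak kt; first by rewrite mul0r addr_ge0// ltW.
  have /set_mem/(lifetime_gt HX D w (jd0 N k)) Tk := ak k (leqnn _).
  rewrite -natr1 mulrDl mul1r lerD2r.
  have [h|h] := ltP (lifetime w) t%:E; first by rewrite -lee_fin stop_time_lt// ltW.
  rewrite stop_time_ge//; apply: le_trans kt; rewrite ler_wpM2r ?ler_nat// ltW//.
(* The grid stopping times approach [stop_time] from above, so the right continuity of the path is
   enough. *)
have cS w : S N w @[N --> \oo] --> g (stop_time X D t w) w.
  have /andP[T0 Tt] := stop_time_itv w (ltW t0); set T := stop_time X D t w in T0 Tt *.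
  have [k kP] := choice (fun N => SE N w).
  have kd : (k N)%:R * del N @[N --> \oo] --> T.
    apply/cvgrPdist_lt => e e0; have [K KP] := ex_inv_lt (divr_gt0 e0 t0); exists K => // N /= /KP KN.
    have [_ /andP[h1 h2] _] := kP N; rewrite ler0_norm ?subr_le0// opprB ltrBlDl.
    by apply: le_lt_trans h2 _; rewrite ltrD2l /del mulrC -ltr_pdivlMr.
  under eq_fun => N do (have [_ _ ->] := kP N).
  apply: cvgM.
    apply: (@continuous_cvg _ _ _ _ _ (fun N => - ((t - (k N)%:R * del N) * psi xi)) expR).
      exact: continuous_expR.
    by apply: cvgN; apply: cvgMr_tmp; apply: cvgB => //; exact: cvg_cst.
  apply: (@continuous_cvg _ _ _ _ _ (fun N => dotv xi (X ((k N)%:R * del N) w) + c) cos).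
    exact: continuous_cos.
  apply: cvgD; last exact: cvg_cst.
  apply: cvg_sum_seq => i; apply: cvgMl_tmp; apply/cvgrPdist_lt => e e0.
  have [eta eta0 hd] := levy_right_cont HX w T0 e0.
  have /cvgrPdist_lt/(_ _ eta0) := kd; apply: filterS => N h.
  have [_ /andP[h1 h2] _] := kP N; rewrite distrC; apply: hd; rewrite h1/=.
  by move: h; rewrite ler0_norm ?subr_le0// opprB ltrBlDl.
have := @bounded_cvg R dO O (P x) S (fun w => g (stop_time X D t w) w) 1 _ _ cS.
have -> : (fun N => \int[P x]_w S N w) = (fun=> \int[P x]_w cos (dotv xi (X t w) + c)) by apply/funext.
move=> h; rewrite -[LHS](lim_cst (@norm_hausdorff _ _) (F := \oo)); apply/cvg_lim; first exact: norm_hausdorff.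
apply: h.
- move=> N; apply: measurable_funD; [exact: (bg 0 (lexx 0)).1|exact: (bsum N N.+1).1].
- move=> N w; have [k [kN _ ->]] := SE N w; rewrite /g normrM -[leRHS]mulr1 ler_pM//.
    rewrite ger0_norm ?expR_ge0// -[leRHS]expR0 ler_expR oppr_le0 mulr_ge0// subr_ge0.
    by rewrite -[leRHS](delN N) ler_wpM2r ?ler_nat// ltW.
  by rewrite ler_norml cos_geN1 cos_le1.
Qed.

Lemma measurable_stopT t : measurable_fun setT (stop_time X D t).
Proof. exact: (measurableT_comp measurable_stop_time (measurable_pair1 t)). Qed.

Lemma measurable_post_stop t : measurable_fun setT (post_stop X D t).
Proof.
have m1 : measurable_fun setT (fun z : O * O => stop_time X D t z.1).
  exact: measurableT_comp (measurable_stopT t) measurable_fst.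
apply: measurable_vadd.
  by apply: (measurableT_comp (measurable_path_at HX)); apply: measurable_fun_pair.
apply: measurable_vsub.
  by apply: (measurableT_comp (measurable_path_at HX)); apply: measurable_fun_pair => //; exact: measurable_funB.
exact: measurableT_comp (levy_measurable HX (lexx 0)) measurable_snd.
Qed.

(** [stopped_cos] says that [X t] and [post_stop] have the same characteristic function. *)
Lemma stopped_law x t A : 0 < t -> measurable A ->
  (P x (X t @^-1` A) = \int[P x]_w P0 ((fun w' => post_stop X D t (w, w')) @^-1` A))%E.
Proof.
move=> t0 mA; have mZ := measurable_post_stop t.
have -> : P x (X t @^-1` A) = fprod (P x) P0 (post_stop X D t @^-1` A).
  apply: (cf_unique1 (levy_measurable HX (ltW t0)) mZ) => // xi c.
  rewrite stopped_cos// Rintegral_fprod; last first.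
    by apply: bmeas_cos; apply: measurable_funD => //; exact: measurable_dotv.
  apply: eq_Rintegral => w _; have /andP[T0 Tt] := stop_time_itv w (ltW t0).
  rewrite -(incr_cos HX vzero); last by rewrite subr_ge0.
  apply: eq_Rintegral => w' _; congr cos; rewrite /post_stop/= dotvDr !path_atE ?subr_ge0//.
  rewrite /incr; ring.
have mZA : measurable (post_stop X D t @^-1` A) by rewrite -[X in measurable X]setTI; exact: mZ.
transitivity (\int[fprod (P x) P0]_z (\1_(post_stop X D t @^-1` A) z)%:E)%E.
  by rewrite integral_indic// setIT.
rewrite ge0_integral_fprod//; last exact/measurable_EFinP.
apply: eq_integral => w _.
have mw : measurable ((fun w' => post_stop X D t (w, w')) @^-1` A).
  by rewrite -[X in measurable X]setTI; apply: (measurableT_comp mZ (measurable_pair1 w)).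
transitivity (\int[P0]_w' (\1_((fun w' => post_stop X D t (w, w')) @^-1` A) w')%:E)%E => //.
by rewrite integral_indic// setIT.
Qed.

End stopping.

Local Open Scope ereal_scope.

(** Stated for arbitrary [f] and [g], because integrands built on [exit_time] are not known to be
    measurable. The integral is a supremum over simple functions, and these can be set to 0 on the
    null set. *)
Lemma integral_le_off_null {R : realType} {d1} {T : measurableType d1} (m : {measure set T -> \bar R})
    (f g : T -> \bar R) N : measurable N -> m N = 0 -> (forall w, 0 <= f w) -> (forall w, 0 <= g w) ->
  (forall w, ~ N w -> f w <= g w) -> \int[m]_w f w <= \int[m]_w g w.
Proof.
move=> mN N0 f0 g0 fg; rewrite !ge0_integralTE//.
apply: ge_ereal_sup => _ [h hf <-].
have mC := measurableC mN.
have -> : sintegral m h = sintegral m (proj_nnsfun h mC).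
  rewrite -!integralT_nnsfun; apply: ge0_ae_eq_integral => //.
  - by apply/measurable_EFinP.
  - by apply/measurable_EFinP.
  - by move=> w _; rewrite lee_fin.
  - by move=> w _; rewrite lee_fin.
  exists N; split => // w /= H; apply: contrapT => nN; apply: H => _.
  by rewrite /proj_nnsfun/= mindicE mem_set//= mulr1.
apply: ereal_sup_ubound; exists (proj_nnsfun h mC) => // w.
rewrite /proj_nnsfun/= mindicE; have [/set_mem /= nN|_] := boolP (w \in ~` N); last by rewrite mulr0.
by rewrite mulr1 (le_trans (hf w))// fg.
Qed.

Lemma integral_eq_off_null {R : realType} {d1} {T : measurableType d1} (m : {measure set T -> \bar R})
    (f g : T -> \bar R) N : measurable N -> m N = 0 -> (forall w, 0 <= f w) -> (forall w, 0 <= g w) ->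
  (forall w, ~ N w -> f w = g w) -> \int[m]_w f w = \int[m]_w g w.
Proof.
move=> mN N0 f0 g0 fg; apply/eqP; rewrite eq_le; apply/andP; split.
  by apply: (integral_le_off_null mN N0) => // w /fg ->.
by apply: (integral_le_off_null mN N0) => // w /fg ->.
Qed.

Lemma integral_indicM {R : realType} {d1} {T : measurableType d1} (m : {measure set T -> \bar R})
    (f : T -> \bar R) A : measurable A -> \int[m]_x ((\1_A x)%:E * f x) = \int[m]_(x in A) f x.
Proof.
move=> mA; rewrite [RHS]integral_mkcond; apply: eq_integral => x _.
by rewrite patchE indicE; case: ifP => h; rewrite ?mul1e ?mul0e.
Qed.

(** On subsets of the set where [g < f] the two integrals are ordered both ways, so [f = g] almost
    everywhere there and that set is null. *)
Lemma ae_le_of_integral {R : realType} {d1} {T : measurableType d1} (m : {measure set T -> \bar R})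
    (f g : T -> \bar R) : nnmeas f -> nnmeas g -> \int[m]_x f x < +oo ->
  (forall A, measurable A -> \int[m]_x ((\1_A x)%:E * f x) <= \int[m]_x ((\1_A x)%:E * g x)) ->
  {ae m, forall x, f x <= g x}.
Proof.
move=> [mf f0] [mg g0] fin H.
pose A := [set x | g x < f x].
have mA : measurable A by rewrite -[A]setTI; exact: measurable_lte.
have iA : m.-integrable A f.
  apply/integrableP; split; first exact: measurable_funTS.
  under eq_integral do rewrite gee0_abs//.
  apply: le_lt_trans fin; exact: ge0_subset_integral.
have : ae_eq m A f g.
  apply: integral_ae_eq => //; first exact: measurable_funTS.
  move=> E EA mE; apply/eqP; rewrite eq_le; apply/andP; split.
    by rewrite -(integral_indicM m f mE) -(integral_indicM m g mE); exact: H.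
  by apply: ge0_le_integral => //; [exact: measurable_funTS|exact: measurable_funTS|move=> x /EA /ltW].
apply: filterS => x h; rewrite leNgt; apply/negP => gf.
by have := gf; rewrite (h gf) ltxx.
Qed.

(** * The killed density integrates to the survival probability *)

Section killed_density_definitions.
Context {R : realType} {d : nat} {dO : measure_display} {O : measurableType dO}.
Local Notation V := (d.-tuple R).
Variables (X : R -> O -> V) (p : R -> V -> R) (D : set V).

(* The density at [y] of [X_t] after the exit time [T < t], given the path [w] up to [T]. *)
Definition post_dens (z : (R * V) * O) : R :=
  let s := stop_time X D z.1.1 z.2 in dens p (z.1.1 - s, vsub z.1.2 (path_at X (s, z.2)))%R.

(** The weak inequality is the one that stopping at time [t] produces, the strict one of
    [survives_lt] corresponds to [alive]. For a given path they differ for at most one [t], hence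
    not after integration in time. *)
Definition survives (A : set V) (z : R * O) : bool :=
  (z.1%:E <= lifetime X D z.2) && (path_at X z \in A).

Definition survives_lt (A : set V) (z : R * O) : bool :=
  (z.1%:E < lifetime X D z.2) && (path_at X z \in A).

End killed_density_definitions.

Section killed_density.
Context {R : realType} {d : nat} {dO : measure_display} {O : measurableType dO}.
Local Notation V := (d.-tuple R).
Context {P : V -> probability O R} {X : R -> O -> V}.
Context {nu : {measure set V -> \bar R}} {p : R -> V -> R}.
Hypothesis HX : sym_levy_process P X nu p.
Variable D : set V.
Hypothesis oD : open_Rd D.
Variable x : V.
Hypothesis Dx : D x.
Local Notation P0 := (P vzero).
Local Notation incr := (incr X).
Local Notation lifetime := (lifetime X D).
Local Notation alive := (alive X D).
Local Notation killed := (killed P X D).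
Local Notation stop_time := (stop_time X D).

Local Notation post_densX := (post_dens X p D).

Lemma post_dens_ge0 z : (0 <= post_densX z)%R. Proof. exact: (dens_ge0 HX). Qed.

Lemma measurable_post_dens : measurable_fun setT post_densX.
Proof.
have m11 : measurable_fun setT (fun z : (R * V) * O => z.1.1) := measurableT_comp measurable_fst measurable_fst.
have m12 : measurable_fun setT (fun z : (R * V) * O => z.1.2) := measurableT_comp measurable_snd measurable_fst.
have m2 : measurable_fun setT (fun z : (R * V) * O => z.2) := measurable_snd.
have m1 : measurable_fun setT (fun z : (R * V) * O => stop_time z.1.1 z.2).
  exact: (measurableT_comp (measurable_stop_time HX D) (measurable_fun_pair m11 m2)).
apply: (measurableT_comp (measurable_dens HX)); apply: measurable_fun_pair.
  exact: measurable_funB.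
apply: measurable_vsub; first exact: m12.
exact: (measurableT_comp (measurable_path_at HX) (measurable_fun_pair m1 m2)).
Qed.

Let mEpd : measurable_fun setT (fun z : (R * V) * O => (post_densX z)%:E).
Proof. by apply/measurable_EFinP; exact: measurable_post_dens. Qed.

(** The expectation subtracted in [killed_density], with [lifetime] in place of the exit time. *)
Definition returned (z : R * V) : \bar R := \int[P x]_w (post_densX (z, w))%:E.

Lemma nnmeas_returned : nnmeas returned.
Proof.
split=> [|z]; last by apply: integral_ge0 => w _; rewrite lee_fin post_dens_ge0.
apply: (@measurable_fun_fubini_tonelli_F _ _ _ _ R (P x) (fun z : (R * V) * O => (post_densX z)%:E)) => //.
by move=> z; rewrite lee_fin post_dens_ge0.
Qed.

Lemma killed_densityE t y : (0 < t)%R ->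
  killed_density P X p D t x y = (p t (vsub y x))%:E - returned (t, y).
Proof.
move=> t0; congr (_ - _).
pose N := bad_set (X := X) D `|` ~` [set w | X 0%R w = x].
have mb := measurable_bad_set HX D; have ms := measurable_start HX x.
have mN : measurable N by apply: measurableU => //; exact: measurableC.
have N0 : P x N = 0.
  apply: null_set_setU => //; [exact: measurableC|exact: (bad_set_null HX)|].
  have E : P x (~` [set w | X 0%R w = x]) = 0 by rewrite probability_setC// (levy_start HX) subee.
  exact: E.
have exit_ge0 w : 0 <= exit_time X D w.
  by apply: le_ereal_inf_tmp => _ [s [s0 _] <-]; rewrite lee_fin ltW.
have exit_fin w : exit_time X D w < t%:E -> (fine (exit_time X D w))%:E = exit_time X D w.
  by move=> h; rewrite fineK// ge0_fin_numE// (lt_trans h (ltry _)).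
apply: (integral_eq_off_null mN N0) => [w|w|w nN].
- case: ifPn => // h; rewrite lee_fin (density_nonneg HX)// subr_gt0.
  by rewrite -lte_fin exit_fin.
- by rewrite lee_fin post_dens_ge0.
have [nb Xx] : ~ bad_set (X := X) D w /\ X 0%R w = x.
  by split=> [b|]; [apply: nN; left|apply: contrapT => nx; apply: nN; right].
have E : exit_time X D w = lifetime w by apply: (exit_lifetime HX oD) => //; rewrite Xx.
rewrite E /post_dens /=; case: ifPn => h.
  have sE := stop_time_lt h.
  have -> : fine (lifetime w) = stop_time t w by rewrite -sE.
  have st : (stop_time t w < t)%R by rewrite -lte_fin sE.
  have /andP[s0 _] := @stop_time_itv R d dO O X D t w (ltW t0).
  by rewrite /dens/= subr_gt0 st path_atE.
by rewrite /dens/= stop_time_ge ?subrr ?ltxx// leNgt.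
Qed.

Let mlife : measurable_fun setT (fun z : R * O => lifetime z.2).
Proof. exact: (measurableT_comp (measurable_lifetime HX D) measurable_snd). Qed.

Let mtime : measurable_fun setT (fun z : R * O => z.1%:E).
Proof. by apply/measurable_EFinP; exact: measurable_fst. Qed.

Lemma measurable_survives A : measurable A -> measurable [set z | survives X D A z].
Proof.
move=> mA; rewrite (_ : [set z | _] = [set z | z.1%:E <= lifetime z.2] `&` path_at X @^-1` A).
  apply: measurableI; first by rewrite -[X in measurable X]setTI; exact: measurable_lee.
  by rewrite -[X in measurable X]setTI; exact: (measurable_path_at HX).
by apply/seteqP; split=> z; rewrite /survives/=; [move=> /andP[-> /set_mem]|move=> [-> /mem_set ->]].
Qed.

Lemma measurable_survives_lt A : measurable A -> measurable [set z | survives_lt X D A z].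
Proof.
move=> mA; rewrite (_ : [set z | _] = [set z | z.1%:E < lifetime z.2] `&` path_at X @^-1` A).
  apply: measurableI; first by rewrite -[X in measurable X]setTI; exact: measurable_lte.
  by rewrite -[X in measurable X]setTI; exact: (measurable_path_at HX).
by apply/seteqP; split=> z; rewrite /survives_lt/=; [move=> /andP[-> /set_mem]|move=> [-> /mem_set ->]].
Qed.

(** Either the path is not stopped before [t], and the second path contributes nothing, or the
    remaining time is positive and the increment of the second path has a density. *)
Lemma post_stop_split t w A : (0 < t)%R -> measurable A ->
  P0 ((fun w' => post_stop X D t (w, w')) @^-1` A) =
  (survives X D A (t, w))%:R%:E + \int[lebT d]_y ((\1_A y)%:E * (post_densX ((t, y), w))%:E).
Proof.
move=> t0 mA; have /andP[s0 st] := @stop_time_itv R d dO O X D t w (ltW t0).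
have [Tt|tT] := ltP (lifetime w) t%:E; last first.
  have sE := stop_time_ge tT.
  rewrite [X in _ + X]integral0_eq ?adde0; last first.
    by move=> y _; rewrite /post_dens/= sE subrr /dens/= ltxx mule0.
  rewrite /survives/= tT/= path_atE ?ltW//.
  rewrite (_ : _ @^-1` A = if X t w \in A then setT else set0).
    by case: ifP => _; [exact: probability_setT|exact: measure0].
  apply/seteqP; split=> w' /=.
    by rewrite /post_stop/= sE !path_atE ?subrr// ?ltW// vsubxx vadd0 => /mem_set ->.
  by rewrite /post_stop/= sE !path_atE ?subrr// ?ltW// vsubxx vadd0; case: ifP => // /set_mem.
have sE := stop_time_lt Tt.
have s_lt : (0 < t - stop_time t w)%R by rewrite subr_gt0 -lte_fin sE.
rewrite /survives/= leNgt Tt/= add0e.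
set a := path_at X (stop_time t w, w).
have mva : measurable (vadd a @^-1` A).
  by rewrite -[X in measurable X]setTI; apply: (measurable_vadd (f := fun=> a) (g := id)).
have -> : (fun w' => post_stop X D t (w, w')) @^-1` A = incr (t - stop_time t w)%R @^-1` (vadd a @^-1` A).
  by apply/seteqP; split=> w'; rewrite /post_stop/= [path_at X (t - _, _)%R]path_atE// ltW.
rewrite (incr_density HX s_lt mva).
have mq : measurable_fun setT (fun y : V => (\1_A y)%:E * (p (t - stop_time t w)%R (vsub y a))%:E).
  apply: emeasurable_funM; first by apply/measurable_EFinP; exact: measurable_indic.
  apply/measurable_EFinP; apply: (measurableT_comp (density_measurable HX s_lt)).
  exact: measurable_vsub.
rewrite (_ : \int[lebT d]_y _ = \int[lebT d]_y ((\1_A y)%:E * (p (t - stop_time t w)%R (vsub y a))%:E)); last first.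
  apply: etrans (integral_lebT_shift a mq _) => [|y]; last first.
    by rewrite mule_ge0// lee_fin// (density_nonneg HX).
  apply: eq_integral => y _; rewrite [vadd y a]vaddC; congr (_ * (p _ _)%:E).
  by rewrite vsub_vadd.
apply: eq_integral => y _; congr (_ * _%:E).
by rewrite /post_dens/= /dens/= s_lt.
Qed.

Definition survival A (t : R) : \bar R := \int[P x]_w (survives X D A (t, w))%:R%:E.
Definition survival_lt A (t : R) : \bar R := \int[P x]_w (survives_lt X D A (t, w))%:R%:E.

Let bool_indic {T : Type} (b : T -> bool) z : (b z)%:R = \1_[set z | b z] z :> R.
Proof.
by rewrite indicE; congr ((nat_of_bool _)%:R)%R; apply/idP/idP => [h|/set_mem//]; exact/mem_set.
Qed.

Lemma nnmeas_survives A : measurable A -> nnmeas (fun z : R * O => (survives X D A z)%:R%:E : \bar R).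
Proof.
move=> mA; split=> [|z]; last by rewrite lee_fin.
under eq_fun do rewrite bool_indic.
by apply/measurable_EFinP; apply: measurable_indic; exact: measurable_survives.
Qed.

Lemma nnmeas_survives_lt A : measurable A -> nnmeas (fun z : R * O => (survives_lt X D A z)%:R%:E : \bar R).
Proof.
move=> mA; split=> [|z]; last by rewrite lee_fin.
under eq_fun do rewrite bool_indic.
by apply/measurable_EFinP; apply: measurable_indic; exact: measurable_survives_lt.
Qed.

Lemma nnmeas_survival A : measurable A -> nnmeas (survival A).
Proof.
move=> mA; have [m0 s0] := nnmeas_survives mA; split=> [|t]; last exact: integral_ge0.
exact: (@measurable_fun_fubini_tonelli_F _ _ _ _ R (P x) _ m0 s0).
Qed.

Lemma nnmeas_survival_lt A : measurable A -> nnmeas (survival_lt A).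
Proof.
move=> mA; have [m0 s0] := nnmeas_survives_lt mA; split=> [|t]; last exact: integral_ge0.
exact: (@measurable_fun_fubini_tonelli_F _ _ _ _ R (P x) _ m0 s0).
Qed.

Lemma survival_ltE A t : (0 <= t)%R -> measurable A -> survival_lt A t = killed t A x.
Proof.
move=> t0 mA; rewrite /survival_lt.
have mE : measurable (alive t `&` X t @^-1` A).
  by apply: measurableI; [exact: (measurable_alive HX)|exact: (measurable_levy_preimage HX)].
transitivity (\int[P x]_w (\1_(alive t `&` X t @^-1` A) w)%:E); last by rewrite integral_indic// setIT.
apply: eq_integral => w _; rewrite indicE /survives_lt/= path_atE//; congr ((nat_of_bool _)%:R)%:E.
apply/idP/idP => [/andP[h /set_mem h2]|/set_mem[h1 h2]].
  by apply/mem_set; split => //; apply/(lifetime_gt HX).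
by apply/andP; split; [exact/(lifetime_gt HX)|exact/mem_set].
Qed.

Lemma survival_split A t : (0 < t)%R -> measurable A ->
  P x (X t @^-1` A) = survival A t + \int[lebT d]_y ((\1_A y)%:E * returned (t, y)).
Proof.
move=> t0 mA; rewrite (stopped_law HX D x t0 mA).
under eq_integral do rewrite post_stop_split//.
have mi : measurable_fun setT (fun y : V => (\1_A y)%:E : \bar R) by apply/measurable_EFinP.
pose F (z : O * V) : \bar R := (\1_A z.2)%:E * (post_densX ((t, z.2), z.1))%:E.
have mF : measurable_fun setT F.
  apply: emeasurable_funM; first exact: (measurableT_comp mi measurable_snd).
  have m1 : measurable_fun setT (fun z : O * V => ((t, z.2), z.1)).
    exact: (measurable_fun_pair (measurable_fun_pair (measurable_cst t) measurable_snd) measurable_fst).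
  exact: (measurableT_comp mEpd m1).
have F0 z : 0 <= F z by rewrite /F mule_ge0// lee_fin// post_dens_ge0.
have [ms s0] := nnmeas_survives mA.
rewrite ge0_integralD//; first last.
- exact: (@measurable_fun_fubini_tonelli_F _ _ _ _ R (lebT d) F).
- by move=> w _; apply: integral_ge0 => y _; exact: (F0 (w, y)).
- exact: (measurableT_comp ms (measurable_pair1 t)).
congr (_ + _).
rewrite -(@ge0_integral_sprod1 _ _ _ _ _ (P x) (lebT d) F mF F0).
rewrite (@ge0_integral_sprod2 _ _ _ _ _ (P x) (lebT d) F mF F0).
apply: eq_integral => y _; rewrite /F/= ge0_integralZl//.
- exact: (measurableT_comp mEpd (measurable_pair1 (t, y))).
- by move=> w _; rewrite lee_fin post_dens_ge0.
Qed.

Lemma levy_density A t : (0 < t)%R -> measurable A ->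
  P x (X t @^-1` A) = \int[lebT d]_y ((\1_A y)%:E * (p t (vsub y x))%:E).
Proof.
move=> t0 mA; have mi := measurable_incr HX (ltW t0).
have nA : nnmeas (fun y : V => (\1_A y)%:E : \bar R) by exact: nnmeas_indic.
have := markov_indic HX x (lexx 0%R) (ltW t0) (@past_setT R d dO O X 0%R) nA.
under eq_integral do rewrite indicT mul1e add0r.
under [RHS]eq_integral do rewrite indicT mul1e.
rewrite (integral_start HX); last exact: (nnmeas_trans HX (ltW t0)).
have mXA : measurable (X t @^-1` A) by apply: (measurable_levy_preimage HX) => //; exact: ltW.
have -> : \int[P x]_w (\1_A (X t w))%:E = P x (X t @^-1` A).
  transitivity (\int[P x]_w (\1_(X t @^-1` A) w)%:E) => //.
  by rewrite integral_indic// setIT.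
move=> ->.
have mva : measurable (vadd x @^-1` A).
  by rewrite -[X in measurable X]setTI; apply: (measurable_vadd (f := fun=> x) (g := id)).
have mxA : measurable (incr t @^-1` (vadd x @^-1` A)) by rewrite -[X in measurable X]setTI; exact: mi.
transitivity (P0 (incr t @^-1` (vadd x @^-1` A))).
  transitivity (\int[P0]_w (\1_(incr t @^-1` (vadd x @^-1` A)) w)%:E) => //.
  by rewrite integral_indic// setIT.
rewrite (incr_density HX t0 mva).
have mq : measurable_fun setT (fun y : V => (\1_A y)%:E * (p t (vsub y x))%:E).
  apply: emeasurable_funM; first by apply/measurable_EFinP; exact: measurable_indic.
  apply/measurable_EFinP; apply: (measurableT_comp (density_measurable HX t0)).
  exact: measurable_vsub.
apply: etrans (integral_lebT_shift x mq _) => [|y]; last first.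
  by rewrite mule_ge0// lee_fin// (density_nonneg HX).
by apply: eq_integral => y _; rewrite [vadd y x]vaddC vsub_vadd.
Qed.

Definition free (p : R -> V -> R) (x : V) (z : R * V) : \bar R := (dens p (z.1, vsub z.2 x))%:E.
Local Notation u := (free p x).

Lemma nnmeas_free : nnmeas u.
Proof.
split=> [|z]; last by rewrite lee_fin (dens_ge0 HX).
have m2 : measurable_fun setT (fun z : R * V => vsub z.2 x).
  by apply: measurable_vsub; [exact: measurable_snd|exact: measurable_cst].
apply/measurable_EFinP.
exact: (measurableT_comp (measurable_dens HX) (measurable_fun_pair measurable_fst m2)).
Qed.

Let nn_sec {dU} {U : measurableType dU} (f : R * U -> \bar R) t : nnmeas f -> nnmeas (fun y => f (t, y)).
Proof. by move=> [mf f0]; split=> //; exact: (measurableT_comp mf (measurable_pair1 t)). Qed.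

Let nn_indic A (f : V -> \bar R) : measurable A -> nnmeas f -> nnmeas (fun y => (\1_A y)%:E * f y).
Proof. by move=> mA nf; apply: nnmeasM => //; exact: nnmeas_indic. Qed.

Lemma free_int A t : (0 < t)%R -> measurable A ->
  \int[lebT d]_y ((\1_A y)%:E * u (t, y)) = survival A t + \int[lebT d]_y ((\1_A y)%:E * returned (t, y)).
Proof.
move=> t0 mA; rewrite -survival_split// levy_density//.
by apply: eq_integral => y _; rewrite /free/dens/= t0.
Qed.

Lemma returned_int_fin A t : (0 < t)%R -> measurable A ->
  \int[lebT d]_y ((\1_A y)%:E * returned (t, y)) < +oo.
Proof.
move=> t0 mA; apply: (@le_lt_trans _ _ (P x (X t @^-1` A))); last first.
  by rewrite (le_lt_trans (probability_le1 _ _)) ?ltry//; exact: (measurable_levy_preimage HX) (ltW t0) mA.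
by rewrite survival_split// leeDr// (nnmeas_survival mA).2.
Qed.

(** Only integrals over sets are compared, where the difference is [survival A t >= 0]; hence the
    restriction to almost every [y]. *)
Lemma returned_le t : (0 < t)%R -> {ae lebT d, forall y, returned (t, y) <= u (t, y)}.
Proof.
move=> t0; apply: ae_le_of_integral; [exact: nn_sec nnmeas_returned|exact: nn_sec nnmeas_free| |].
  apply: le_lt_trans (returned_int_fin t0 measurableT); rewrite le_eqVlt; apply/orP; left; apply/eqP.
  by apply: eq_integral => y _; rewrite indicE in_setT mul1e.
by move=> A mA; rewrite free_int// leeDr// (nnmeas_survival mA).2.
Qed.

(** The extended difference in [killed_density] is known to be nonnegative only for almost every
    [y]; its positive part is nonnegative everywhere, as Tonelli in [(t, y)] demands. *)
Definition kernel_pos (z : R * V) : \bar R := maxe (u z - returned z) 0.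

Lemma nnmeas_kernel_pos : nnmeas kernel_pos.
Proof.
split=> [|z]; last by rewrite le_max lexx orbT.
apply: measurable_maxe => //; apply: emeasurable_funB; first exact: nnmeas_free.1.
exact: nnmeas_returned.1.
Qed.

Lemma kernel_pos_int A t : (0 < t)%R -> measurable A ->
  \int[lebT d]_y ((\1_A y)%:E * kernel_pos (t, y)) = survival A t.
Proof.
move=> t0 mA; have := free_int t0 mA.
have nk := nn_indic mA (nn_sec t nnmeas_kernel_pos).
have nr := nn_indic mA (nn_sec t nnmeas_returned).
have nu' := nn_indic mA (nn_sec t nnmeas_free).
have -> : \int[lebT d]_y ((\1_A y)%:E * u (t, y)) =
    \int[lebT d]_y ((\1_A y)%:E * kernel_pos (t, y) + (\1_A y)%:E * returned (t, y)).
  apply: ge0_ae_eq_integral => //; [exact: nu'.1|by apply: emeasurable_funD; [exact: nk.1|exact: nr.1]| | |].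
  - by move=> y _; exact: nu'.2.
  - by move=> y _; rewrite adde_ge0//; [exact: nk.2|exact: nr.2].
  apply: filterS (returned_le t0) => y h _.
  have fr : returned (t, y) \is a fin_num.
    rewrite ge0_fin_numE; last exact: nnmeas_returned.2.
    exact: le_lt_trans h (ltry _).
  rewrite -ge0_muleDr; [|exact: nnmeas_kernel_pos.2|exact: nnmeas_returned.2]; congr (_ * _).
  by rewrite /kernel_pos max_l ?sube_ge0 ?fr ?orbT// subeK.
rewrite ge0_integralD//; [|by move=> y _; exact: nk.2|exact: nk.1|by move=> y _; exact: nr.2|exact: nr.1].
have fr : \int[lebT d]_y ((\1_A y)%:E * returned (t, y)) \is a fin_num.
  rewrite ge0_fin_numE ?returned_int_fin//; apply: integral_ge0 => y _; exact: nr.2.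
by move/(congr1 (fun z => z - \int[lebT d]_y ((\1_A y)%:E * returned (t, y)))); rewrite !addeK.
Qed.

Definition times : set R := [set` `]0%R, +oo[].

Lemma timesE t : times t = (0 < t)%R :> Prop.
Proof. by rewrite /times/= in_itv/= andbT. Qed.

Lemma measurable_times : measurable times.
Proof. exact: measurable_itv. Qed.

Definition green_pos y : \bar R := \int[@lebesgue_measure R]_(t in times) kernel_pos (t, y).

Let kk (z : R * V) : \bar R := (\1_times z.1)%:E * kernel_pos z.

Let nkk : nnmeas kk.
Proof.
apply: nnmeasM; last exact: nnmeas_kernel_pos.
split=> [|z]; last by rewrite lee_fin.
apply/measurable_EFinP; exact: (measurableT_comp (@measurable_indic _ _ R setT _ measurable_times) measurable_fst).
Qed.

Lemma green_posE y : green_pos y = \int[@lebesgue_measure R]_t kk (t, y).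
Proof. exact: (esym (integral_indicM (@lebesgue_measure R) (fun t => kernel_pos (t, y)) measurable_times)). Qed.

Lemma nnmeas_green_pos : nnmeas green_pos.
Proof.
split=> [|y]; last by apply: integral_ge0 => t _; exact: nnmeas_kernel_pos.2.
rewrite (_ : green_pos = fun y => \int[@lebesgue_measure R]_t kk (t, y)).
  exact: (@measurable_fun_fubini_tonelli_G _ _ _ _ R (@lebesgue_measure R) kk nkk.1 nkk.2).
by apply/funext => y; exact: green_posE.
Qed.

Lemma green_pos_survival A : measurable A ->
  \int[lebT d]_y ((\1_A y)%:E * green_pos y) = \int[@lebesgue_measure R]_(t in times) survival A t.
Proof.
move=> mA; pose F (z : R * V) := (\1_A z.2)%:E * kk z.
have nF : nnmeas F.
  apply: nnmeasM; last exact: nkk.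
  split=> [|z]; last by rewrite lee_fin.
  by apply/measurable_EFinP; exact: (measurableT_comp (@measurable_indic _ _ R setT _ mA) measurable_snd).
have h1 := @ge0_integral_sprod1 _ _ _ _ _ (@lebesgue_measure R) (lebT d) F nF.1 nF.2.
have h2 := @ge0_integral_sprod2 _ _ _ _ _ (@lebesgue_measure R) (lebT d) F nF.1 nF.2.
transitivity (\int[lebT d]_y \int[@lebesgue_measure R]_t F (t, y)).
  apply: eq_integral => y _; rewrite green_posE /F/= ge0_integralZl//.
  - exact: (measurableT_comp nkk.1 (measurable_pair2 y)).
  - by move=> t _; exact: nkk.2.
rewrite -h2 h1 -(integral_indicM (@lebesgue_measure R) (survival A) measurable_times).
apply: eq_integral => t _; rewrite /F/= [\1_times t]indicE.
have [/set_mem|/negP nt] := boolP (t \in times).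
  rewrite timesE => t0; rewrite mul1e -kernel_pos_int//; apply: eq_integral => y _.
  by rewrite /kk/= [\1_times t]indicE mem_set ?timesE// mul1e.
rewrite mul0e integral0_eq// => y _; rewrite /kk/= [\1_times t]indicE memNset ?mul0e ?mule0// => ht.
by apply: nt; exact/mem_set.
Qed.

Lemma survival_times A : measurable A ->
  \int[@lebesgue_measure R]_(t in times) survival A t = \int[@lebesgue_measure R]_(t in times) killed t A x.
Proof.
move=> mA; have mT := measurable_times.
transitivity (\int[@lebesgue_measure R]_(t in times) survival_lt A t); last first.
  apply: eq_integral => t /set_mem; rewrite timesE => /ltW t0; exact: survival_ltE.
rewrite -(integral_indicM (@lebesgue_measure R) (survival A) mT).
rewrite -(integral_indicM (@lebesgue_measure R) (survival_lt A) mT).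
have n1 := nnmeas_survives mA; have n2 := nnmeas_survives_lt mA.
have nt : nnmeas (fun z : R * O => (\1_times z.1)%:E : \bar R).
  split=> [|z]; last by rewrite lee_fin.
  by apply/measurable_EFinP; exact: (measurableT_comp (@measurable_indic _ _ R setT _ mT) measurable_fst).
have I (f : R * O -> \bar R) : nnmeas f ->
    \int[@lebesgue_measure R]_t ((\1_times t)%:E * \int[P x]_w f (t, w)) =
    \int[P x]_w \int[@lebesgue_measure R]_t ((\1_times t)%:E * f (t, w)).
  move=> nf; pose F (z : R * O) := (\1_times z.1)%:E * f z.
  have nF : nnmeas F by exact: nnmeasM.
  rewrite -(@ge0_integral_sprod2 _ _ _ _ _ (@lebesgue_measure R) (P x) F nF.1 nF.2).
  rewrite (@ge0_integral_sprod1 _ _ _ _ _ (@lebesgue_measure R) (P x) F nF.1 nF.2).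
  apply: eq_integral => t _; rewrite /F/= ge0_integralZl//.
  - exact: (measurableT_comp nf.1 (measurable_pair1 t)).
  - by move=> w _; exact: nf.2.
rewrite (I _ n1) (I _ n2); apply: eq_integral => w _.
(* For a fixed path the two integrands can differ only at the time [lifetime w], a Lebesgue null
   set. *)
apply: (@integral_eq_off_null R _ _ (@lebesgue_measure R) _ _ [set fine (lifetime w)]).
- exact: measurable_set1.
- exact: lebesgue_measure_set1.
- by move=> t; rewrite mule_ge0// lee_fin.
- by move=> t; rewrite mule_ge0// lee_fin.
move=> t nt'; congr (_ * (nat_of_bool (_ && _))%:R%:E); rewrite /= le_eqVlt.
case: eqP => //= E; exfalso; apply: nt'.
by rewrite /= -E.
Qed.

(** For each [t], the points [y] where the difference is negative form a null set; by Tonelli, for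
    almost every [y] the exceptional times form a null set, and they do not affect the time
    integral. *)
Lemma ae_green : {ae lebT d, forall y, green P X p D x y = green_pos y}.
Proof.
have mT := measurable_times.
pose B : set (R * V) := [set z | times z.1 /\ u z < returned z].
have mB : measurable B.
  rewrite (_ : B = (times `*` setT) `&` [set z | u z < returned z]).
    apply: measurableI; first exact: measurableX.
    by rewrite -[X in measurable X]setTI; apply: measurable_lte => //; [exact: nnmeas_free.1|exact: nnmeas_returned.1].
  by apply/seteqP; split=> z /= [h1 h2]; split => //; case: h1.
pose G (z : R * V) : \bar R := (\1_B z)%:E.
have nG : nnmeas G by exact: nnmeas_indic.
have : \int[lebT d]_y \int[@lebesgue_measure R]_t G (t, y) = 0.
  rewrite -(@ge0_integral_sprod2 _ _ _ _ _ (@lebesgue_measure R) (lebT d) G nG.1 nG.2).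
  rewrite (@ge0_integral_sprod1 _ _ _ _ _ (@lebesgue_measure R) (lebT d) G nG.1 nG.2).
  apply: integral0_eq => t _; have [t0|t0] := pselect (times t); last first.
    by apply: integral0_eq => y _; rewrite /G indicE memNset// => -[].
  transitivity (\int[lebT d]_y (0 : \bar R)); last exact: integral0.
  have t0' : (0 < t)%R by rewrite timesE in t0.
  apply: ge0_ae_eq_integral => //.
  - exact: (nn_sec t nG).1.
  - by move=> y _; exact: nG.2.
  apply: filterS (returned_le t0') => y h _.
  by rewrite /G indicE memNset//= => -[_]; rewrite ltNge h.
have mI : measurable_fun setT (fun y => \int[@lebesgue_measure R]_t G (t, y)).
  exact: (@measurable_fun_fubini_tonelli_G _ _ _ _ R (@lebesgue_measure R) G nG.1 nG.2).
have I0 y : 0 <= \int[@lebesgue_measure R]_t G (t, y) by apply: integral_ge0 => t _; exact: nG.2.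
move=> E0.
have : ae_eq (lebT d) setT (fun y => \int[@lebesgue_measure R]_t G (t, y)) (cst 0).
  apply/(ae_eq_integral_abs _ measurableT mI); rewrite -[RHS]E0.
  by apply: eq_integral => y _; rewrite gee0_abs.
apply: filterS => y /(_ Logic.I) /= hy.
have mGy : measurable_fun setT (fun t => G (t, y)) by exact: (measurableT_comp nG.1 (measurable_pair2 y)).
have aeG : ae_eq (@lebesgue_measure R) setT (fun t => G (t, y)) (cst 0).
  apply/(ae_eq_integral_abs (@lebesgue_measure R) measurableT mGy); rewrite -[RHS]hy.
  by apply: eq_integral => t _; rewrite gee0_abs//; exact: nG.2.
rewrite /green /green_pos.
transitivity (\int[@lebesgue_measure R]_(t in times) (u (t, y) - returned (t, y))).
  apply: eq_integral => t /set_mem; rewrite /= in_itv/= andbT => t0.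
  by rewrite killed_densityE// /free/dens/= t0.
apply: ae_eq_integral => //.
- apply: measurable_funTS; apply: emeasurable_funB.
    exact: (measurableT_comp nnmeas_free.1 (measurable_pair2 y)).
  exact: (measurableT_comp nnmeas_returned.1 (measurable_pair2 y)).
- by apply: measurable_funTS; exact: (measurableT_comp nnmeas_kernel_pos.1 (measurable_pair2 y)).
apply: filterS aeG => t /(_ Logic.I) /= h tt; rewrite /kernel_pos max_l//.
have [le|lt] := leP (returned (t, y)) (u (t, y)); first by rewrite sube_ge0// orbC.
move: h; rewrite /G indicE mem_set//= => -[] /eqP; by rewrite oner_eq0.
Qed.

Lemma measurable_killed_time A : measurable A -> measurable_fun times (fun t => killed t A x).
Proof.
move=> mA; apply: (eq_measurable_fun (survival_lt A)) => [t /set_mem|].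
  by rewrite timesE => /ltW t0; exact: survival_ltE.
by apply: measurable_funTS; exact: (nnmeas_survival_lt mA).1.
Qed.

(** All later uses of [green] go through this measurable representative, whose integrals over sets
    are occupation times. *)
Lemma green_spec : exists gr : V -> \bar R, [/\ nnmeas gr,
  {ae lebT d, forall y, green P X p D x y = gr y} &
  forall A, measurable A ->
    \int[lebT d]_y ((\1_A y)%:E * gr y) = \int[@lebesgue_measure R]_(t in times) killed t A x].
Proof.
exists green_pos; split; [exact: nnmeas_green_pos|exact: ae_green|].
by move=> A mA; rewrite green_pos_survival// survival_times.
Qed.

End killed_density.

(** * Green functions *)

Section green_definitions.
Context {R : realType} {d : nat} {dO : measure_display} {O : measurableType dO}.
Local Notation V := (d.-tuple R).
Variables (P : V -> probability O R) (X : R -> O -> V) (D : set V).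

Definition alive_one y : \bar R := killed P X D 1%R setT y.

Definition alive_mass (A : set V) : \bar R := \int[lebT d]_y ((\1_A y)%:E * alive_one y).

Definition occupation (A : set V) x : \bar R :=
  \int[@lebesgue_measure R]_(t in @times R) killed P X D t A x.

Definition early (a : R) : set R := [set` `]0%R, a[].
Definition late (a : R) : set R := [set` `[a, +oo[].

End green_definitions.

Section green_estimates.
Context {R : realType} {d : nat} {dO : measure_display} {O : measurableType dO}.
Local Notation V := (d.-tuple R).
Context {P : V -> probability O R} {X : R -> O -> V}.
Context {nu : {measure set V -> \bar R}} {p : R -> V -> R}.
Hypothesis HX : sym_levy_process P X nu p.
Variable D : set V.
Hypothesis oD : open_Rd D.
Hypothesis bD : bounded_Rd D.
Local Notation killed := (killed P X D).
Local Notation alive := (alive X D).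
Local Notation leb := (@lebesgue_measure R).

Local Notation alive_oneX := (alive_one P X D).

Local Notation alive_massX := (alive_mass P X D).

Lemma nnmeas_alive_one : nnmeas alive_oneX.
Proof. exact: (nnmeas_killed HX D ler01 measurableT). Qed.

Lemma alive_one_le1 y : alive_oneX y <= 1.
Proof. exact: (killed_le1 HX). Qed.

Lemma alive_one_out y : ~ D y -> alive_oneX y = 0.
Proof.
move=> nD; apply/eqP; rewrite eq_le (nnmeas_alive_one).2 andbT.
have ms := measurable_start HX y.
have E : P y (~` [set w | X 0%R w = y]) = 0 by rewrite probability_setC// (levy_start HX) subee.
rewrite -[leRHS]E; apply: le_measure; rewrite ?inE.
- by apply: measurableI; [exact: (measurable_alive HX)|exact: (measurable_levy_preimage HX)].
- exact: measurableC.
by move=> w [al _] /= Xy; apply: nD; rewrite -Xy; apply: alive_in al; rewrite lexx ler01.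
Qed.

(** A path from [D] that survives up to time 1 has exit time at least 1. *)
Lemma alive_one_le_exit x : alive_oneX x <= expected_exit P X D x.
Proof.
have mal := measurable_alive HX D (ler01 : (0 <= 1 :> R)%R).
have -> : alive_oneX x = \int[P x]_w (\1_(alive 1%R) w)%:E.
  have -> : alive_oneX x = P x (alive 1%R) by rewrite -[alive 1%R in RHS]setIT.
  by rewrite integral_indic// setIT.
have exit_ge0 w : 0 <= exit_time X D w.
  by apply: le_ereal_inf_tmp => _ [s [s0 _] <-]; rewrite lee_fin ltW.
apply: (integral_le_off_null measurable0) => // w _.
rewrite indicE; have [/set_mem al|_] := boolP (w \in alive 1%R); last exact: exit_ge0.
apply: (@le_trans _ _ (lifetime X D w)).
  by apply: ltW; apply/(lifetime_gt HX).
by apply: lifetime_le_exit; apply: alive_in al; rewrite lexx ler01.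
Qed.

Lemma nnmeas_alive_indic A : measurable A -> nnmeas (fun y => (\1_A y)%:E * alive_oneX y).
Proof. by move=> mA; apply: nnmeasM; [exact: nnmeas_indic|exact: nnmeas_alive_one]. Qed.

Lemma alive_mass_ge0 A : measurable A -> 0 <= alive_massX A.
Proof. by move=> mA; apply: integral_ge0 => y _; exact: (nnmeas_alive_indic mA).2. Qed.

Lemma alive_mass_fin A : measurable A -> alive_massX A < +oo.
Proof.
move=> mA; have [L L0 DL] := bounded_sub_box bD; have mb := @measurable_box R d vzero L.
apply: (@le_lt_trans _ _ (\int[lebT d]_y (\1_(box vzero L) y)%:E)).
  apply: ge0_le_integral => //.
  - by move=> y _; exact: (nnmeas_alive_indic mA).2.
  - exact: (nnmeas_alive_indic mA).1.
  - by apply/measurable_EFinP; exact: measurable_indic.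
  move=> y _; have [Dy|nD] := pselect (D y); last first.
    by rewrite alive_one_out// mule0 lee_fin.
  rewrite [\1_(box _ _) y]indicE mem_set//=; last exact: DL.
  rewrite -[leRHS]mule1; apply: lee_pmul.
  - by rewrite lee_fin.
  - exact: nnmeas_alive_one.2.
  - by rewrite lee_fin indicE lern1 leq_b1.
  - exact: alive_one_le1.
by rewrite integral_indic// setIT [X in X < _]lebT_box ?ltW// ltry.
Qed.

Lemma lateP (a t : R) : late a t <-> (a <= t)%R.
Proof. by rewrite /late/= in_itv/= andbT. Qed.

Lemma tail_bound : exists s0 q K : R, [/\ (0 < s0)%R, (0 <= q < 1)%R, (0 <= K)%R &
  forall n0 x A, measurable A ->
    \int[leb]_(t in late (3 + n0%:R * s0)) killed t A x <= (K * q ^+ n0)%:E * (alive_oneX x * alive_massX A)].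
Proof.
have [s0 [q [s00 q01 dec]]] := killed_decay HX bD.
have [M M0 MP] := killed_two_bound HX bD.
have /andP[q0 q1] := q01.
(* [M] is the bound of [killed_two_bound]; [s0 / (1 - q)] is the geometric sum over time slices of
   length [s0]. *)
exists s0, q, (M * s0 / (1 - q))%R; split => //.
  by rewrite divr_ge0 ?mulr_ge0// ?subr_ge0// ltW.
move=> n0 x A mA; set E := alive_oneX x * alive_massX A.
have E0 : 0 <= E by rewrite mule_ge0// ?alive_mass_ge0//; exact: nnmeas_alive_one.2.
have Efin : E \is a fin_num.
  apply: fin_numM; last by rewrite ge0_fin_numE ?alive_mass_ge0 ?alive_mass_fin.
  by rewrite ge0_fin_numE ?(le_lt_trans (alive_one_le1 x)) ?ltry//; exact: nnmeas_alive_one.2.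
have step (n : nat) (t : R) : (3 + n%:R * s0 <= t)%R -> killed t A x <= (M * q ^+ n)%:E * E.
  move=> nt; have t3 : (0 <= t - 3)%R by have : (0 <= n%:R * s0)%R; [by rewrite mulr_ge0// ltW|lra].
  (* The first unit of time yields [alive_one] at [x], the last two yield [alive_mass A] with the
     constant [M], and the time [t - 3] in between yields the decay. *)
  have -> : t = (1 + ((t - 3) + (1 + 1)))%R by ring.
  have mm := alive_mass_ge0 mA.
  have two y : killed (t - 3 + (1 + 1))%R A y <= (q ^+ n * M)%:E * alive_massX A.
    have h := @killed_add_le _ _ _ _ _ _ _ _ HX D (t - 3)%R (1 + 1)%R A y (M%:E * alive_massX A) t3.
    apply: le_trans (h _ mA _) _ => // [z|]; first exact: MP.
    rewrite EFinM -muleA lee_wpmul2r// ?mule_ge0//.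
    by apply: dec; lra.
  have h := @killed_add_le _ _ _ _ _ _ _ _ HX D 1%R (t - 3 + (1 + 1))%R A x _ ler01 _ mA two.
  apply: le_trans (h _) _; first by rewrite addr_ge0.
  by rewrite muleCA [(M * _)%R]mulrC.
(* Time slices of length [s0], on each of which the bound is a constant [c n]. *)
pose J n : set R := [set` `[3 + (n0 + n)%:R * s0, 3 + (n0 + n.+1)%:R * s0[%R].
have mJ n : measurable (J n) by exact: measurable_itv.
pose c n : R := (M * q ^+ (n0 + n) * fine E)%R.
have c0 n : (0 <= c n)%R by rewrite !mulr_ge0// ?exprn_ge0// fine_ge0.
pose f n (t : R) : \bar R := (c n * \1_(J n) t)%:E.
have f0 n t : 0 <= f n t by rewrite lee_fin mulr_ge0.
have mf n : measurable_fun setT (f n).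
  by apply/measurable_EFinP; apply: measurable_funM => //; exact: measurable_indic.
have late_times : late (3 + n0%:R * s0) `<=` times.
  move=> t; rewrite /late/times/= !in_itv/= !andbT => h; apply: lt_le_trans h.
  by rewrite ltr_wpDr// mulr_ge0// ltW.
apply: (@le_trans _ _ (\int[leb]_(t in late (3 + n0%:R * s0)) \sum_(n <oo) f n t)).
  apply: ge0_le_integral.
  - exact: measurable_itv.
  - by move=> t _; exact: measure_ge0.
  - exact: (measurable_funS (@measurable_times R) late_times (measurable_killed_time HX D x mA)).
  - apply: measurable_funTS; apply: ge0_emeasurable_sum => // n _; exact: mf.
  - move=> t /lateP ht.
    pose n := Num.truncn ((t - 3) / s0)%R.
    have t3 : (0 <= (t - 3) / s0)%R.
      by rewrite divr_ge0 ?(ltW s00)// subr_ge0; apply: le_trans ht; rewrite lerDl mulr_ge0// ltW.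
    have /andP[n1 n2] := truncn_itv t3; rewrite -/n in n1 n2.
    have nn0 : (n0 <= n)%N.
      by rewrite truncn_ge_nat// ler_pdivlMr//; lra.
    have tJ : J (n - n0)%N t.
      rewrite /J/= in_itv/= addnS subnKC//; move: n1 n2; rewrite ler_pdivlMr// ltr_pdivrMr// => n1 n2.
      by apply/andP; split; lra.
    apply: (@le_trans _ _ (f (n - n0)%N t)).
      rewrite /f indicE mem_set// mulr1 /c subnKC// EFinM fineK//.
      by apply: step; move: n1; rewrite ler_pdivlMr//; lra.
    have := @nneseries_lim_ge R (f ^~ t) xpredT 0%N (n - n0).+1 (fun k _ _ => f0 k t).
    by apply: le_trans; rewrite big_nat_recr//= leeDr// sume_ge0.
apply: (@le_trans _ _ (\int[leb]_t \sum_(n <oo) f n t)).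
  apply: ge0_subset_integral => //; first exact: measurable_itv.
  - by apply: ge0_emeasurable_sum => // n _; exact: mf.
  - by move=> t _; apply: nneseries_ge0 => n _ _; exact: f0.
rewrite (integral_nneseries leb measurableT mf)//.
have fI n : \int[leb]_t f n t = (M * s0 * q ^+ n0 * fine E * q ^+ n)%:E.
  rewrite /f; under eq_integral do rewrite EFinM.
  have mi : measurable_fun setT (fun t : R => (\1_(J n) t)%:E : \bar R).
    by apply/measurable_EFinP; exact: measurable_indic.
  rewrite (ge0_integralZl leb measurableT mi)//; last by rewrite lee_fin c0.
  have -> : \int[leb]_t (\1_(J n) t)%:E = s0%:E.
    rewrite (integral_indic leb measurableT (mJ n)).
    have -> : J n `&` setT = J n by rewrite setIT.
    rewrite [LHS]lebesgue_measure_itv/= lte_fin.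
    by rewrite addnS ltrD2l ltr_pM2r// ltr_nat ltnS leqnn -EFinD; congr EFin; rewrite -natr1; ring.
  by rewrite -EFinM; congr EFin; rewrite /c exprD; ring.
under eq_eseriesr do rewrite fI.
rewrite (@nneseries_cvg _ _ (M * s0 * q ^+ n0 * fine E / (1 - q))%R).
- rewrite -[E in leRHS]fineK// -EFinM lee_fin le_eqVlt; apply/orP; left; apply/eqP; ring.
- by move=> k; rewrite !mulr_ge0// ?exprn_ge0// ?fine_ge0// ltW.
- by apply: cvg_geometric_series; rewrite ger0_norm.
Qed.

Local Notation occupationX := (occupation P X D).

Lemma killed_ge0 t A x : 0 <= killed t A x. Proof. exact: measure_ge0. Qed.

Lemma early_times (a : R) : early a `<=` times.
Proof. by move=> t; rewrite /early/times/= !in_itv/= andbT => /andP[]. Qed.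

Lemma late_times (a : R) : (0 < a)%R -> late a `<=` times.
Proof. by move=> a0 t; rewrite /late/times/= !in_itv/= !andbT; exact: lt_le_trans. Qed.

Lemma occupation_split a A x : (0 < a)%R -> measurable A ->
  occupationX A x = \int[leb]_(t in early a) killed t A x + \int[leb]_(t in late a) killed t A x.
Proof.
move=> a0 mA; have U : times = early a `|` late a.
  apply/seteqP; split=> t.
    rewrite /early/late/times/= !in_itv/= !andbT => ->/=.
    by have [h|h] := ltP t a; [left|right].
  by case; [exact: early_times|exact: late_times].
rewrite /occupation U.
have mk : measurable_fun (early a `|` late a) (fun t => killed t A x).
  by rewrite -U; exact: (measurable_killed_time HX D x mA).
apply: (ge0_integral_setU leb (measurable_itv _) (measurable_itv _) mk).
- by move=> t _; exact: killed_ge0.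
- apply/disj_setPS => t []; rewrite /early/late/= !in_itv/= andbT => /andP[_ h1] h2.
  by have := lt_le_trans h1 h2; rewrite ltxx.
Qed.

Lemma early_le a A x : (0 < a)%R -> measurable A -> \int[leb]_(t in early a) killed t A x <= a%:E.
Proof.
move=> a0 mA; have me : measurable (early a) by exact: measurable_itv.
apply: (@le_trans _ _ (\int[leb]_(t in early a) 1)).
  apply: ge0_le_integral => //.
  - exact: (measurable_funS (@measurable_times R) (@early_times a) (measurable_killed_time HX D x mA)).
  - by move=> t /early_times; rewrite timesE => /ltW t0; exact: (killed_le1 HX).
rewrite (integral_cst leb me) mul1e [X in X <= _]lebesgue_measure_itv/= lte_fin a0.
by rewrite oppr0 adde0.
Qed.

(** Finiteness is what allows a fraction of the occupation of [Y] to be absorbed in the left-hand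
    side. *)
Lemma occupation_lty A x : measurable A -> occupationX A x < +oo.
Proof.
move=> mA; have [s0 [q [K [s00 _ K0 tail]]]] := tail_bound.
have a0 : (0 < 3 + 0%:R * s0)%R by rewrite mul0r addr0.
rewrite (occupation_split x a0 mA) lte_add_pinfty//.
  by rewrite (le_lt_trans (early_le x a0 mA))// ltry.
apply: le_lt_trans (tail 0%N x A mA) _; rewrite lte_mul_pinfty// ?lee_fin ?mulr_ge0//.
have mm := alive_mass_ge0 mA.
apply: (@le_lt_trans _ _ (1 * alive_massX A)).
  by apply: lee_wpmul2r => //; exact: alive_one_le1.
by rewrite mul1e alive_mass_fin.
Qed.

(** Property A integrated over [A], after the mean exit times have been bounded below by the
    probabilities of surviving one unit of time. *)
Lemma propertyA_occupation : propertyA P X p D -> exists2 c : R, (0 <= c)%R &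
  forall x A, D x -> measurable A -> alive_oneX x * alive_massX A <= c%:E * occupationX A x.
Proof.
(* Property A leaves the sign of [c] open; the representative of the Green function being
   nonnegative, the absolute value will do. *)
move=> [c cP]; exists `|c|%R => // x A Dx mA.
have [gr [[mgr gr0] aegr grI]] := green_spec HX oD Dx.
have a1 y : 0 <= alive_oneX y by exact: nnmeas_alive_one.2.
have nA := nnmeas_alive_indic mA.
have mi : measurable_fun setT (fun y : V => (\1_A y)%:E : \bar R) by apply/measurable_EFinP; exact: measurable_indic.
have mg : measurable_fun setT (fun y => (\1_A y)%:E * gr y) by exact: emeasurable_funM.
have g0 y : 0 <= (\1_A y)%:E * gr y by rewrite mule_ge0// lee_fin.
rewrite /occupation -grI//.
rewrite -(ge0_integralZl (lebT d) measurableT nA.1 (fun y _ => nA.2 y) (a1 x)).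
rewrite -(ge0_integralZl (lebT d) measurableT mg (fun y _ => g0 y)); last by rewrite lee_fin.
apply: ae_ge0_le_integral => //.
- by move=> y _; rewrite mule_ge0//; exact: nA.2.
- by apply: emeasurable_funM => //; exact: nA.1.
- by move=> y _; rewrite mule_ge0.
- exact: emeasurable_funM.
apply: filterS aegr => y gE _; rewrite [leLHS]muleCA [leRHS]muleCA lee_wpmul2l ?lee_fin//.
(* Property A says nothing for [y] outside [D], but there [alive_one] vanishes. *)
have [Dy|nD] := pselect (D y); last by rewrite (alive_one_out nD) mule0 mule_ge0.
apply: (@le_trans _ _ (expected_exit P X D x * expected_exit P X D y)).
  by apply: lee_pmul => //; exact: alive_one_le_exit.
by apply: le_trans (cP x y Dx Dy) _; rewrite gE lee_wpmul2r// lee_fin ler_norm.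
Qed.

End green_estimates.

(** * Comparison of occupation times under Property A *)

Section green_comparison.
Context {R : realType} {d : nat}.
Local Notation V := (d.-tuple R).
Context {dX : measure_display} {OX : measurableType dX} {PX : V -> probability OX R} {X : R -> OX -> V}.
Context {nuX : {measure set V -> \bar R}} {pX : R -> V -> R}.
Context {dY : measure_display} {OY : measurableType dY} {PY : V -> probability OY R} {Y : R -> OY -> V}.
Context {nuY : {measure set V -> \bar R}} {pY : R -> V -> R}.
Hypothesis HX : sym_levy_process PX X nuX pX.
Hypothesis HY : sym_levy_process PY Y nuY pY.
Variable D : set V.
Hypothesis oD : open_Rd D.
Hypothesis bD : bounded_Rd D.
Variable m : R.
Hypothesis m0 : (0 <= m)%R.
Hypothesis killedYX : forall t A x, (0 <= t)%R -> measurable A ->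
  killed PY Y D t A x <= (expR (m * t))%:E * killed PX X D t A x.
Local Notation leb := (@lebesgue_measure R).

Lemma alive_oneYX x : alive_one PY Y D x <= (expR m)%:E * alive_one PX X D x.
Proof. by have := killedYX x ler01 measurableT; rewrite mulr1. Qed.

Lemma alive_massYX A : measurable A -> alive_mass PY Y D A <= (expR m)%:E * alive_mass PX X D A.
Proof.
move=> mA; have nX := nnmeas_alive_indic HX D mA; have nY := nnmeas_alive_indic HY D mA.
rewrite /alive_mass -(ge0_integralZl (lebT d) measurableT nX.1 (fun y _ => nX.2 y)); last by rewrite lee_fin expR_ge0.
apply: ge0_le_integral => //.
- by move=> y _; exact: nY.2.
- exact: nY.1.
- by apply: emeasurable_funM => //; exact: nX.1.
by move=> y _; rewrite [leRHS]muleCA lee_wpmul2l ?lee_fin// alive_oneYX.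
Qed.

Lemma early_comparison a A x : (0 < a)%R -> measurable A ->
  \int[leb]_(t in early a) killed PY Y D t A x <= (expR (m * a))%:E * occupation PX X D A x.
Proof.
move=> a0 mA; have me : measurable (early a) by exact: measurable_itv.
have mkX := measurable_funS (@measurable_times R) (@early_times R a) (measurable_killed_time HX D x mA).
have mkY := measurable_funS (@measurable_times R) (@early_times R a) (measurable_killed_time HY D x mA).
apply: (@le_trans _ _ (\int[leb]_(t in early a) ((expR (m * a))%:E * killed PX X D t A x))).
  apply: ge0_le_integral => //.
  - by apply: emeasurable_funM.
  move=> t; rewrite /early/= in_itv/= => /andP[t0 ta].
  apply: le_trans (killedYX x (ltW t0) mA) _.
  by rewrite lee_wpmul2r ?killed_ge0// lee_fin ler_expR ler_wpM2l// ltW.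
rewrite (ge0_integralZl leb me mkX); [|by move=> t _; exact: killed_ge0|by rewrite lee_fin expR_ge0].
rewrite lee_wpmul2l ?lee_fin ?expR_ge0//.
apply: ge0_subset_integral => //.
- exact: measurable_times.
- exact: (measurable_killed_time HX D x mA).
- exact: early_times.
Qed.

Lemma occupation_comparison : propertyA PX X pX D \/ propertyA PY Y pY D ->
  exists2 C : R, (0 <= C)%R & forall x A, D x -> measurable A ->
    occupation PY Y D A x <= C%:E * occupation PX X D A x.
Proof.
have [s0 [q [K [s00 q01 K0 tail]]]] := tail_bound HY bD; have /andP[q0 q1] := q01.
have aY0 x : 0 <= alive_one PY Y D x by exact: killed_ge0.
have aX0 x : 0 <= alive_one PX X D x by exact: killed_ge0.
have a0 n : (0 < 3 + n%:R * s0)%R by rewrite ltr_pwDl// mulr_ge0// ltW.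
have occ0 x A : 0 <= occupation PX X D A x by apply: integral_ge0 => t _; exact: killed_ge0.
have occY0 x A : 0 <= occupation PY Y D A x by apply: integral_ge0 => t _; exact: killed_ge0.
case=> [/(propertyA_occupation HX oD)|/(propertyA_occupation HY oD)] [c c0 cP].
  (* Property A for [X]: the tail is taken from time 3 on. The two factors [expR m] in the constant
     come from passing to [X] in [alive_one] and in [alive_mass]. *)
  pose a := (3 + 0%:R * s0)%R.
  exists (expR (m * a) + K * (expR m * expR m * c))%R.
    by rewrite addr_ge0 ?expR_ge0// !mulr_ge0 ?expR_ge0.
  move=> x A Dx mA; rewrite (occupation_split HY D x (a0 0%N) mA) EFinD ge0_muleDl ?lee_fin ?expR_ge0//; last first.
    by rewrite !mulr_ge0 ?expR_ge0.
  apply: leeD; first exact: early_comparison.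
  apply: le_trans (tail 0%N x A mA) _; rewrite expr0 mulr1 EFinM -muleA lee_wpmul2l ?lee_fin//.
  apply: (@le_trans _ _ (((expR m)%:E * alive_one PX X D x) * ((expR m)%:E * alive_mass PX X D A))).
    by apply: lee_pmul; [exact: aY0|exact: (alive_mass_ge0 HY D mA)|exact: alive_oneYX|exact: alive_massYX].
  rewrite muleACA -EFinM [X in _ <= X * _]EFinM -muleA lee_wpmul2l ?lee_fin ?mulr_ge0 ?expR_ge0//.
  exact: cP.
(* Property A for [Y]: the tail must weigh at most half of the whole occupation, and cancelling this
   half gives the factor 2 in the constant. *)
have [n nP] : exists n, (K * c * q ^+ n <= 2^-1)%R.
  have : (K * c * q ^+ n)%R @[n --> \oo] --> (K * c * 0)%R.
    by apply: cvgMl_tmp; apply: cvg_expr; rewrite ger0_norm.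
  rewrite mulr0 => /cvgrPdist_le/(_ 2^-1%R ltac:(by [])) [n _ /(_ n (leqnn n))] /= h.
  by exists n; move: h; rewrite sub0r normrN; apply: le_trans; exact: ler_norm.
exists (2 * expR (m * (3 + n%:R * s0)))%R; first by rewrite mulr_ge0 ?expR_ge0.
move=> x A Dx mA; have fin := occupation_lty HY bD x mA.
have e := early_comparison x (a0 n) mA.
have h : occupation PY Y D A x <= (expR (m * (3 + n%:R * s0)))%:E * occupation PX X D A x +
    (2^-1)%:E * occupation PY Y D A x.
  rewrite {1}(occupation_split HY D x (a0 n) mA); apply: leeD => //.
  apply: le_trans (tail n x A mA) _.
  apply: (@le_trans _ _ ((K * q ^+ n)%:E * (c%:E * occupation PY Y D A x))).
    by rewrite lee_wpmul2l ?lee_fin ?mulr_ge0 ?exprn_ge0//; exact: cP.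
  by rewrite muleA -EFinM lee_wpmul2r// lee_fin mulrAC.
(* The occupation of [Y] is a real number and can be subtracted; if the bound on the other side is
   [+oo], there is nothing to prove. *)
rewrite EFinM -muleA; move: h fin; move: (_ * occupation PX X D A x) => g.
have := occY0 x A; case: (occupation PY Y D A x) => [y| |]// y0; case: g => [g| |]//.
  rewrite -!EFinM -EFinD !lee_fin => h _; lra.
by move=> _ _; rewrite mulry gtr0_sg// mul1e leey.
Qed.

End green_comparison.

Lemma ae_leb_lebT {R : realType} {d : nat} (Q : d.-tuple R -> Prop) :
  {ae lebT d, forall y, Q y} -> ae_leb Q.
Proof.
move=> [N [mN N0 QN]]; exists N; split => //; split; first by rewrite lebR_indic.
by move=> y nN; apply: contrapT => nQ; apply: nN; exact: QN.
Qed.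

Local Close Scope ereal_scope.

Theorem mainTheorem10 (R : realType) (d : nat)
  (dX : measure_display) (OX : measurableType dX)
  (PX : d.-tuple R -> probability OX R) (X : R -> OX -> d.-tuple R)
  (nuX : {measure set (d.-tuple R) -> \bar R}) (pX : R -> d.-tuple R -> R)
  (dY : measure_display) (OY : measurableType dY)
  (PY : d.-tuple R -> probability OY R) (Y : R -> OY -> d.-tuple R)
  (nuY : {measure set (d.-tuple R) -> \bar R}) (pY : R -> d.-tuple R -> R)
  (D : set (d.-tuple R)) :
  sym_levy_process PX X nuX pX ->
  sym_levy_process PY Y nuY pY ->
  open_Rd D -> bounded_Rd D ->
  (exists sigma : {measure set (d.-tuple R) -> \bar R},
     (sigma setT < +oo)%E /\
     forall A : set (d.-tuple R), measurable A -> nuX A = (nuY A + sigma A)%E) ->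
  propertyA PX X pX D \/ propertyA PY Y pY D ->
  exists C : R, forall x, D x ->
    ae_leb (fun y => (green PY Y pY D x y <= C%:E * green PX X pX D x y)%E).
Proof.
move=> HX HY oD bD [sg [fsg nuE]] pA.
have m0 : 0 <= fine (symm fsg setT) by rewrite fine_ge0.
have kYX t A x := @killed_le _ _ _ _ _ _ _ _ HX _ _ _ _ _ _ HY _ (law_comparison HX HY fsg nuE) D t A x.
have [C C0 CP] := occupation_comparison HX HY oD bD m0 kYX pA.
exists C => x Dx; apply: ae_leb_lebT.
have [gX [nX aeX IX]] := green_spec HX oD Dx.
have [gY [nY aeY IY]] := green_spec HY oD Dx.
have nCX : nnmeas (fun y => C%:E * gX y)%E.
  split=> [|y]; last by rewrite mule_ge0// ?lee_fin//; exact: nX.2.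
  by apply: emeasurable_funM => //; exact: nX.1.
(* With the measurable representatives, an almost everywhere inequality can be tested on integrals
   over sets, that is, on occupation times. *)
suff : {ae lebT d, forall y, (gY y <= C%:E * gX y)%E}.
  by apply: filterS3 aeX aeY => y -> ->.
apply: ae_le_of_integral => //.
  have := occupation_lty HY bD x measurableT; rewrite /occupation -IY//.
  by apply: le_lt_trans; rewrite le_eqVlt; apply/orP; left; apply/eqP; apply: eq_integral => y _; rewrite indicE in_setT mul1e.
move=> A mA; rewrite IY//; apply: le_trans (CP x A Dx mA) _; rewrite /occupation -IX//.
have mi : measurable_fun setT (fun y : d.-tuple R => (\1_A y)%:E : \bar R) by apply/measurable_EFinP; exact: measurable_indic.
rewrite -ge0_integralZl//.
- by under eq_integral do rewrite muleCA.
- by apply: emeasurable_funM => //; exact: nX.1.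
- by move=> y _; rewrite mule_ge0// ?lee_fin//; exact: nX.2.
Qed.
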